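(* Let $d=0$. For every $0<\gamma\leq\frac1\pi$ there are a minimal and a maximal half-length $L_{\min}(\gamma)$ and $L_{\max}(\gamma)$ for which pinned fluxons exist, such that for every $L\in(L_{\min}(\gamma),L_{\max}(\gamma))$ there are at least two pinned fluxons, and for $L=L_{\min}(\gamma)$ and for $L=L_{\max}(\gamma)$ there is at least one pinned fluxon. Furthermore \[ \lim_{\gamma\downarrow0}L_{\min}(\gamma)=0,\qquad \lim_{\gamma\downarrow0}L_{\max}(\gamma)=\infty, \] and \[ \lim_{\gamma\uparrow1/\pi}L_{\min}(\gamma)=\lim_{\gamma\uparrow1/\pi}L_{\max}(\gamma)=\sqrt{\tfrac\pi2\left(\arcsin\tfrac1\pi+\sqrt{\pi^2-1}\right)}-\sqrt{\tfrac\pi2\left(\arcsin\tfrac1\pi+\sqrt{\pi^2-1}-\pi\right)}\approx 1.8 . \] For given $L\in[L_{\min}(\gamma),L_{\max}(\gamma)]$, the maximum possible number of simultaneously existing pinned fluxons is $6$ (that is, there are never more than $6$, and the number $6$ is attained for some $\gamma$ and $L$). For $\frac1\pi<\gamma\leq1$ there exist no pinned fluxons (for any $L>0$).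
   Context: For $L>0$ (the half-length of the inhomogeneity, whose length is $2L$) and $d\ge 0$ let $D(x;L,d)=d$ for $|x|<L$ and $D(x;L,d)=1$ for $|x|>L$. Let $0\le\gamma\le1$ (applied bias current). A pinned fluxon (for given $L,\gamma,d$) is a function $\phi\in C^1(\mathbb R)$, twice differentiable for $|x|\ne L$, solving \[ \phi_{xx}-D(x;L,d)\sin\phi+\gamma=0\quad(|x|\neq L),\qquad \lim_{x\to-\infty}\phi(x)=\arcsin\gamma,\qquad \lim_{x\to\infty}\phi(x)=\arcsin\gamma+2\pi . \] Two pinned fluxons are counted as distinct if they are distinct functions. *)

(* Defs.v *)
From Stdlib Require Import Reals List.
From Coquelicot Require Import Coquelicot.
Open Scope R_scope.

(* The values at Rabs x = L are immaterial: the equation below is never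
   evaluated there. *)
Definition inhomogeneity (x L d : R) : R := if Rlt_dec (Rabs x) L then d else 1.

Record pinned_fluxon (L gamma d : R) (phi : R -> R) : Prop := {
  pf_diff : forall x : R, ex_derive phi x;
  pf_C1 : forall x : R, continuous (Derive phi) x;
  pf_diff2 : forall x : R, Rabs x <> L -> ex_derive_n phi 2 x;
  pf_eqn : forall x : R, Rabs x <> L ->
    Derive_n phi 2 x - inhomogeneity x L d * sin (phi x) + gamma = 0;
  pf_lim_left : is_lim phi m_infty (asin gamma);
  pf_lim_right : is_lim phi p_infty (asin gamma + 2 * PI)
}.

Definition at_least_fluxons (n : nat) (L gamma d : R) : Prop :=
  exists l : list (R -> R),
    NoDup l /\ List.Forall (pinned_fluxon L gamma d) l /\ length l = n.

Definition pinning_half_length (gamma d L : R) : Prop :=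
  0 < L /\ exists phi : R -> R, pinned_fluxon L gamma d phi.

Definition is_minimum (E : R -> Prop) (m : R) : Prop :=
  E m /\ forall x : R, E x -> m <= x.

Definition is_maximum (E : R -> Prop) (m : R) : Prop :=
  E m /\ forall x : R, E x -> x <= m.

(* Main.v *)
Require Import Defs.
From Stdlib Require Import Reals List Lra Lia Psatz Classical FunctionalExtensionality.
From Coquelicot Require Import Coquelicot.
From Corelib Require Import ssreflect.
Open Scope R_scope.

(** With a = asin gamma and F x = cos a - cos x + gamma (a - x), conservation of
    energy puts the two tails of a fluxon on the level sets phi'^2 = 2 F phi and
    phi'^2 = 2 F (phi - 2 pi).  Across the inhomogeneity phi is a parabola, so a
    fluxon amounts to angles u = phi(-L), v = phi(L) - 2 pi and slopes pin, pout
    with cos v - cos u = 2 pi gamma and 2 gamma L = pin - pout; in particular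
    gamma <= 1/pi.  Here pin = sqrt (2 F u), while pout = +- sqrt (2 F v) with
    pout > 0 for v left of the saddle a.

    The admissible data form three families of curves, each with two sides u and
    2 pi - u: an outer closed curve, an arc of loops (v right of a, pout > 0),
    and a closed curve of humps with v near that point.  On each of them 2 gamma L
    takes every value at most twice, which bounds the number of fluxons by six.
    Indeed it is concave in - cos v on one side of the outer curve, monotone on
    some of the remaining arcs, and on the others its second derivative has a
    fixed sign at all critical points.  The outer curve carries the extreme
    values of L, and by the intermediate value theorem it takes all values in
    between twice. *)

(** The matching relation makes [- cos u] and [- cos v] differ by the constant 2 PI gamma. Entry and
    exit speeds can therefore be differentiated in one common variable, [- cos v], and the slope of
    a length becomes a sum or difference of one function ([kappa]) at the two angles; its
    monotonicity settles the arcs where concavity or monotonicity is claimed. Where this is not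
    enough, only critical points are examined: there the ratio of the two speeds is a known function
    of the sines, so the square roots drop out and a rational inequality in sines and cosines
    remains. Unimodality is stated by comparing three points instead of by derivatives, because
    speeds are not smooth at the saddle and at the turning point and because two arcs are sometimes
    laid end to end. On a closed curve the upper arc is strictly quasiconcave, the lower one
    strictly quasiconvex, and the shared ends exclude a third point on a level. Counting points
    suffices to count fluxons: the entry slope is always the positive root, so the value at -L fixes
    the whole function. *)

Lemma mvt_open (f df : R -> R) (a b : R) :
  a < b ->
  (forall x, a < x < b -> is_derive f x (df x)) ->
  (forall x, a <= x <= b -> continuity_pt f x) ->
  exists c, a < c < b /\ f b - f a = df c * (b - a).
Proof.
intros Hab Hd Hc.
assert (pr1 : forall c, a < c < b -> derivable_pt f c).
{ intros c Hc'. exists (df c). apply is_derive_Reals. now apply Hd. }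
assert (pr2 : forall c : R, a < c < b -> derivable_pt id c).
{ intros c _. apply derivable_pt_id. }
destruct (MVT f id a b pr1 pr2 Hab Hc) as [c [Pc HE]].
{ intros c _. apply derivable_continuous_pt, derivable_pt_id. }
exists c. split; [exact Pc|].
rewrite (derive_pt_eq_0 _ _ _ (pr1 c Pc)
  (proj1 (is_derive_Reals f c (df c)) (Hd c Pc))) in HE.
rewrite (derive_pt_eq_0 _ _ _ (pr2 c Pc) (derivable_pt_lim_id c)) in HE.
unfold id in HE. lra.
Qed.

Lemma derive_neg_lt (f df : R -> R) (a b : R) :
  a < b ->
  (forall x, a < x < b -> is_derive f x (df x)) ->
  (forall x, a <= x <= b -> continuity_pt f x) ->
  (forall x, a < x < b -> df x < 0) -> f b < f a.
Proof.
intros Hab Hd Hc Hp.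
destruct (mvt_open f df a b Hab Hd Hc) as [c [Pc HE]].
specialize (Hp c Pc). nra.
Qed.

Lemma is_derive_continuity (f : R -> R) (x l : R) :
  is_derive f x l -> continuity_pt f x.
Proof.
intros H. apply derivable_continuous_pt. exists l. now apply is_derive_Reals.
Qed.

Lemma continuity_pt_cst (c x : R) : continuity_pt (fun _ => c) x.
Proof. now apply continuity_pt_const. Qed.

Lemma derive_neg_lt_closed (f df : R -> R) (a b : R) :
  a < b ->
  (forall x, a <= x <= b -> is_derive f x (df x)) ->
  (forall x, a < x < b -> df x < 0) -> f b < f a.
Proof.
intros Hab Hd Hp.
apply (derive_neg_lt f df a b Hab); [|intros x Hx; eapply is_derive_continuity, Hd|]; auto.
intros x Hx; apply Hd; lra.
Qed.

Lemma derive_pos_lt_closed (f df : R -> R) (a b : R) :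
  a < b ->
  (forall x, a <= x <= b -> is_derive f x (df x)) ->
  (forall x, a < x < b -> 0 < df x) -> f a < f b.
Proof.
intros Hab Hd Hp.
enough (- f b < - f a) by lra.
apply (derive_neg_lt_closed (fun x => - f x) (fun x => - df x) a b Hab).
- intros x Hx. now apply: is_derive_opp; apply Hd.
- intros x Hx. specialize (Hp x Hx). lra.
Qed.

(** * Unimodal functions and the size of their level sets *)

Definition quasiconcave (f : R -> R) (a b : R) : Prop :=
  forall x y z, a <= x -> x < y -> y < z -> z <= b -> Rmin (f x) (f z) < f y.

Definition quasiconvex (f : R -> R) (a b : R) : Prop :=
  forall x y z, a <= x -> x < y -> y < z -> z <= b -> f y < Rmax (f x) (f z).

(** The mean slope over the interval is a weighted average of the mean slopes on the two sides of
    [m], so one intermediate slope lies below it and one above. Equality may fail when [m] is a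
    corner. *)
Lemma mvt_except (f df : R -> R) (m a b : R) :
  a < b ->
  (forall x, a < x < b -> x <> m -> is_derive f x (df x)) ->
  (forall x, a <= x <= b -> continuity_pt f x) ->
  (exists c1, a < c1 < b /\ c1 <> m /\ df c1 * (b - a) <= f b - f a) /\
  (exists c2, a < c2 < b /\ c2 <> m /\ f b - f a <= df c2 * (b - a)).
Proof.
intros Hab Hd Hc.
destruct (classic (a < m < b)) as [Hm|Hm].
- destruct (mvt_open f df a m) as [c1 [Pc1 E1]]; [lra| | |].
  { intros x Hx; apply Hd; lra. }
  { intros x Hx; apply Hc; lra. }
  destruct (mvt_open f df m b) as [c2 [Pc2 E2]]; [lra| | |].
  { intros x Hx; apply Hd; lra. }
  { intros x Hx; apply Hc; lra. }
  assert (E : f b - f a = df c1 * (m - a) + df c2 * (b - m)) by lra.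
  destruct (Rle_dec (df c1) (df c2)) as [H|H].
  + split; [exists c1|exists c2]; repeat split; try lra; nra.
  + split; [exists c2|exists c1]; repeat split; try lra; nra.
- destruct (mvt_open f df a b Hab) as [c [Pc E]].
  { intros x Hx; apply Hd; lra. }
  { exact Hc. }
  split; exists c; repeat split; lra.
Qed.

(** A middle value not above the smaller outer one produces a slope <= 0 followed by a slope >= 0,
    which is the excluded pattern. The exceptional point [m] will be the saddle, the turning point
    or the junction of two arcs. *)
Lemma quasiconcave_of_derive (f df : R -> R) (m a b : R) :
  (forall x, a < x < b -> x <> m -> is_derive f x (df x)) ->
  (forall x, a <= x <= b -> continuity_pt f x) ->
  (forall x1 x2, a < x1 -> x1 < x2 -> x2 < b -> x1 <> m -> x2 <> m ->
     df x1 <= 0 -> 0 <= df x2 -> False) ->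
  quasiconcave f a b.
Proof.
intros Hd Hc Hs x y z Hax Hxy Hyz Hzb.
destruct (Rlt_dec (Rmin (f x) (f z)) (f y)) as [|Hn]; [easy|exfalso].
apply Rnot_lt_le in Hn.
assert (f y <= f x) by (eapply Rle_trans; [exact Hn|apply Rmin_l]).
assert (f y <= f z) by (eapply Rle_trans; [exact Hn|apply Rmin_r]).
destruct (mvt_except f df m x y Hxy) as [[c1 [P1 [M1 E1]]] _].
{ intros t Ht; apply Hd; lra. }
{ intros t Ht; apply Hc; lra. }
destruct (mvt_except f df m y z Hyz) as [_ [c2 [P2 [M2 E2]]]].
{ intros t Ht; apply Hd; lra. }
{ intros t Ht; apply Hc; lra. }
apply (Hs c1 c2); try lra; nra.
Qed.

Lemma quasiconvex_opp (f : R -> R) (a b : R) :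
  quasiconvex f a b <-> quasiconcave (fun x => - f x) a b.
Proof.
split; intros H x y z h1 h2 h3 h4; specialize (H x y z h1 h2 h3 h4);
  revert H; unfold Rmin, Rmax;
  destruct (Rle_dec (f x) (f z)), (Rle_dec (- f x) (- f z)); lra.
Qed.

Lemma quasiconvex_of_derive (f df : R -> R) (m a b : R) :
  (forall x, a < x < b -> x <> m -> is_derive f x (df x)) ->
  (forall x, a <= x <= b -> continuity_pt f x) ->
  (forall x1 x2, a < x1 -> x1 < x2 -> x2 < b -> x1 <> m -> x2 <> m ->
     0 <= df x1 -> df x2 <= 0 -> False) ->
  quasiconvex f a b.
Proof.
intros Hd Hc Hs. apply quasiconvex_opp.
apply (quasiconcave_of_derive _ (fun x => - df x) m).
- intros x Hx N. apply: is_derive_opp. now apply Hd.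
- intros x Hx. now apply continuity_pt_opp, Hc.
- intros x1 x2 H1 H12 H2 N1 N2 S1 S2. apply (Hs x1 x2); easy || lra.
Qed.

Lemma derive_pos_right (f : R -> R) (x l : R) :
  is_derive f x l -> 0 < l ->
  exists d, 0 < d /\ forall t, x < t < x + d -> f x < f t.
Proof.
intros Hd Hl. apply is_derive_Reals in Hd.
destruct (Hd (l / 2)) as [d Hd']; [lra|].
exists d. split; [apply cond_pos|]. intros t Ht.
specialize (Hd' (t - x)).
replace (x + (t - x)) with t in Hd' by ring.
assert (H : Rabs ((f t - f x) / (t - x) - l) < l / 2).
{ apply Hd'; [lra|]. rewrite Rabs_pos_eq; lra. }
apply Rabs_def2 in H. destruct H as [_ H].
assert (H2 : 0 < (f t - f x) / (t - x)) by lra.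
assert (f t - f x = (f t - f x) / (t - x) * (t - x)) by (field; lra).
assert (0 < (f t - f x) / (t - x) * (t - x)) by (apply Rmult_lt_0_compat; lra).
lra.
Qed.

Lemma derive_pos_left (f : R -> R) (x l : R) :
  is_derive f x l -> 0 < l ->
  exists d, 0 < d /\ forall t, x - d < t < x -> f t < f x.
Proof.
intros Hd Hl. apply is_derive_Reals in Hd.
destruct (Hd (l / 2)) as [d Hd']; [lra|].
exists d. split; [apply cond_pos|]. intros t Ht.
specialize (Hd' (t - x)).
replace (x + (t - x)) with t in Hd' by ring.
assert (H : Rabs ((f t - f x) / (t - x) - l) < l / 2).
{ apply Hd'; [lra|]. rewrite Rabs_left; lra. }
apply Rabs_def2 in H. destruct H as [_ H].
assert (H2 : 0 < (f t - f x) / (t - x)) by lra.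
assert (f t - f x = (f t - f x) / (t - x) * (t - x)) by (field; lra).
assert (0 < (f t - f x) / (t - x) * (x - t)) by (apply Rmult_lt_0_compat; lra).
lra.
Qed.

(** The zero is the supremum of the initial segments on which [f] stays positive. Beyond the
    intermediate value theorem this keeps the sign before the zero, as arguments about a first
    turning time require. *)
Lemma first_zero (f : R -> R) (a b : R) :
  a < b -> (forall x, a <= x <= b -> continuity_pt f x) ->
  0 < f a -> f b <= 0 ->
  exists c, a < c <= b /\ f c = 0 /\ forall t, a <= t < c -> 0 < f t.
Proof.
intros Hab Hc Ha Hb.
set (E := fun x => a <= x <= b /\ forall t, a <= t <= x -> 0 < f t).
destruct (completeness E) as [c [Hub Hlub]].
{ exists b. intros x [Hx _]. lra. }
{ exists a. split; [lra|]. intros t Ht. replace t with a by lra. exact Ha. }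
assert (Hac : a <= c).
{ apply Hub. split; [lra|]. intros t Ht. replace t with a by lra. exact Ha. }
assert (Hcb : c <= b). { apply Hlub. intros x [Hx _]; lra. }
assert (Hpos : forall t, a <= t < c -> 0 < f t).
{ intros t Ht.
  destruct (classic (exists x, E x /\ t < x)) as [[x [[Hx Hx'] Htx]]|Hn].
  - apply Hx'; lra.
  - exfalso. assert (c <= t); [|lra]. apply Hlub. intros x Hx.
    apply Rnot_lt_le. intros Htx. apply Hn. now exists x. }
assert (Hcc := Hc c (conj Hac Hcb)).
assert (Hfc : f c = 0).
{ destruct (Rtotal_order (f c) 0) as [H|[H|H]]; [exfalso|exact H|exfalso].
  - destruct (Hcc (- f c / 2)) as [d [Hd Hd']]; [lra|].
    assert (a < c). { destruct Hac; [easy|]. subst. lra. }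
    set (t := Rmax a (c - d / 2)).
    assert (a <= t) by apply Rmax_l.
    assert (c - d / 2 <= t) by apply Rmax_r.
    assert (t < c) by (apply Rmax_lub_lt; lra).
    assert (Ht := Hpos t (conj H1 H3)).
    specialize (Hd' t). simpl in Hd'. unfold R_dist in Hd'.
    assert (Rabs (f t - f c) < - f c / 2).
    { apply Hd'. repeat split; [lra|]. rewrite Rabs_left; lra. }
    apply Rabs_def2 in H4. lra.
  - destruct (Hcc (f c / 2)) as [d [Hd Hd']]; [lra|].
    assert (c < b). { destruct Hcb; [easy|]. subst. lra. }
    set (x := Rmin b (c + d / 2)).
    assert (x <= b) by apply Rmin_l.
    assert (x <= c + d / 2) by apply Rmin_r.
    assert (c < x) by (apply Rmin_glb_lt; lra).
    assert (E x).
    { split; [lra|]. intros t Ht.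
      destruct (Rlt_dec t c) as [Htc|Htc]; [apply Hpos; lra|].
      destruct (Req_dec t c) as [Htc1|Htc1]; [now rewrite Htc1|].
      specialize (Hd' t). simpl in Hd'. unfold R_dist in Hd'.
      assert (Rabs (f t - f c) < f c / 2).
      { apply Hd'. repeat split; [lra|]. rewrite Rabs_pos_eq; lra. }
      apply Rabs_def2 in H4. lra. }
    assert (x <= c) by now apply Hub. lra. }
exists c. repeat split; try lra; auto.
destruct Hac; [easy|]. subst. lra.
Qed.

(** At the first return to zero [D] would come from positive values although its derivative there is
    positive, which makes it negative just before. *)
Lemma zero_crossing_up (D dD : R -> R) (x1 x2 : R) :
  x1 < x2 ->
  (forall t, x1 <= t <= x2 -> is_derive D t (dD t)) ->
  (forall t, x1 <= t <= x2 -> D t = 0 -> 0 < dD t) ->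
  0 <= D x1 -> 0 < D x2.
Proof.
intros H12 Hd Hz H1.
apply Rnot_le_lt. intros H2.
assert (Hc : forall t, x1 <= t <= x2 -> continuity_pt D t).
{ intros t Ht. eapply is_derive_continuity, Hd, Ht. }
(* If [D x1 = 0], the start is moved slightly to the right, where the positive derivative has
   already made [D] positive. *)
assert (exists x, x1 <= x < x2 /\ 0 < D x) as [x [Hx Dx]].
{ destruct H1 as [H1|H1]; [exists x1; lra|].
  destruct (derive_pos_right D x1 (dD x1)) as [d [Hd0 Hd1]].
  - apply Hd; lra.
  - apply Hz; lra.
  - set (t := Rmin ((x1 + x2) / 2) (x1 + d / 2)).
    assert (t <= (x1 + x2) / 2) by apply Rmin_l.
    assert (t <= x1 + d / 2) by apply Rmin_r.
    assert (x1 < t) by (apply Rmin_glb_lt; lra).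
    exists t. split; [lra|]. rewrite H1. apply Hd1. lra. }
destruct (first_zero D x x2) as [c [Hc1 [Hc2 Hc3]]]; try lra.
{ intros t Ht. apply Hc; lra. }
destruct (derive_pos_left D c (dD c)) as [d [Hd0 Hd1]].
- apply Hd; lra.
- apply Hz; lra.
- set (t := Rmax x (c - d / 2)).
  assert (x <= t) by apply Rmax_l.
  assert (c - d / 2 <= t) by apply Rmax_r.
  assert (t < c) by (apply Rmax_lub_lt; lra).
  assert (D t < D c) by (apply Hd1; lra).
  assert (0 < D t) by (apply Hc3; lra). lra.
Qed.

Lemma quasiconcave_level3 (f : R -> R) (a b l x y z : R) :
  quasiconcave f a b ->
  a <= x <= b -> a <= y <= b -> a <= z <= b ->
  f x = l -> f y = l -> f z = l -> x <> y -> x <> z -> y <> z -> False.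
Proof.
intros H Hx Hy Hz Ex Ey Ez Nxy Nxz Nyz.
assert (K : forall x y z, a <= x -> x < y -> y < z -> z <= b ->
  f x = l -> f y = l -> f z = l -> False).
{ clear - H. intros x y z h1 h2 h3 h4 e1 e2 e3.
  specialize (H x y z h1 h2 h3 h4). rewrite e1 e2 e3 Rmin_left in H; lra. }
destruct (Rlt_dec x y), (Rlt_dec x z), (Rlt_dec y z);
  first [ apply (K x y z); lra | apply (K x z y); lra | apply (K y x z); lra
        | apply (K y z x); lra | apply (K z x y); lra | apply (K z y x); lra | lra ].
Qed.

Lemma quasiconvex_level3 (f : R -> R) (a b l x y z : R) :
  quasiconvex f a b ->
  a <= x <= b -> a <= y <= b -> a <= z <= b ->
  f x = l -> f y = l -> f z = l -> x <> y -> x <> z -> y <> z -> False.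
Proof.
intros H Hx Hy Hz Ex Ey Ez.
apply (quasiconcave_level3 (fun x => - f x) a b (- l) x y z); auto; try lra.
now apply quasiconvex_opp.
Qed.

Lemma quasiconcave_level2 (f : R -> R) (a b l x y : R) :
  quasiconcave f a b ->
  a <= x <= b -> a <= y <= b -> f x = l -> f y = l -> x <> y ->
  f a <= l /\ f b <= l.
Proof.
intros H Hx Hy Ex Ey Nxy.
assert (K : forall x y, a <= x -> x < y -> y <= b -> f x = l -> f y = l ->
  f a <= l /\ f b <= l).
{ clear - H. intros x y h1 h2 h3 e1 e2. split.
  - destruct h1 as [h1|h1]; [|rewrite h1; lra].
    specialize (H a x y (Rle_refl a) h1 h2 h3).
    unfold Rmin in H. destruct (Rle_dec (f a) (f y)); lra.
  - destruct h3 as [h3|h3]; [|rewrite <- h3; lra].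
    specialize (H x y b h1 h2 h3 (Rle_refl b)).
    unfold Rmin in H. destruct (Rle_dec (f x) (f b)); lra. }
destruct (Rlt_dec x y); [apply (K x y)|apply (K y x)]; lra.
Qed.

Lemma quasiconvex_level2 (f : R -> R) (a b l x y : R) :
  quasiconvex f a b ->
  a < x < b -> a < y < b -> f x = l -> f y = l -> x <> y ->
  l < f a /\ l < f b.
Proof.
intros H Hx Hy Ex Ey Nxy.
assert (K : forall x y, a < x -> x < y -> y < b -> f x = l -> f y = l ->
  l < f a /\ l < f b).
{ clear - H. intros x y h1 h2 h3 e1 e2. split.
  - specialize (H a x y (Rle_refl a) h1 h2 (Rlt_le _ _ h3)).
    unfold Rmax in H. destruct (Rle_dec (f a) (f y)); lra.
  - specialize (H x y b (Rlt_le _ _ h1) h2 h3 (Rle_refl b)).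
    unfold Rmax in H. destruct (Rle_dec (f x) (f b)); lra. }
destruct (Rlt_dec x y); [apply (K x y)|apply (K y x)]; lra.
Qed.

Lemma quasiconcave_ge_ends (f : R -> R) (a b x : R) :
  quasiconcave f a b -> a <= x <= b -> Rmin (f a) (f b) <= f x.
Proof.
intros H [[Hx|Hx] [Hx'|Hx']]; try (rewrite <- Hx; apply Rmin_l);
  try (rewrite Hx'; apply Rmin_r).
left. apply H; lra.
Qed.

(* Points of a closed curve made of two arcs with common end points, which are
   counted on the first arc. *)
Definition on_arc (f g : R -> R) (a b l : R) (s : bool) (x : R) : Prop :=
  if s then a <= x <= b /\ f x = l else a < x < b /\ g x = l.

(** Two points of the upper arc on level [l] put both ends at or below [l], whereas the interior of
    the lower arc stays strictly below the larger end. Two points of the lower arc put both ends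
    strictly above [l], whereas the upper arc never goes below the smaller end. *)
Lemma closed_curve_level3 (f g : R -> R) (a b l : R) (s1 s2 s3 : bool) (x1 x2 x3 : R) :
  quasiconcave f a b -> quasiconvex g a b -> f a = g a -> f b = g b ->
  on_arc f g a b l s1 x1 -> on_arc f g a b l s2 x2 -> on_arc f g a b l s3 x3 ->
  (s1, x1) <> (s2, x2) -> (s1, x1) <> (s3, x3) -> (s2, x2) <> (s3, x3) -> False.
Proof.
intros Hf Hg Ea Eb.
assert (K1 : forall x y z, on_arc f g a b l true x -> on_arc f g a b l true y ->
  on_arc f g a b l false z -> x <> y -> False).
{ intros x y z [Hx Ex] [Hy Ey] [Hz Ez] N.
  destruct (quasiconcave_level2 f a b l x y Hf Hx Hy Ex Ey N) as [La Lb].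
  assert (H : g z < Rmax (g a) (g b)) by (apply Hg; lra).
  rewrite <- Ea, <- Eb in H. revert H. unfold Rmax. destruct (Rle_dec (f a) (f b)); lra. }
assert (K2 : forall x y z, on_arc f g a b l true x -> on_arc f g a b l false y ->
  on_arc f g a b l false z -> y <> z -> False).
{ intros x y z [Hx Ex] [Hy Ey] [Hz Ez] N.
  destruct (quasiconvex_level2 g a b l y z Hg Hy Hz Ey Ez N) as [La Lb].
  assert (H := quasiconcave_ge_ends f a b x Hf Hx).
  revert H. unfold Rmin. destruct (Rle_dec (f a) (f b)); lra. }
intros H1 H2 H3 N12 N13 N23.
assert (M : forall (s : bool) (x y : R), (s, x) <> (s, y) -> x <> y).
{ intros s x y N E. apply N. now rewrite E. }
destruct s1, s2, s3.
- destruct H1, H2, H3. apply (quasiconcave_level3 f a b l x1 x2 x3); eauto.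
- apply (K1 x1 x2 x3); eauto.
- apply (K1 x1 x3 x2); eauto.
- apply (K2 x1 x2 x3); eauto.
- apply (K1 x2 x3 x1); eauto.
- apply (K2 x2 x1 x3); eauto.
- apply (K2 x3 x1 x2); eauto.
- destruct H1, H2, H3. apply (quasiconvex_level3 g a b l x1 x2 x3); eauto; lra.
Qed.

(** * The outer equation *)

Definition pendulum (g : R) (y z : R -> R) : Prop :=
  forall t, is_derive y t (z t) /\ is_derive z t (sin (y t) - g).

Lemma is_derive_sub (f h : R -> R) (t a b : R) :
  is_derive f t a -> is_derive h t b -> is_derive (fun s => f s - h s) t (a - b).
Proof. apply: is_derive_minus. Qed.

(** * Global existence and uniqueness for the pendulum equation *)

Fixpoint picard (g v p : R) (n : nat) : (R -> R) * (R -> R) :=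
  match n with
  | O => (fun _ => v, fun _ => p)
  | S n => (fun t => v + RInt (snd (picard g v p n)) 0 t,
            fun t => p + RInt (fun s => sin (fst (picard g v p n) s) - g) 0 t)
  end.

Lemma is_derive_RInt_continuous (c : R) (f : R -> R) (t : R) :
  (forall s, continuous f s) ->
  is_derive (fun t => c + RInt f 0 t) t (f t).
Proof.
intros Hf.
replace (f t) with (0 + f t) by ring.
apply (is_derive_plus (fun _ => c) (fun t => RInt f 0 t)).
- apply (is_derive_const c t).
- apply is_derive_RInt with (a := 0); [|apply Hf].
  apply filter_forall. intros b. apply: (@RInt_correct R_CompleteNormedModule).
  apply: (@ex_RInt_continuous R_CompleteNormedModule). intros; apply Hf.
Qed.

Lemma continuous_sin_minus (f : R -> R) (g t : R) :
  continuous f t -> continuous (fun s => sin (f s) - g) t.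
Proof.
intros Hf. apply (continuous_minus (fun s => sin (f s)) (fun _ => g)).
- apply continuous_comp; [exact Hf|apply continuous_sin].
- apply continuous_const.
Qed.

Lemma picard_continuous (g v p : R) (n : nat) (t : R) :
  continuous (fst (picard g v p n)) t /\ continuous (snd (picard g v p n)) t.
Proof.
revert t. induction n as [|n IH]; intros t; simpl.
- split; apply continuous_const.
- split.
  + apply: ex_derive_continuous. eexists. apply is_derive_RInt_continuous.
    intros s. exact (proj2 (IH s)).
  + apply: ex_derive_continuous. eexists.
    apply (is_derive_RInt_continuous p (fun s => sin (fst (picard g v p n) s) - g)).
    intros s. apply continuous_sin_minus. exact (proj1 (IH s)).
Qed.

Lemma picard_derive (g v p : R) (n : nat) (t : R) :
  is_derive (fst (picard g v p (S n))) t (snd (picard g v p n) t) /\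
  is_derive (snd (picard g v p (S n))) t (sin (fst (picard g v p n) t) - g).
Proof.
split; simpl.
- apply is_derive_RInt_continuous. intros s. exact (proj2 (picard_continuous g v p n s)).
- apply (is_derive_RInt_continuous p (fun s => sin (fst (picard g v p n) s) - g)).
  intros s. apply continuous_sin_minus. exact (proj1 (picard_continuous g v p n s)).
Qed.

Lemma picard_0 (g v p : R) (n : nat) :
  fst (picard g v p n) 0 = v /\ snd (picard g v p n) 0 = p.
Proof.
destruct n; simpl; [easy|]. rewrite !RInt_point. unfold zero; simpl. split; ring.
Qed.

(** In the norm weighted by [exp (2 * Rabs t)] integration from 0 halves the constant. Since the
    vector field has Lipschitz constant 1, Picard iteration then contracts by 1/2 on the whole line,
    with no restriction to short times. *)
Lemma exp_growth_integrate (f df : R -> R) (K : R) :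
  f 0 = 0 -> (forall t, is_derive f t (df t)) ->
  (forall t, Rabs (df t) <= K * exp (2 * Rabs t)) ->
  forall t, Rabs (f t) <= K / 2 * exp (2 * Rabs t).
Proof.
(* This one-sided bound for positive times is the core; [- f] gives the absolute value and
   [fun t => f (- t)] the negative times. *)
assert (Hpos : forall f df : R -> R,
  f 0 = 0 -> (forall t, 0 <= t -> is_derive f t (df t)) ->
  (forall t, 0 <= t -> df t <= K * exp (2 * t)) ->
  forall t, 0 < t -> f t <= K / 2 * exp (2 * t) - K / 2).
{ clear. intros f df H0 Hd Hb t Ht.
  destruct (mvt_open (fun t => f t - K / 2 * exp (2 * t))
    (fun t => df t - K * exp (2 * t)) 0 t Ht) as [c [Hc E]].
  - intros x Hx. apply is_derive_sub; [apply Hd; lra|].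
    auto_derive; [easy|field].
  - intros x Hx. eapply is_derive_continuity.
    apply is_derive_sub; [apply Hd; lra|].
    auto_derive; [easy|reflexivity].
  - specialize (Hb c). rewrite H0 Rmult_0_r exp_0 in E.
    assert ((df c - K * exp (2 * c)) * (t - 0) <= 0); [|lra].
    assert (df c - K * exp (2 * c) <= 0) by (assert (0 <= c) by lra; specialize (Hb H); lra).
    nra. }
intros H0 Hd Hb t.
assert (Habs : forall f df : R -> R, f 0 = 0 -> (forall t, is_derive f t (df t)) ->
  (forall t, 0 <= t -> Rabs (df t) <= K * exp (2 * t)) ->
  forall t, 0 < t -> Rabs (f t) <= K / 2 * exp (2 * t)).
{ clear - Hpos. intros f df H0 Hd Hb t Ht.
  assert (HK : 0 <= K).
  { specialize (Hb 0 (Rle_refl 0)). rewrite Rmult_0_r exp_0 in Hb.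
    assert (H := Rabs_pos (df 0)). lra. }
  assert (Hb' : forall t, 0 <= t -> - (K * exp (2 * t)) <= df t <= K * exp (2 * t)).
  { intros u Hu. now apply Rabs_le_between, Hb. }
  assert (B1 := Hpos f df H0 (fun u _ => Hd u) (fun u Hu => proj2 (Hb' u Hu)) t Ht).
  assert (B2 := Hpos (fun t => - f t) (fun t => - df t) ltac:(simpl; lra)
    ltac:(intros u _; apply: is_derive_opp; apply Hd)
    ltac:(intros u Hu; specialize (Hb' u Hu); lra) t Ht).
  simpl in B2. apply Rabs_le. lra. }
destruct (Rtotal_order t 0) as [Ht|[->|Ht]].
- rewrite (Rabs_left t Ht) -{1}(Ropp_involutive t).
  apply (Habs (fun t => f (- t)) (fun t => - df (- t))); [now rewrite Ropp_0| | |lra].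
  + intros u. auto_derive; [eexists; apply Hd|].
    rewrite (is_derive_unique _ _ _ (Hd (- u))). ring.
  + intros u Hu. rewrite Rabs_Ropp -{2}(Rabs_pos_eq u Hu) -(Rabs_Ropp u). apply Hb.
- specialize (Hb 0). rewrite H0 Rabs_R0 Rmult_0_r exp_0 in Hb |- *.
  assert (H := Rabs_pos (df 0)). lra.
- rewrite (Rabs_pos_eq t (Rlt_le _ _ Ht)). apply (Habs f df); auto.
  intros u Hu. rewrite -{2}(Rabs_pos_eq u Hu). apply Hb.
Qed.

Lemma sin_lipschitz (x y : R) : Rabs (sin x - sin y) <= Rabs (x - y).
Proof.
destruct (MVT_gen sin y x cos) as [c [_ E]].
- intros t _. apply is_derive_sin.
- intros t _. apply continuity_sin.
- rewrite E Rabs_mult. assert (H := COS_bound c).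
  assert (Rabs (cos c) <= 1) by (apply Rabs_le; lra).
  assert (H2 := Rabs_pos (x - y)). nra.
Qed.

(** The first step changes the components at rates [p] and [sin v - g], bounded by [Rabs p] and
    [1 + Rabs g]; their sum serves for both components, which feed into each other at every later
    step. *)
Lemma picard_step (g v p : R) (n : nat) (t : R) :
  let K := (Rabs p + (1 + Rabs g)) * (/ 2) ^ n in
  Rabs (fst (picard g v p (S n)) t - fst (picard g v p n) t) <= K * exp (2 * Rabs t) /\
  Rabs (snd (picard g v p (S n)) t - snd (picard g v p n) t) <= K * exp (2 * Rabs t).
Proof.
revert t. induction n as [|n IH]; intros t K.
- assert (Hp := Rabs_pos p). assert (Hg := Rabs_pos g).
  assert (He : forall t, 1 <= exp (2 * Rabs t)).
  { intros s. assert (H := exp_ineq1_le (2 * Rabs s)). assert (H' := Rabs_pos s). lra. }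
  unfold K. rewrite pow_O Rmult_1_r.
  split; eapply Rle_trans.
  + apply (exp_growth_integrate (fun t => fst (picard g v p 1) t - v) (fun _ => p) (Rabs p)).
    * rewrite (proj1 (picard_0 g v p 1)). ring.
    * intros s. rewrite -[X in is_derive _ _ X](Rminus_0_r p).
      apply is_derive_sub; [exact (proj1 (picard_derive g v p 0 s))|apply: is_derive_const].
    * intros s. specialize (He s). nra.
  + specialize (He t). nra.
  + apply (exp_growth_integrate (fun t => snd (picard g v p 1) t - p) (fun _ => sin v - g) (1 + Rabs g)).
    * rewrite (proj2 (picard_0 g v p 1)). ring.
    * intros s. rewrite -[X in is_derive _ _ X]Rminus_0_r.
      apply is_derive_sub; [exact (proj2 (picard_derive g v p 0 s))|apply: is_derive_const].
    * intros s. specialize (He s).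
      assert (Rabs (sin v - g) <= 1 + Rabs g).
      { eapply Rle_trans; [apply Rabs_triang|]. rewrite Rabs_Ropp.
        assert (H := SIN_bound v). assert (Rabs (sin v) <= 1) by (apply Rabs_le; lra). lra. }
      nra.
  + specialize (He t). nra.
- assert (EK : K = (Rabs p + (1 + Rabs g)) * (/ 2) ^ n / 2) by (unfold K; simpl; field).
  rewrite EK.
  split.
  + apply (exp_growth_integrate
      (fun t => fst (picard g v p (S (S n))) t - fst (picard g v p (S n)) t)
      (fun t => snd (picard g v p (S n)) t - snd (picard g v p n) t)).
    * rewrite !(proj1 (picard_0 _ _ _ _)). ring.
    * intros s. apply is_derive_sub; apply (proj1 (picard_derive g v p _ s)).
    * intros s. apply IH.
  + apply (exp_growth_integrate
      (fun t => snd (picard g v p (S (S n))) t - snd (picard g v p (S n)) t)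
      (fun t => (sin (fst (picard g v p (S n)) t) - g) - (sin (fst (picard g v p n) t) - g))).
    * rewrite !(proj2 (picard_0 _ _ _ _)). ring.
    * intros s. apply is_derive_sub; apply (proj2 (picard_derive g v p _ s)).
    * intros s. eapply Rle_trans; [|apply (proj1 (IH s))].
      eapply Rle_trans; [|apply sin_lipschitz]. right. f_equal. ring.
Qed.

Lemma geometric_cauchy (u : nat -> R) (C : R) :
  (forall n, Rabs (u (S n) - u n) <= C * (/ 2) ^ n) ->
  forall n m, (n <= m)%nat -> Rabs (u m - u n) <= 2 * C * (/ 2) ^ n.
Proof.
intros H n m Hnm.
assert (HC : 0 <= C).
{ specialize (H 0%nat). simpl in H. assert (H' := Rabs_pos (u 1%nat - u 0%nat)). lra. }
assert (K : Rabs (u m - u n) <= 2 * C * ((/ 2) ^ n - (/ 2) ^ m)).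
{ induction Hnm as [|m Hnm IH].
  - rewrite !Rminus_diag Rabs_R0. lra.
  - replace (u (S m) - u n) with ((u (S m) - u m) + (u m - u n)) by ring.
    eapply Rle_trans; [apply Rabs_triang|]. specialize (H m). simpl. lra. }
eapply Rle_trans; [exact K|].
assert (0 < (/ 2) ^ m) by (apply pow_lt; lra). nra.
Qed.

Lemma CVU_geometric (fn : nat -> R -> R) (C T : R) :
  (forall n t, Rabs (fn (S n) t - fn n t) <= C * (/ 2) ^ n * exp (2 * Rabs t)) ->
  CVU_cauchy fn (fun t => Rabs t < T).
Proof.
intros H eps.
assert (HC : 0 <= C).
{ specialize (H 0%nat 0). rewrite Rabs_R0 Rmult_0_r exp_0 in H. simpl in H.
  assert (H' := Rabs_pos (fn 1%nat 0 - fn 0%nat 0)). lra. }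
(* The added 1 keeps [M] positive when [C = 0]. *)
set (M := 2 * (C * exp (2 * T)) + 1).
assert (HM : 0 < M). { unfold M. assert (H' := exp_pos (2 * T)). nra. }
destruct (pow_lt_1_zero (/ 2)) with (y := eps / (2 * M)) as [N HN].
{ rewrite Rabs_pos_eq; lra. }
{ apply Rdiv_lt_0_compat; [apply cond_pos|lra]. }
exists N. intros n m t Ht Hn Hm.
assert (K : forall k, (N <= k)%nat -> Rabs (fn k t - fn N t) < eps / 2).
{ intros k Hk. eapply Rle_lt_trans.
  - apply (geometric_cauchy (fun n => fn n t) (C * exp (2 * T))); [|exact Hk].
    intros j. eapply Rle_trans; [apply H|].
    rewrite !Rmult_assoc. apply Rmult_le_compat_l; [exact HC|].
    rewrite Rmult_comm. apply Rmult_le_compat_r; [apply pow_le; lra|].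
    left. apply exp_increasing. lra.
  - specialize (HN N (le_n N)). rewrite Rabs_pos_eq in HN; [|apply pow_le; lra].
    apply Rle_lt_trans with (M * (/ 2) ^ N).
    { apply Rmult_le_compat_r; [apply pow_le; lra|unfold M; lra]. }
    apply Rlt_le_trans with (M * (eps / (2 * M))).
    { now apply Rmult_lt_compat_l. }
    right. field. lra. }
replace (fn n t - fn m t) with ((fn n t - fn N t) - (fn m t - fn N t)) by ring.
eapply Rle_lt_trans; [apply Rabs_triang|]. rewrite Rabs_Ropp.
assert (K1 := K n Hn). assert (K2 := K m Hm). lra.
Qed.

(** Functions and derivatives converge locally uniformly, so differentiation passes to the limit.
    The index shift is that of the Picard scheme: iterate [S n] is an integral of data of iterate
    [n]. *)
Lemma is_derive_limit (fn dn : nat -> R -> R) (t : R) :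
  (forall T, CVU_cauchy fn (fun s => Rabs s < T)) ->
  (forall T, CVU_cauchy dn (fun s => Rabs s < T)) ->
  (forall n s, is_derive (fn (S n)) s (dn n s)) -> (forall n s, continuous (dn n) s) ->
  is_derive (fun s => real (Lim_seq (fun n => fn n s))) t (real (Lim_seq (fun n => dn n t))).
Proof.
intros Hf Hd D C.
assert (ED : forall n s, Derive (fn (S n)) s = dn n s).
{ intros n s. apply is_derive_unique, D. }
eapply is_derive_ext; [intros s; apply (f_equal real), (Lim_seq_incr_1 (fun n => fn n s))|].
rewrite <- (Lim_seq_ext _ _ (fun n => ED n t)).
apply (CVU_Derive (fun n => fn (S n)) (fun s => Rabs s < Rabs t + 1)).
- apply (open_comp Rabs (fun s => s < Rabs t + 1)); [|apply open_lt].
  intros x _. apply continuous_Rabs.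
- intros a b x Ha Hb Hx. apply Rabs_def2 in Ha. apply Rabs_def2 in Hb. apply Rabs_def1; lra.
- apply CVU_dom_cauchy. intros eps. destruct (Hf (Rabs t + 1) eps) as [N HN].
  exists N. intros n m x Hx Hn Hm. apply HN; [easy|lia|lia].
- intros n x _. eexists. apply D.
- intros n x _. apply continuity_pt_ext with (dn n); [intros; now rewrite ED|].
  apply continuity_pt_filterlim, C.
- apply CVU_dom_cauchy. intros eps. destruct (Hd (Rabs t + 1) eps) as [N HN].
  exists N. intros n m x Hx Hn Hm. rewrite !ED. now apply HN.
- lra.
Qed.

Lemma pendulum_exists (g v p : R) :
  exists y z, pendulum g y z /\ y 0 = v /\ z 0 = p.
Proof.
set (yn := fun n => fst (picard g v p n)). set (zn := fun n => snd (picard g v p n)).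
set (y := fun t => real (Lim_seq (fun n => yn n t))).
set (z := fun t => real (Lim_seq (fun n => zn n t))).
assert (Hy : forall T, CVU_cauchy yn (fun s => Rabs s < T)).
{ intros T. apply (CVU_geometric _ (Rabs p + (1 + Rabs g))).
  intros n t. exact (proj1 (picard_step g v p n t)). }
assert (Hz : forall T, CVU_cauchy zn (fun s => Rabs s < T)).
{ intros T. apply (CVU_geometric _ (Rabs p + (1 + Rabs g))).
  intros n t. exact (proj2 (picard_step g v p n t)). }
exists y, z. split; [intros t; split|].
- apply (is_derive_limit yn zn t Hy Hz).
  + intros n s. exact (proj1 (picard_derive g v p n s)).
  + intros n s. exact (proj2 (picard_continuous g v p n s)).
- assert (Hlim : is_lim_seq (fun n => yn n t) (y t)).
  { apply Lim_seq_correct', ex_lim_seq_cauchy_corr. intros eps.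
    destruct (Hy (Rabs t + 1) eps) as [N HN].
    exists N. intros n m Hn Hm. apply HN; [lra|easy|easy]. }
  replace (sin (y t) - g) with (real (Lim_seq (fun n => sin (yn n t) - g))).
  + apply (is_derive_limit zn (fun n s => sin (yn n s) - g) t Hz).
    * intros T eps. destruct (Hy T eps) as [N HN]. exists N. intros n m s Hs Hn Hm.
      eapply Rle_lt_trans; [|apply (HN n m s Hs Hn Hm)].
      eapply Rle_trans; [|apply sin_lipschitz]. right. f_equal. ring.
    * intros n s. exact (proj2 (picard_derive g v p n s)).
    * intros n s. apply continuous_sin_minus, (proj1 (picard_continuous g v p n s)).
  + rewrite (is_lim_seq_unique _ (Finite (sin (y t) - g))); [reflexivity|].
    apply (is_lim_seq_continuous (fun s => sin s - g)); [|exact Hlim].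
    apply continuity_pt_filterlim, (continuous_sin_minus (fun s => s)), continuous_id.
- unfold y, z. split.
  + rewrite (Lim_seq_ext _ (fun _ => v)); [now rewrite Lim_seq_const|].
    intros n. exact (proj1 (picard_0 g v p n)).
  + rewrite (Lim_seq_ext _ (fun _ => p)); [now rewrite Lim_seq_const|].
    intros n. exact (proj2 (picard_0 g v p n)).
Qed.

(* Gronwall for the squared distance of two solutions in the phase plane. *)
Lemma pendulum_unique (g : R) (y1 z1 y2 z2 : R -> R) :
  (forall t, 0 < t -> is_derive y1 t (z1 t) /\ is_derive z1 t (sin (y1 t) - g)) ->
  (forall t, 0 < t -> is_derive y2 t (z2 t) /\ is_derive z2 t (sin (y2 t) - g)) ->
  continuity_pt y1 0 -> continuity_pt z1 0 ->
  continuity_pt y2 0 -> continuity_pt z2 0 ->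
  y1 0 = y2 0 -> z1 0 = z2 0 ->
  forall t, 0 <= t -> y1 t = y2 t.
Proof.
intros H1 H2 Cy1 Cz1 Cy2 Cz2 Ey Ez t [Ht|<-]; [|exact Ey].
(* The squared distance grows at rate at most 2: with [u], [w] the two differences and [r] the
   difference of the sines, 2uw + 2wr <= 4|u||w| <= 2(u^2 + w^2). *)
set (E := fun t => ((y1 t - y2 t) ^ 2 + (z1 t - z2 t) ^ 2) * exp (- (2 * t))).
set (d := fun t => ((2 * (y1 t - y2 t) * (z1 t - z2 t)
  + 2 * (z1 t - z2 t) * (sin (y1 t) - sin (y2 t)))
  - 2 * ((y1 t - y2 t) ^ 2 + (z1 t - z2 t) ^ 2)) * exp (- (2 * t))).
assert (HE : forall s, 0 < s -> is_derive E s (d s)).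
{ intros s Hs. destruct (H1 s Hs) as [A1 B1]. destruct (H2 s Hs) as [A2 B2].
  unfold E, d. auto_derive.
  - repeat split; eexists; eassumption.
  - rewrite (is_derive_unique _ _ _ A1) (is_derive_unique _ _ _ A2)
      (is_derive_unique _ _ _ B1) (is_derive_unique _ _ _ B2). ring. }
destruct (mvt_open E d 0 t Ht) as [c [Hc Hd]].
- intros s Hs. apply HE; lra.
- intros s [[Hs|<-] _].
  + eapply is_derive_continuity, HE, Hs.
  + unfold E. apply continuity_pt_mult.
    * apply continuity_pt_plus.
      -- apply (continuity_pt_comp (fun t => y1 t - y2 t) (fun u => u ^ 2)).
         ++ now apply continuity_pt_minus.
         ++ apply derivable_continuous_pt, derivable_pt_pow.
      -- apply (continuity_pt_comp (fun t => z1 t - z2 t) (fun u => u ^ 2)).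
         ++ now apply continuity_pt_minus.
         ++ apply derivable_continuous_pt, derivable_pt_pow.
    * eapply is_derive_continuity. auto_derive; [easy|reflexivity].
- assert (E0 : E 0 = 0) by (unfold E; rewrite Ey Ez; ring).
  assert (d c <= 0).
  { unfold d. assert (He := exp_pos (- (2 * c))).
    assert (Hl := sin_lipschitz (y1 c) (y2 c)).
    set (u := y1 c - y2 c) in *. set (w := z1 c - z2 c) in *.
    set (r := sin (y1 c) - sin (y2 c)) in *.
    assert (r * w <= Rabs u * Rabs w).
    { eapply Rle_trans; [apply Rle_abs|]. rewrite Rabs_mult.
      apply Rmult_le_compat_r; [apply Rabs_pos|exact Hl]. }
    assert (u * w <= Rabs u * Rabs w) by (rewrite <- Rabs_mult; apply Rle_abs).
    assert (Rabs u * Rabs u = u ^ 2) by (rewrite <- Rabs_mult, Rabs_pos_eq; [ring|nra]).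
    assert (Rabs w * Rabs w = w ^ 2) by (rewrite <- Rabs_mult, Rabs_pos_eq; [ring|nra]).
    assert (0 <= (Rabs u - Rabs w) ^ 2) by apply pow2_ge_0.
    assert (2 * u * w + 2 * w * r - 2 * (u ^ 2 + w ^ 2) <= 0) by nra.
    nra. }
  assert (E t <= 0) by nra.
  unfold E in H0. assert (He := exp_pos (- (2 * t))).
  assert ((y1 t - y2 t) ^ 2 + (z1 t - z2 t) ^ 2 <= 0).
  { apply Rnot_lt_le. intros Hn. assert (H3 := Rmult_lt_0_compat _ _ Hn He). lra. }
  assert (H5 := pow2_ge_0 (z1 t - z2 t)).
  apply Rminus_diag_uniq, Rsqr_0_uniq. rewrite Rsqr_pow2.
  assert (H4 := pow2_ge_0 (y1 t - y2 t)). lra.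
Qed.

(* V(a) - V(x) for the potential V(x) = cos x + g x of the outer equation and
   its maximum a = asin g. *)
Definition gap (g x : R) : R := cos (asin g) - cos x + g * (asin g - x).

Lemma is_derive_gap (g x : R) : is_derive (gap g) x (sin x - g).
Proof. unfold gap. auto_derive; [easy|ring]. Qed.

Lemma gap_continuous (g x : R) : continuous (gap g) x.
Proof. apply: ex_derive_continuous. eexists. apply is_derive_gap. Qed.

Lemma gap_asin (g : R) : gap g (asin g) = 0.
Proof. unfold gap. ring. Qed.

Lemma is_lim_p_infty_eps (f : R -> R) (l : R) :
  is_lim f p_infty l ->
  forall eps, 0 < eps -> exists M, 0 < M /\ forall t, M < t -> Rabs (f t - l) < eps.
Proof.
intros H eps He. apply is_lim_spec in H. destruct (H (mkposreal eps He)) as [M HM].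
exists (Rmax M 1). split.
- eapply Rlt_le_trans; [|apply Rmax_r]. lra.
- intros t Ht. apply HM. eapply Rle_lt_trans; [apply Rmax_l|exact Ht].
Qed.

Lemma is_lim_continuous_comp (h f : R -> R) (l : R) :
  continuous h l -> is_lim f p_infty l -> is_lim (fun t => h (f t)) p_infty (h l).
Proof. intros Hh Hf. exact (filterlim_comp _ _ _ _ _ _ _ _ Hf Hh). Qed.

(** If [h l] were nonzero, the speed would eventually stay away from zero, while over a unit of time
    a convergent [y] has an arbitrarily small mean speed. *)
Lemma limit_is_rest_point (h y z : R -> R) (l : R) :
  (forall t, 0 < t -> is_derive y t (z t)) ->
  (forall t, 0 < t -> z t ^ 2 = h (y t)) ->
  continuous h l -> is_lim y p_infty l -> h l = 0.
Proof.
intros Hd He Hh Hl.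
destruct (Req_dec (h l) 0) as [|Hn]; [easy|exfalso].
assert (Hp : 0 < Rabs (h l)) by now apply Rabs_pos_lt.
(* The cap 1 turns a mean speed below [e / 2] into a squared speed below [e / 2]. *)
set (e := Rmin 1 (Rabs (h l))).
assert (He0 : 0 < e) by (apply Rmin_glb_lt; lra).
assert (He1 : e <= 1) by apply Rmin_l.
assert (He2 : e <= Rabs (h l)) by apply Rmin_r.
destruct (is_lim_p_infty_eps _ _ Hl (e / 4)) as [M [HM HM']]; [lra|].
destruct (is_lim_p_infty_eps _ _ (is_lim_continuous_comp h y l Hh Hl) (e / 2))
  as [N [HN HN']]; [lra|].
set (t := M + N).
destruct (mvt_open y z t (t + 1)) as [c [Hc E]]; [lra| | |].
{ intros x Hx. apply Hd. unfold t in Hx. lra. }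
{ intros x Hx. eapply is_derive_continuity, Hd. unfold t in Hx. lra. }
unfold t in Hc, E.
assert (B1 := HM' (M + N) ltac:(lra)). assert (B2 := HM' (M + N + 1) ltac:(lra)).
assert (B3 := HN' c ltac:(lra)). rewrite <- (He c ltac:(lra)) in B3.
apply Rabs_def2 in B1. apply Rabs_def2 in B2.
assert (Hz : - (e / 2) < z c < e / 2) by lra.
assert (z c ^ 2 < e / 2) by nra.
assert (0 <= z c ^ 2) by apply pow2_ge_0.
apply Rabs_def2 in B3. revert He2. unfold Rabs. destruct (Rcase_abs (h l)); lra.
Qed.

(** One outer half of a fluxon with its end moved to time 0: the right half shifted by 2 PI, the
    left half reversed in time. At time 0 only continuity is asked, because a fluxon may have no
    second derivative at the edges of the inhomogeneity. *)
Record tail (g : R) (y z : R -> R) : Prop := {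
  tail_ode : forall t, 0 < t -> is_derive y t (z t) /\ is_derive z t (sin (y t) - g);
  tail_cont : continuity_pt y 0 /\ continuity_pt z 0;
  tail_lim : is_lim y p_infty (asin g)
}.

Lemma tail_continuity (g : R) (y z : R -> R) (t : R) :
  tail g y z -> 0 <= t -> continuity_pt y t /\ continuity_pt z t.
Proof.
intros T [Ht|<-]; [|apply T].
destruct (tail_ode _ _ _ T t Ht). split; eapply is_derive_continuity; eassumption.
Qed.

Lemma energy_derive (g t : R) (y z : R -> R) :
  is_derive y t (z t) -> is_derive z t (sin (y t) - g) ->
  is_derive (fun t => z t ^ 2 - 2 * gap g (y t)) t 0.
Proof.
intros Hy Hz. unfold gap. auto_derive.
- repeat split; eexists; eassumption.
- rewrite (is_derive_unique _ _ _ Hy) (is_derive_unique _ _ _ Hz). ring.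
Qed.

(** The conserved energy [E 0] is identified at infinity: the limit [asin g] must be a zero of
    [2 * gap g x + E 0], and [gap] vanishes there. Nothing need be known in advance about the limit
    of the slope. *)
Lemma tail_energy (g : R) (y z : R -> R) :
  tail g y z -> forall t, 0 <= t -> z t ^ 2 = 2 * gap g (y t).
Proof.
intros T.
set (E := fun t => z t ^ 2 - 2 * gap g (y t)).
assert (Hd : forall t, 0 < t -> is_derive E t 0).
{ intros t Ht. destruct (tail_ode _ _ _ T t Ht). now apply energy_derive. }
assert (HE : forall t, 0 <= t -> E t = E 0).
{ intros t [Ht|<-]; [|easy].
  destruct (mvt_open E (fun _ => 0) 0 t Ht) as [c [_ Ec]]; [| |lra].
  - intros x Hx. apply Hd; lra.
  - intros x [Hx _]. destruct (tail_continuity g y z x T Hx) as [C1 C2].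
    apply continuity_pt_minus.
    + apply (continuity_pt_comp z (fun u => u ^ 2)); [exact C2|].
      apply derivable_continuous_pt, derivable_pt_pow.
    + apply continuity_pt_mult; [apply continuity_pt_cst|].
      apply (continuity_pt_comp y (gap g)); [exact C1|].
      apply continuity_pt_filterlim, gap_continuous. }
assert (H0 : 2 * gap g (asin g) + E 0 = 0).
{ apply (limit_is_rest_point (fun x => 2 * gap g x + E 0) y z).
  - intros t Ht. apply (tail_ode _ _ _ T t Ht).
  - intros t Ht. rewrite <- (HE t (Rlt_le _ _ Ht)). unfold E. ring.
  - apply: ex_derive_continuous. unfold gap. auto_derive. easy.
  - apply T. }
rewrite gap_asin in H0. intros t Ht. specialize (HE t Ht). unfold E in HE at 1. lra.
Qed.

(** * The sign of the potential gap for an admissible bias *)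

Definition bias (g : R) : Prop := 0 < g <= 1 / PI.

Lemma PI_gt_3 : 3 < PI.
Proof. assert (H := PI2_3_2). unfold PI2 in H. lra. Qed.

Lemma bias_PI (g : R) : bias g -> 0 < g /\ g * PI <= 1 /\ g < 1 / 3.
Proof.
intros [H1 H2]. assert (H := PI_gt_3).
assert (g * PI <= 1).
{ apply Rmult_le_compat_r with (r := PI) in H2; [|lra].
  replace (1 / PI * PI) with 1 in H2 by (field; lra). exact H2. }
repeat split; try lra. nra.
Qed.

Lemma bias_asin (g : R) : bias g ->
  0 < asin g < PI / 6 /\ sin (asin g) = g /\ 9 / 10 < cos (asin g).
Proof.
intros Hg. destruct (bias_PI g Hg) as [H1 [_ H2]]. assert (HP := PI_RGT_0).
assert (Es : sin (asin g) = g) by (apply sin_asin; lra).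
assert (Hb := asin_bound g).
assert (Ha : 0 < asin g).
{ apply sin_increasing_0; try lra. rewrite sin_0. lra. }
assert (Hc : 0 <= cos (asin g)) by (apply cos_ge_0; lra).
assert (Hsc := sin2_cos2 (asin g)). unfold Rsqr in Hsc. rewrite Es in Hsc.
repeat split; try lra.
- apply sin_increasing_0; try lra. rewrite sin_PI6. lra.
- nra.
Qed.

Lemma sin_gt_bias (g x : R) : bias g -> asin g < x < PI - asin g -> g < sin x.
Proof.
intros Hg Hx. destruct (bias_asin g Hg) as [Ha [Es _]].
rewrite -{1}Es. destruct (Rle_dec x (PI / 2)).
- apply sin_increasing_1; lra.
- rewrite -(sin_PI_x x). apply sin_increasing_1; lra.
Qed.

Lemma sin_lt_bias_left (g x : R) : bias g -> - PI / 2 <= x < asin g -> sin x < g.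
Proof.
intros Hg Hx. destruct (bias_asin g Hg) as [Ha [Es _]].
rewrite -Es. apply sin_increasing_1; lra.
Qed.

Lemma sin_lt_bias (g x : R) : bias g -> PI - asin g < x < 2 * PI + asin g -> sin x < g.
Proof.
intros Hg Hx. destruct (bias_asin g Hg) as [Ha [Es _]].
destruct (Rle_dec x (3 * (PI / 2))).
- rewrite -(sin_PI_x x). apply sin_lt_bias_left; [easy|lra].
- replace x with ((x - 2 * PI) + 2 * PI) by ring.
  rewrite sin_plus sin_2PI cos_2PI.
  replace (sin (x - 2 * PI) * 1 + cos (x - 2 * PI) * 0) with (sin (x - 2 * PI)) by ring.
  apply sin_lt_bias_left; [easy|lra].
Qed.

Lemma gap_decr_right (g x y : R) :
  bias g -> PI - asin g <= x -> x < y -> y <= 2 * PI + asin g -> gap g y < gap g x.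
Proof.
intros Hg Hx Hxy Hy.
apply (derive_neg_lt_closed (gap g) (fun x => sin x - g)); [easy| |].
- intros t _. apply is_derive_gap.
- intros t Ht. assert (sin t < g) by (apply sin_lt_bias; [easy|lra]). lra.
Qed.

Lemma gap_incr (g x y : R) :
  bias g -> asin g <= x -> x < y -> y <= PI - asin g -> gap g x < gap g y.
Proof.
intros Hg Hx Hxy Hy.
apply (derive_pos_lt_closed (gap g) (fun x => sin x - g)); [easy| |].
- intros t _. apply is_derive_gap.
- intros t Ht. assert (g < sin t) by (apply sin_gt_bias; [easy|lra]). lra.
Qed.

(** With t = asin g - x the addition formula gives gap = g (t - sin t) + cos (asin g) (1 - cos t),
    which is positive for every t > 0, however far to the left. *)
Lemma gap_pos_left (g x : R) : bias g -> x < asin g -> 0 < gap g x.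
Proof.
intros Hg Hx. destruct (bias_asin g Hg) as [Ha [Es Hc]]. destruct Hg as [Hg _].
set (t := asin g - x).
replace (gap g x) with (g * (t - sin t) + cos (asin g) * (1 - cos t)).
2:{ unfold gap. replace x with (asin g - t) by (unfold t; ring).
    rewrite cos_minus Es. ring. }
assert (sin t < t) by (apply sin_lt_x; unfold t; lra).
assert (Hb := COS_bound t). nra.
Qed.

(** The value at which the homoclinic loop of the saddle [asin g] turns back. *)
Definition is_top (g m : R) : Prop := PI < m < 2 * PI /\ gap g m = 0.

Lemma gap_PI_pos (g : R) : bias g -> 9 / 10 < gap g PI.
Proof.
intros Hg. destruct (bias_asin g Hg) as [Ha [Es Hc]]. destruct (bias_PI g Hg) as [H1 [H2 H3]].
unfold gap. rewrite cos_PI. nra.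
Qed.

Lemma top_exists (g : R) : bias g -> exists m, is_top g m.
Proof.
intros Hg. destruct (bias_asin g Hg) as [Ha [Es Hc]]. destruct (bias_PI g Hg) as [H1 [H2 H3]].
assert (HPI := gap_PI_pos g Hg).
assert (H2PI : gap g (2 * PI) < 0).
{ unfold gap. rewrite cos_2PI. assert (H := COS_bound (asin g)). nra. }
destruct (first_zero (gap g) PI (2 * PI)) as [m [Hm [Em _]]]; try lra.
- intros x _. apply continuity_pt_filterlim, gap_continuous.
- exists m. repeat split; try lra.
  destruct Hm as [_ [Hm|Hm]]; [lra|]. rewrite Hm in Em. lra.
Qed.

Lemma gap_pos_top (g m x : R) : bias g -> is_top g m -> asin g < x < m -> 0 < gap g x.
Proof.
intros Hg [Hm Em] Hx. destruct (bias_asin g Hg) as [Ha _].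
destruct (Rle_dec x (PI - asin g)).
- rewrite -(gap_asin g). apply gap_incr; lra || easy.
- rewrite -Em. apply gap_decr_right; lra || easy.
Qed.

Lemma gap_neg_top (g m x : R) : bias g -> is_top g m -> m < x <= 2 * PI + asin g -> gap g x < 0.
Proof.
intros Hg [Hm Em] Hx. destruct (bias_asin g Hg) as [Ha _].
rewrite -Em. apply gap_decr_right; lra || easy.
Qed.

(* The values just above the top are energetically forbidden. *)
Lemma stays_below_top (g m : R) (y z : R -> R) (t1 t2 : R) :
  bias g -> is_top g m ->
  (forall t, Rmin t1 t2 <= t <= Rmax t1 t2 -> continuity_pt y t /\ z t ^ 2 = 2 * gap g (y t)) ->
  y t1 <= m -> y t2 <= m.
Proof.
intros Hg Hm H H1. apply Rnot_lt_le. intros H2.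
(* [c] is a value that [y] must cross, kept within the range where [gap_neg_top] applies. The order
   of [t1] and [t2] is left open so that the bound can also be carried backwards in time. *)
set (c := Rmin (y t2) (2 * PI)).
destruct Hm as [Hm Em].
assert (Hc : m < c) by (apply Rmin_glb_lt; lra).
assert (Hc1 : c <= y t2) by apply Rmin_l.
assert (Hc2 : c <= 2 * PI) by apply Rmin_r.
destruct (bias_asin g Hg) as [Ha _].
assert (exists t, Rmin t1 t2 <= t <= Rmax t1 t2 /\ y t = c) as [t [Ht Et]].
{ destruct (Rle_dec t1 t2) as [Ht|Ht].
  - rewrite (Rmin_left _ _ Ht) (Rmax_right _ _ Ht) in H |- *.
    destruct Ht as [Ht|<-]; [|lra].
    destruct (first_zero (fun t => c - y t) t1 t2) as [t [B1 [B2 _]]]; try lra.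
    + intros x Hx. apply continuity_pt_minus; [|now apply H].
      apply continuity_pt_cst.
    + exists t. split; lra.
  - apply Rnot_le_lt in Ht.
    rewrite (Rmin_right t1 t2) ?(Rmax_left t1 t2) in H |- *; try lra.
    destruct (first_zero (fun t => c - y (- t)) (- t1) (- t2)) as [t [B1 [B2 _]]];
      try (rewrite ?Ropp_involutive; lra).
    + intros x Hx. apply continuity_pt_minus.
      * apply continuity_pt_cst.
      * apply (continuity_pt_comp Ropp y).
        -- apply derivable_continuous_pt, derivable_pt_opp, derivable_pt_id.
        -- apply H. lra.
    + exists (- t). split; lra. }
destruct (H t Ht) as [_ E]. rewrite Et in E.
assert (0 <= z t ^ 2) by apply pow2_ge_0.
assert (gap g c < 0) by (apply (gap_neg_top g m); [easy|split; easy|lra]). lra.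
Qed.

(** At a late time [y] is within 1 of [asin g], hence below [m]; the bound is then carried back to
    time 0. *)
Lemma tail_le_top (g m : R) (y z : R -> R) :
  bias g -> is_top g m -> tail g y z -> y 0 <= m.
Proof.
intros Hg Hm T. destruct (bias_asin g Hg) as [Ha _].
destruct (is_lim_p_infty_eps _ _ (tail_lim _ _ _ T) 1) as [M [HM HM']]; [lra|].
specialize (HM' (M + 1) ltac:(lra)). apply Rabs_def2 in HM'.
apply (stays_below_top g m y z (M + 1) 0); auto.
- rewrite Rmin_right; [|lra]. intros t Ht. split.
  + apply (tail_continuity g y z); [easy|lra].
  + apply tail_energy; [easy|lra].
- assert (H := PI_gt_3). destruct Hm. lra.
Qed.

(** Left of the saddle the gap is positive, so the slope cannot vanish. A solution starting
    downwards there keeps falling and never comes back to the saddle. *)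
Lemma tail_from_left (g : R) (y z : R -> R) :
  bias g -> tail g y z -> y 0 < asin g -> 0 < z 0.
Proof.
intros Hg T H0.
assert (En := tail_energy g y z T).
apply Rnot_le_lt. intros Hz.
assert (Hz0 : 0 < - z 0).
{ assert (P := gap_pos_left g (y 0) Hg H0). assert (E := En 0 (Rle_refl 0)). nra. }
assert (Hlt : forall t, 0 < t -> (forall s, 0 < s < t -> 0 < - z s) -> y t < y 0).
{ intros t Ht Hs. apply (derive_neg_lt y z); [easy| | |].
  - intros x Hx. apply (tail_ode _ _ _ T). lra.
  - intros x Hx. apply (tail_continuity g y z); [easy|lra].
  - intros x Hx. specialize (Hs x Hx). lra. }
assert (Hneg : forall t, 0 < t -> 0 < - z t).
{ intros t Ht. apply Rnot_le_lt. intros Hn.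
  destruct (first_zero (fun t => - z t) 0 t Ht) as [c [Hc [Ec Hc']]]; try easy.
  - intros x Hx. apply continuity_pt_opp, (tail_continuity g y z); [easy|lra].
  - assert (y c < y 0). { apply Hlt; [lra|]. intros s Hs. apply Hc'. lra. }
    assert (P := gap_pos_left g (y c) Hg ltac:(lra)). assert (E := En c ltac:(lra)). nra. }
destruct (is_lim_p_infty_eps _ _ (tail_lim _ _ _ T) (asin g - y 0)) as [M [HM HM']]; [lra|].
specialize (HM' (M + 1) ltac:(lra)). apply Rabs_def2 in HM'.
assert (y (M + 1) < y 0). { apply Hlt; [lra|]. intros s Hs. apply Hneg. lra. }
lra.
Qed.

(** * Existence of tails: the stable set of the saddle *)

Lemma is_lim_monotone (f : R -> R) (B : R) :
  (forall s t, 0 <= s -> s <= t -> f s <= f t) -> (forall t, 0 <= t -> f t <= B) ->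
  exists l : R, is_lim f p_infty l /\ l <= B /\ forall t, 0 <= t -> f t <= l.
Proof.
intros Hm HB.
destruct (completeness (fun x => exists t, 0 <= t /\ f t = x)) as [l [Hub Hlub]].
{ exists B. intros x [t [Ht <-]]. now apply HB. }
{ exists (f 0), 0. split; [lra|easy]. }
assert (Hl : forall t, 0 <= t -> f t <= l). { intros t Ht. apply Hub. now exists t. }
exists l. split; [|split; [|exact Hl]].
- apply is_lim_spec. intros eps. simpl.
  destruct (classic (exists s, 0 <= s /\ l - eps < f s)) as [[s [Hs Hs']]|Hn].
  + exists s. intros t Ht. specialize (Hm s t Hs (Rlt_le _ _ Ht)).
    specialize (Hl t ltac:(lra)). assert (He := cond_pos eps). apply Rabs_def1; lra.
  + exfalso. assert (l <= l - eps); [|assert (He := cond_pos eps); lra].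
    apply Hlub. intros x [t [Ht <-]]. apply Rnot_lt_le. intros H. apply Hn. now exists t.
- apply Hlub. intros x [t [Ht <-]]. now apply HB.
Qed.

Lemma pendulum_reverse_const (g : R) (y z : R -> R) (t0 : R) :
  -1 <= g <= 1 -> pendulum g y z -> y t0 = asin g -> z t0 = 0 ->
  forall t, t <= t0 -> y t = asin g.
Proof.
intros Hg H Ey Ez t Ht.
replace t with (t0 - (t0 - t)) by ring.
assert (Hd1 : forall s, is_derive (fun s => y (t0 - s)) s (- z (t0 - s))).
{ intros s. destruct (H (t0 - s)) as [A _]. auto_derive.
  - eexists; eassumption.
  - rewrite (is_derive_unique _ _ _ A). ring. }
assert (Hd2 : forall s, is_derive (fun s => - z (t0 - s)) s (sin (y (t0 - s)) - g)).
{ intros s. destruct (H (t0 - s)) as [_ A]. auto_derive.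
  - eexists; eassumption.
  - rewrite (is_derive_unique _ _ _ A). ring. }
apply (pendulum_unique g (fun s => y (t0 - s)) (fun s => - z (t0 - s))
  (fun _ => asin g) (fun _ => 0)).
- intros s _. split; auto.
- intros s _. rewrite sin_asin; [|lra].
  replace (g - g) with 0 by ring. split; apply: is_derive_const.
- eapply is_derive_continuity, Hd1.
- eapply is_derive_continuity, Hd2.
- apply continuity_pt_cst.
- apply continuity_pt_cst.
- now rewrite Rminus_0_r.
- rewrite Rminus_0_r Ez. ring.
- lra.
Qed.

Lemma pendulum_continuity (g : R) (y z : R -> R) (t : R) :
  pendulum g y z -> continuity_pt y t /\ continuity_pt z t.
Proof.
intros H. destruct (H t). split; eapply is_derive_continuity; eassumption.
Qed.

Lemma pendulum_energy (g : R) (y z : R -> R) :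
  pendulum g y z -> z 0 ^ 2 = 2 * gap g (y 0) -> forall t, z t ^ 2 = 2 * gap g (y t).
Proof.
intros H H0 t.
destruct (MVT_gen (fun t => z t ^ 2 - 2 * gap g (y t)) 0 t (fun _ => 0)) as [c [_ E]].
- intros x _. destruct (H x). now apply energy_derive.
- intros x _. destruct (H x). eapply is_derive_continuity. now apply energy_derive.
- lra.
Qed.

Lemma pendulum_monotone (g : R) (y z : R -> R) (s t : R) :
  pendulum g y z -> s <= t -> (forall r, s <= r <= t -> 0 <= z r) -> y s <= y t.
Proof.
intros H [Hst|<-] Hz; [|lra].
destruct (mvt_open y z s t Hst) as [c [Hc E]].
- intros x _. apply H.
- intros x _. now apply (pendulum_continuity g y z).
- specialize (Hz c ltac:(lra)). nra.
Qed.

Lemma pendulum_antitone (g : R) (y z : R -> R) (s t : R) :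
  pendulum g y z -> s <= t -> (forall r, s <= r <= t -> z r <= 0) -> y t <= y s.
Proof.
intros H [Hst|<-] Hz; [|lra].
destruct (mvt_open y z s t Hst) as [c [Hc E]].
- intros x _. apply H.
- intros x _. now apply (pendulum_continuity g y z).
- specialize (Hz c ltac:(lra)). nra.
Qed.

(** On the zero energy level a solution at the saddle has slope zero, so uniqueness backwards in
    time makes it constant. The saddle is thus approached only asymptotically. *)
Lemma pendulum_avoids_saddle (g : R) (y z : R -> R) (t : R) :
  -1 <= g <= 1 -> pendulum g y z -> z 0 ^ 2 = 2 * gap g (y 0) -> 0 <= t ->
  y t = asin g -> y 0 = asin g.
Proof.
intros Hg H H0 Ht Et.
assert (E := pendulum_energy g y z H H0 t). rewrite Et gap_asin in E.
apply (pendulum_reverse_const g y z t Hg H Et); [|exact Ht].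
apply Rsqr_0_uniq. rewrite Rsqr_pow2. lra.
Qed.

Lemma bias_unit (g : R) : bias g -> -1 <= g <= 1.
Proof. intros Hg. destruct (bias_PI g Hg). lra. Qed.

Lemma pendulum_limit (g : R) (y z : R -> R) (l : R) :
  pendulum g y z -> (forall t, z t ^ 2 = 2 * gap g (y t)) -> is_lim y p_infty l ->
  2 * gap g l = 0.
Proof.
intros H En Hl. apply (limit_is_rest_point (fun x => 2 * gap g x) y z); auto.
- intros t _. apply H.
- apply: ex_derive_continuous. unfold gap. auto_derive. easy.
Qed.

(** The solution can neither reach the saddle nor stop before it, so it increases to a limit; that
    limit is a zero of the gap and none lies to the left of the saddle. *)
Lemma tail_exists_below (g : R) (y z : R -> R) :
  bias g -> pendulum g y z -> z 0 ^ 2 = 2 * gap g (y 0) ->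
  y 0 < asin g -> 0 < z 0 -> is_lim y p_infty (asin g).
Proof.
intros Hg H H0 Hy0 Hz0.
assert (En := pendulum_energy g y z H H0).
assert (Hlt : forall t, 0 <= t -> y t < asin g).
{ intros t Ht. apply Rnot_le_lt. intros Hn.
  destruct Ht as [Ht|<-]; [|lra].
  destruct (first_zero (fun t => asin g - y t) 0 t Ht) as [c [Hc [Ec _]]]; try lra.
  - intros x _. apply continuity_pt_minus; [|now apply (pendulum_continuity g y z)].
    apply continuity_pt_cst.
  - assert (y 0 = asin g); [|lra].
    apply (pendulum_avoids_saddle g y z c); auto using bias_unit; lra. }
assert (Hpos : forall t, 0 <= t -> 0 < z t).
{ intros t [Ht|<-]; [|easy]. apply Rnot_le_lt. intros Hn.
  destruct (first_zero z 0 t Ht) as [c [Hc [Ec _]]]; try lra.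
  - intros x _. now apply (pendulum_continuity g y z).
  - assert (P := gap_pos_left g (y c) Hg (Hlt c ltac:(lra))).
    specialize (En c). rewrite Ec in En. lra. }
destruct (is_lim_monotone y (asin g)) as [l [Hl [Hla _]]].
- intros s t Hs Hst. apply (pendulum_monotone g y z); auto.
  intros r Hr. left. apply Hpos. lra.
- intros t Ht. left. now apply Hlt.
- replace (asin g) with l; [exact Hl|].
  assert (2 * gap g l = 0).
  { now apply (pendulum_limit g y z). }
  destruct Hla as [Hla|]; [|easy].
  assert (P := gap_pos_left g l Hg Hla). lra.
Qed.

Lemma pendulum_stays_above (g : R) (y z : R -> R) (t : R) :
  bias g -> pendulum g y z -> z 0 ^ 2 = 2 * gap g (y 0) ->
  asin g < y 0 -> 0 <= t -> asin g < y t.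
Proof.
intros Hg H H0 Hy0 Ht. apply Rnot_le_lt. intros Hn.
destruct Ht as [Ht|<-]; [|lra].
destruct (first_zero (fun t => y t - asin g) 0 t Ht) as [c [Hc [Ec _]]]; try lra.
- intros x _. apply continuity_pt_minus; [now apply (pendulum_continuity g y z)|].
  apply continuity_pt_cst.
- assert (y 0 = asin g); [|lra].
  apply (pendulum_avoids_saddle g y z c); auto using bias_unit; lra.
Qed.

Lemma tail_exists_descending (g m : R) (y z : R -> R) :
  bias g -> is_top g m -> pendulum g y z -> z 0 ^ 2 = 2 * gap g (y 0) ->
  asin g < y 0 <= m -> z 0 < 0 -> is_lim y p_infty (asin g).
Proof.
intros Hg Hm H H0 Hy0 Hz0.
assert (En := pendulum_energy g y z H H0).
assert (Hgt : forall t, 0 <= t -> asin g < y t).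
{ intros t Ht. apply (pendulum_stays_above g y z); auto; lra. }
assert (Hy0m : y 0 < m).
{ destruct Hy0 as [_ [|E]]; [easy|]. rewrite E (proj2 Hm) in H0. nra. }
assert (Hneg : forall t, 0 <= t -> z t < 0).
{ intros t [Ht|<-]; [|easy]. apply Rnot_le_lt. intros Hn.
  destruct (first_zero (fun t => - z t) 0 t Ht) as [c [Hc [Ec Hc']]]; try lra.
  - intros x _. apply continuity_pt_opp. now apply (pendulum_continuity g y z).
  - assert (y c <= y 0).
    { apply (pendulum_antitone g y z); [easy|lra|]. intros r Hr.
      destruct (Req_dec r c) as [->|N]; [lra|]. specialize (Hc' r ltac:(lra)). lra. }
    assert (P := gap_pos_top g m (y c) Hg Hm ltac:(specialize (Hgt c ltac:(lra)); lra)).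
    specialize (En c). replace (z c) with 0 in En by lra. lra. }
destruct (is_lim_monotone (fun t => - y t) (- asin g)) as [l [Hl [Hla Hlb]]].
- intros s t Hs Hst. assert (y t <= y s); [|lra].
  apply (pendulum_antitone g y z); auto.
  intros r Hr. left. apply Hneg. lra.
- intros t Ht. specialize (Hgt t Ht). lra.
- apply is_lim_opp in Hl. simpl in Hl.
  apply is_lim_ext with (g := y) in Hl; [|intros; ring].
  replace (asin g) with (- l); [exact Hl|].
  assert (2 * gap g (- l) = 0).
  { now apply (pendulum_limit g y z). }
  specialize (Hlb 0 (Rle_refl 0)).
  destruct (Req_dec (- l) (asin g)); [easy|].
  assert (P := gap_pos_top g m (- l) Hg Hm ltac:(lra)). lra.
Qed.

(** Without a turn [y] would increase to a zero of the gap right of the saddle, that is to [m].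
    There the acceleration [sin m - g] is negative and would drive the slope below zero after
    all. *)
Lemma pendulum_turns (g m : R) (y z : R -> R) :
  bias g -> is_top g m -> pendulum g y z -> z 0 ^ 2 = 2 * gap g (y 0) ->
  asin g < y 0 <= m -> exists t, 0 <= t /\ z t < 0.
Proof.
intros Hg Hm H H0 Hy0.
destruct (classic (exists t, 0 <= t /\ z t < 0)) as [|Hn]; [easy|exfalso].
assert (Hpos : forall t, 0 <= t -> 0 <= z t).
{ intros t Ht. apply Rnot_lt_le. intros Hz. apply Hn. now exists t. }
assert (En := pendulum_energy g y z H H0).
destruct (is_lim_monotone y m) as [l [Hl [Hlm Hlb]]].
- intros s t Hs Hst. apply (pendulum_monotone g y z); auto.
  intros r Hr. apply Hpos. lra.
- intros t Ht. apply (stays_below_top g m y z 0 t); auto; [|lra].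
  intros s _. split; [now apply (pendulum_continuity g y z)|apply En].
- assert (Hgl : 2 * gap g l = 0).
  { now apply (pendulum_limit g y z). }
  specialize (Hlb 0 (Rle_refl 0)).
  assert (Elm : l = m).
  { destruct Hlm as [Hlm|]; [|easy].
    assert (P := gap_pos_top g m l Hg Hm ltac:(lra)). lra. }
  subst l. destruct Hm as [Hm _].
  destruct (bias_asin g Hg) as [Ha _].
  assert (Hs : sin m < g) by (apply sin_lt_bias; [easy|lra]).
  assert (Hlim := is_lim_continuous_comp sin y m (continuous_sin m) Hl).
  destruct (is_lim_p_infty_eps _ _ Hlim ((g - sin m) / 2)) as [M [HM HM']]; [lra|].
  set (d := (g - sin m) / 2) in *.
  assert (Hd : 0 < d) by (unfold d; lra).
  set (T := M + 1). assert (HT : M < T) by (unfold T; lra).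
  (* During this time the slope drops by more than [s * d = z T + 1], hence below zero. *)
  set (s := (z T + 1) / d).
  assert (Hz := Hpos T ltac:(lra)).
  assert (Hs0 : 0 < s) by (apply Rdiv_lt_0_compat; lra).
  destruct (mvt_open z (fun t => sin (y t) - g) T (T + s)) as [c [Hc E]]; [lra| | |].
  + intros x _. apply H.
  + intros x _. now apply (pendulum_continuity g y z).
  + assert (B := HM' c ltac:(lra)). apply Rabs_def2 in B.
    assert (Hzs := Hpos (T + s) ltac:(lra)).
    assert (Esd : s * d = z T + 1) by (unfold s; field; lra).
    assert (sin (y c) - g < - d) by (unfold d in *; lra).
    replace (T + s - T) with s in E by ring. nra.
Qed.

(** Right of the saddle both signs of [p] are allowed: a solution that starts upwards first turns,
    and the descending case applies after a shift of time. The saddle itself carries the constant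
    solution. *)
Lemma tail_exists (g m v p : R) :
  bias g -> is_top g m -> v <= m -> p ^ 2 = 2 * gap g v -> (v < asin g -> 0 < p) ->
  exists y z, pendulum g y z /\ y 0 = v /\ z 0 = p /\ is_lim y p_infty (asin g).
Proof.
intros Hg Hm Hv Hp Hl.
destruct (pendulum_exists g v p) as [y [z [H [Ey Ez]]]].
assert (H0 : z 0 ^ 2 = 2 * gap g (y 0)) by now rewrite Ey Ez.
destruct (Rtotal_order v (asin g)) as [Hva|[Hva|Hva]].
- exists y, z. split; [exact H|]. split; [exact Ey|]. split; [exact Ez|].
  apply (tail_exists_below g y z); auto; rewrite ?Ey ?Ez; auto.
- exists (fun _ => asin g), (fun _ => 0).
  split; [|split; [auto|split; [|apply is_lim_const]]].
  + intros t. rewrite sin_asin; [|now apply bias_unit]. rewrite Rminus_diag.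
    split; apply: is_derive_const.
  + rewrite Hva gap_asin in Hp. symmetry. apply Rsqr_0_uniq. rewrite Rsqr_pow2. lra.
- exists y, z. split; [exact H|]. split; [exact Ey|]. split; [exact Ez|].
  destruct (pendulum_turns g m y z) as [t [Ht Hz]]; auto; [rewrite Ey; lra|].
  assert (En := pendulum_energy g y z H H0).
  assert (Hlim : is_lim (fun s => y (s + t)) p_infty (asin g)).
  { apply (tail_exists_descending g m (fun s => y (s + t)) (fun s => z (s + t))); auto.
    - intros s. destruct (H (s + t)) as [A B]. split; auto_derive;
        try (eexists; eassumption).
      + rewrite (is_derive_unique _ _ _ A). ring.
      + rewrite (is_derive_unique _ _ _ B). ring.
    - rewrite Rplus_0_l. split.
      + apply (pendulum_stays_above g y z); auto; lra.
      + apply (stays_below_top g m y z 0 t); auto; [|lra].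
        intros s _. split; [now apply (pendulum_continuity g y z)|apply En].
    - now rewrite Rplus_0_l. }
  apply is_lim_spec in Hlim. apply is_lim_spec. intros eps.
  destruct (Hlim eps) as [M HM]. exists (M + t). intros s Hs.
  specialize (HM (s - t) ltac:(lra)). replace (s - t + t) with s in HM by ring. exact HM.
Qed.

(** * Fluxons and their matching data *)

Lemma fluxon_derive (L g : R) (phi : R -> R) :
  pinned_fluxon L g 0 phi ->
  forall x, is_derive phi x (Derive phi x).
Proof. intros H x. apply Derive_correct, H. Qed.

Lemma fluxon_derive2 (L g : R) (phi : R -> R) (x : R) :
  pinned_fluxon L g 0 phi -> Rabs x <> L ->
  is_derive (Derive phi) x (inhomogeneity x L 0 * sin (phi x) - g).
Proof.
intros H Hx.
assert (E := pf_eqn _ _ _ _ H x Hx).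
replace (inhomogeneity x L 0 * sin (phi x) - g) with (Derive_n phi 2 x) by lra.
apply Derive_correct, (pf_diff2 _ _ _ _ H x Hx).
Qed.

Lemma fluxon_continuity (L g : R) (phi : R -> R) (x : R) :
  pinned_fluxon L g 0 phi -> continuity_pt phi x /\ continuity_pt (Derive phi) x.
Proof.
intros H. split.
- eapply is_derive_continuity, fluxon_derive, H.
- apply continuity_pt_filterlim, H.
Qed.

Lemma fluxon_right_tail (L g : R) (phi : R -> R) :
  0 < L -> pinned_fluxon L g 0 phi ->
  tail g (fun t => phi (L + t) - 2 * PI) (fun t => Derive phi (L + t)).
Proof.
intros HL H. split.
- intros t Ht.
  assert (A := fluxon_derive L g phi H (L + t)).
  assert (B := fluxon_derive2 L g phi (L + t) H).
  specialize (B ltac:(rewrite Rabs_pos_eq; lra)).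
  unfold inhomogeneity in B. rewrite Rabs_pos_eq in B; [|lra].
  destruct (Rlt_dec (L + t) L); [lra|].
  split; auto_derive; try (eexists; eassumption).
  + rewrite (is_derive_unique _ _ _ A). ring.
  + rewrite (is_derive_unique _ _ _ B).
    replace (phi (L + t) - 2 * PI) with (phi (L + t) + - (2 * PI)) by ring.
    rewrite sin_plus sin_neg cos_neg sin_2PI cos_2PI. ring.
- split.
  + apply continuity_pt_minus; [|apply continuity_pt_cst].
    apply (continuity_pt_comp (fun t => L + t) phi).
    * eapply is_derive_continuity. auto_derive; [easy|reflexivity].
    * apply (fluxon_continuity L g), H.
  + apply (continuity_pt_comp (fun t => L + t) (Derive phi)).
    * eapply is_derive_continuity. auto_derive; [easy|reflexivity].
    * apply (fluxon_continuity L g), H.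
- assert (Hl := pf_lim_right _ _ _ _ H).
  apply is_lim_spec in Hl. apply is_lim_spec. intros eps.
  destruct (Hl eps) as [M HM]. exists (M - L). intros t Ht.
  replace (phi (L + t) - 2 * PI - asin g) with (phi (L + t) - (asin g + 2 * PI)) by ring.
  apply HM. lra.
Qed.

Lemma fluxon_left_tail (L g : R) (phi : R -> R) :
  0 < L -> pinned_fluxon L g 0 phi ->
  tail g (fun t => phi (- L - t)) (fun t => - Derive phi (- L - t)).
Proof.
intros HL H. split.
- intros t Ht.
  assert (A := fluxon_derive L g phi H (- L - t)).
  assert (B := fluxon_derive2 L g phi (- L - t) H).
  specialize (B ltac:(rewrite Rabs_left; lra)).
  unfold inhomogeneity in B. rewrite Rabs_left in B; [|lra].
  destruct (Rlt_dec (- (- L - t)) L); [lra|].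
  split; auto_derive; try (eexists; eassumption).
  + rewrite (is_derive_unique _ _ _ A). ring.
  + rewrite (is_derive_unique _ _ _ B). ring.
- split.
  + apply (continuity_pt_comp (fun t => - L - t) phi).
    * eapply is_derive_continuity. auto_derive; [easy|reflexivity].
    * apply (fluxon_continuity L g), H.
  + apply continuity_pt_opp.
    apply (continuity_pt_comp (fun t => - L - t) (Derive phi)).
    * eapply is_derive_continuity. auto_derive; [easy|reflexivity].
    * apply (fluxon_continuity L g), H.
- assert (Hl := pf_lim_left _ _ _ _ H).
  apply is_lim_spec in Hl. apply is_lim_spec. intros eps.
  destruct (Hl eps) as [M HM]. exists (- L - M). intros t Ht.
  apply HM. lra.
Qed.

(** For d = 0 the second derivative is the constant [- g] strictly inside. Subtracting the candidate
    leaves a function with zero derivative on the open interval; continuity of phi and its slope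
    reaches the end points. *)
Lemma fluxon_middle (L g : R) (phi : R -> R) (x : R) :
  0 < L -> pinned_fluxon L g 0 phi -> - L <= x <= L ->
  Derive phi x = Derive phi (- L) - g * (x + L) /\
  phi x = phi (- L) + Derive phi (- L) * (x + L) - g * (x + L) ^ 2 / 2.
Proof.
intros HL H.
assert (K : forall (f : R -> R) (y : R), - L <= y <= L ->
  (forall t, - L < t < L -> is_derive f t 0) ->
  (forall t, continuity_pt f t) -> f y = f (- L)).
{ intros f y [[Hy|<-] Hy'] Hd Hc; [|easy].
  destruct (mvt_open f (fun _ => 0) (- L) y Hy) as [c [_ E]]; [|auto|lra].
  intros t Ht. apply Hd. lra. }
assert (Hz : forall y, - L <= y <= L -> Derive phi y = Derive phi (- L) - g * (y + L)).
{ intros y Hy.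
  enough (Derive phi y - (- g * y) = Derive phi (- L) - (- g * - L)) by lra.
  apply (K (fun t => Derive phi t - (- g * t)) y Hy).
  - intros t Ht. assert (B := fluxon_derive2 L g phi t H).
    assert (Ht' : Rabs t < L) by (apply Rabs_def1; lra).
    specialize (B ltac:(lra)). unfold inhomogeneity in B. destruct (Rlt_dec (Rabs t) L); [|lra].
    rewrite Rmult_0_l Rminus_0_l in B. rewrite -(Rminus_diag (- g)).
    apply is_derive_sub; [exact B|]. auto_derive; [easy|ring].
  - intros t. apply continuity_pt_minus; [apply (fluxon_continuity L g), H|].
    eapply is_derive_continuity. auto_derive; [easy|reflexivity]. }
intros Hx. split; [now apply Hz|].
set (q := fun t => Derive phi (- L) * (t + L) - g * (t + L) ^ 2 / 2).
assert (E : phi x - q x = phi (- L) - q (- L)).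
{ apply (K (fun t => phi t - q t) x Hx).
  - intros t Ht.
    replace 0 with (Derive phi t - (Derive phi (- L) - g * (t + L))) by (rewrite Hz; lra).
    apply is_derive_sub; [apply (fluxon_derive L g), H|].
    unfold q. auto_derive; [easy|field].
  - intros t. apply continuity_pt_minus; [apply (fluxon_continuity L g), H|].
    eapply is_derive_continuity. unfold q. auto_derive; [easy|reflexivity]. }
unfold q in E. lra.
Qed.

(* Matching data of a pinned fluxon: u and v + 2 PI are the values at -L and L,
   pin and pout the slopes there; m is the turning point of the homoclinic loop. *)
Record orbit (g m L u v pin pout : R) : Prop := {
  orbit_u : u <= m;
  orbit_v : v <= m;
  orbit_pin : pin ^ 2 = 2 * gap g u;
  orbit_pout : pout ^ 2 = 2 * gap g v;
  orbit_left : u < asin g -> pin < 0;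
  orbit_right : v < asin g -> 0 < pout;
  orbit_slope : pin - pout = 2 * g * L;
  orbit_rise : 2 * PI + v - u = L * (pin + pout)
}.

Lemma orbit_of_fluxon (g m L : R) (phi : R -> R) :
  bias g -> is_top g m -> 0 < L -> pinned_fluxon L g 0 phi ->
  orbit g m L (phi (- L)) (phi L - 2 * PI) (Derive phi (- L)) (Derive phi L).
Proof.
intros Hg Hm HL H.
assert (TL := fluxon_left_tail L g phi HL H).
assert (TR := fluxon_right_tail L g phi HL H).
destruct (fluxon_middle L g phi L HL H ltac:(lra)) as [M1 M2].
assert (L1 := tail_le_top g m _ _ Hg Hm TL). assert (R1 := tail_le_top g m _ _ Hg Hm TR).
assert (L2 := tail_energy _ _ _ TL 0 (Rle_refl 0)). assert (R2 := tail_energy _ _ _ TR 0 (Rle_refl 0)).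
assert (L3 := tail_from_left g _ _ Hg TL). assert (R3 := tail_from_left g _ _ Hg TR).
simpl in L1, L2, L3, R1, R2, R3.
rewrite Rminus_0_r in L1, L2, L3. rewrite Rplus_0_r in R1, R2, R3.
split.
- exact L1.
- exact R1.
- rewrite -L2. ring.
- exact R2.
- intros Hu. specialize (L3 Hu). lra.
- exact R3.
- rewrite M1. ring.
- rewrite M2 M1. field.
Qed.

(** The two tail energies and the parabola in between give cos (phi L) - cos (phi (- L)) = 2 PI g,
    and the left side is at most 2. The tail energy is known for every [g], so the bound g <= 1 / PI
    is not presupposed. *)
Lemma energy_no_fluxon (g L : R) :
  1 / PI < g <= 1 -> 0 < L -> ~ exists phi, pinned_fluxon L g 0 phi.
Proof.
intros Hg HL [phi H].
assert (HP := PI_RGT_0).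
assert (TL := fluxon_left_tail L g phi HL H).
assert (TR := fluxon_right_tail L g phi HL H).
destruct (fluxon_middle L g phi L HL H ltac:(lra)) as [M1 M2].
assert (L2 := tail_energy _ _ _ TL 0 (Rle_refl 0)). assert (R2 := tail_energy _ _ _ TR 0 (Rle_refl 0)).
simpl in L2, R2. rewrite Rminus_0_r in L2. rewrite Rplus_0_r in R2.
unfold gap in L2, R2.
replace (cos (phi L - 2 * PI)) with (cos (phi L)) in R2.
2:{ replace (phi L - 2 * PI) with (phi L + - (2 * PI)) by ring.
    rewrite cos_plus sin_neg cos_neg sin_2PI cos_2PI. ring. }
assert (E : cos (phi L) - cos (phi (- L)) = 2 * PI * g).
{ rewrite M2 in R2 |- *. rewrite M1 in R2. nra. }
assert (1 < PI * g).
{ destruct Hg as [Hg _]. apply Rmult_lt_compat_l with (r := PI) in Hg; [|exact HP].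
  replace (PI * (1 / PI)) with 1 in Hg by (field; lra). exact Hg. }
assert (B1 := COS_bound (phi L)). assert (B2 := COS_bound (phi (- L))). lra.
Qed.

(** * Gluing two tails and a parabola into a fluxon *)

Definition glue (c : R) (f1 f2 : R -> R) (x : R) : R :=
  match Rlt_dec x c with left _ => f1 x | right _ => f2 x end.

Lemma glue_lt (c : R) (f1 f2 : R -> R) (x : R) : x < c -> glue c f1 f2 x = f1 x.
Proof. intros H. unfold glue. destruct (Rlt_dec x c); [easy|lra]. Qed.

Lemma glue_ge (c : R) (f1 f2 : R -> R) (x : R) : c <= x -> glue c f1 f2 x = f2 x.
Proof. intros H. unfold glue. destruct (Rlt_dec x c); [lra|easy]. Qed.

Lemma is_derive_glue_lt (c : R) (f1 f2 : R -> R) (x l : R) :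
  x < c -> is_derive f1 x l -> is_derive (glue c f1 f2) x l.
Proof.
intros Hx. apply is_derive_ext_loc.
apply (locally_interval _ x m_infty c); [easy|easy|].
intros t _ Ht. now rewrite glue_lt.
Qed.

Lemma is_derive_glue_gt (c : R) (f1 f2 : R -> R) (x l : R) :
  c < x -> is_derive f2 x l -> is_derive (glue c f1 f2) x l.
Proof.
intros Hx. apply is_derive_ext_loc.
apply (locally_interval _ x c p_infty); [easy|easy|].
intros t Ht _. rewrite glue_ge; [easy|]. left. exact Ht.
Qed.

Lemma is_derive_glue_eq (c : R) (f1 f2 : R -> R) (l : R) :
  f1 c = f2 c -> is_derive f1 c l -> is_derive f2 c l -> is_derive (glue c f1 f2) c l.
Proof.
intros E H1 H2. apply is_derive_Reals in H1, H2. apply is_derive_Reals.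
intros eps He. destruct (H1 eps He) as [d1 D1]. destruct (H2 eps He) as [d2 D2].
assert (Hd : 0 < Rmin d1 d2) by (apply Rmin_glb_lt; apply cond_pos).
exists (mkposreal _ Hd). simpl. intros h Hh Hd'.
rewrite (glue_ge c f1 f2 c (Rle_refl c)).
destruct (Rlt_dec h 0).
- rewrite glue_lt; [|lra]. rewrite <- E. apply D1; [easy|].
  eapply Rlt_le_trans; [exact Hd'|apply Rmin_l].
- rewrite glue_ge; [|lra]. apply D2; [easy|].
  eapply Rlt_le_trans; [exact Hd'|apply Rmin_r].
Qed.

Lemma is_derive_glue (c : R) (f1 f2 d1 d2 : R -> R) :
  f1 c = f2 c -> d1 c = d2 c ->
  (forall x, is_derive f1 x (d1 x)) -> (forall x, is_derive f2 x (d2 x)) ->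
  forall x, is_derive (glue c f1 f2) x (glue c d1 d2 x).
Proof.
intros E Ed H1 H2 x. destruct (Rtotal_order x c) as [Hx|[->|Hx]].
- rewrite glue_lt; [|easy]. now apply is_derive_glue_lt.
- rewrite glue_ge; [|lra]. apply is_derive_glue_eq; [easy| |easy]. now rewrite -Ed.
- rewrite glue_ge; [|lra]. now apply is_derive_glue_gt.
Qed.

(** When the values at [c] agree, the glued function is [f1 (Rmin x c) + f2 (Rmax x c) - f2 c], a
    composition of continuous functions on the whole line. *)
Lemma continuous_glue (c : R) (f1 f2 : R -> R) :
  f1 c = f2 c -> (forall x, continuous f1 x) -> (forall x, continuous f2 x) ->
  forall x, continuous (glue c f1 f2) x.
Proof.
intros E H1 H2 x.
apply continuous_ext with (fun x => f1 (Rmin x c) + f2 (Rmax x c) - f2 c).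
- intros t. unfold glue, Rmin, Rmax.
  destruct (Rlt_dec t c), (Rle_dec t c); try lra.
  replace t with c by lra. lra.
- assert (Cmin : continuous (fun t => Rmin t c) x).
  { apply continuity_pt_filterlim. apply continuity_pt_ext with (fun t => (t + c - Rabs (t - c)) / 2).
    - intros t. unfold Rmin, Rabs. destruct (Rle_dec t c), (Rcase_abs (t - c)); lra.
    - apply continuity_pt_mult; [|apply continuity_pt_cst].
      apply continuity_pt_minus.
      + eapply is_derive_continuity. auto_derive; [easy|reflexivity].
      + apply (continuity_pt_comp (fun t => t - c) Rabs); [|apply Rcontinuity_abs].
        eapply is_derive_continuity. auto_derive; [easy|reflexivity]. }
  assert (Cmax : continuous (fun t => Rmax t c) x).
  { apply continuous_ext with (fun t => t + c - Rmin t c).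
    - intros t. unfold Rmin, Rmax. destruct (Rle_dec t c); lra.
    - apply (continuous_minus (fun t : R => t + c)); [|exact Cmin].
      apply: ex_derive_continuous. auto_derive. easy. }
  apply (continuous_minus (fun t => f1 (Rmin t c) + f2 (Rmax t c)) (fun _ => f2 c)).
  + apply (continuous_plus (fun t => f1 (Rmin t c)) (fun t => f2 (Rmax t c))).
    * apply (continuous_comp (fun t => Rmin t c) f1); [exact Cmin|apply H1].
    * apply (continuous_comp (fun t => Rmax t c) f2); [exact Cmax|apply H2].
  + apply continuous_const.
Qed.

(** [orbit_slope] and [orbit_rise] are exactly the conditions that the parabola leaving [u] with
    slope [pin] arrives at L with the slope and value of the right tail. The left tail runs
    backwards, hence its initial slope [- pin]. *)
Lemma fluxon_of_orbit (g m L u v pin pout : R) :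
  bias g -> is_top g m -> 0 < L -> orbit g m L u v pin pout ->
  exists phi, pinned_fluxon L g 0 phi /\ phi (- L) = u /\ phi L = v + 2 * PI.
Proof.
intros Hg Hm HL H.
destruct (tail_exists g m u (- pin) Hg Hm) as [yl [zl [Pl [Eyl [Ezl Ll]]]]].
{ apply H. } { rewrite -(orbit_pin _ _ _ _ _ _ _ H). ring. }
{ intros Hu. assert (B := orbit_left _ _ _ _ _ _ _ H Hu). lra. }
destruct (tail_exists g m v pout Hg Hm) as [yr [zr [Pr [Eyr [Ezr Lr]]]]]; try apply H.
assert (E1 := orbit_slope _ _ _ _ _ _ _ H). assert (E2 := orbit_rise _ _ _ _ _ _ _ H).
set (fl := fun x => yl (- L - x)). set (dl := fun x => - zl (- L - x)).
set (fm := fun x => u + pin * (x + L) - g * (x + L) ^ 2 / 2). set (dm := fun x => pin - g * (x + L)).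
set (fr := fun x => yr (x - L) + 2 * PI). set (dr := fun x => zr (x - L)).
assert (Dl : forall x, is_derive fl x (dl x)).
{ intros x. destruct (Pl (- L - x)) as [A _]. unfold fl, dl. auto_derive.
  - eexists; eassumption.
  - rewrite (is_derive_unique _ _ _ A). ring. }
assert (DDl : forall x, is_derive dl x (sin (fl x) - g)).
{ intros x. destruct (Pl (- L - x)) as [_ A]. unfold fl, dl. auto_derive.
  - eexists; eassumption.
  - rewrite (is_derive_unique _ _ _ A). ring. }
assert (Dm : forall x, is_derive fm x (dm x)).
{ intros x. unfold fm, dm. auto_derive; [easy|field]. }
assert (DDm : forall x, is_derive dm x (- g)).
{ intros x. unfold dm. auto_derive; [easy|ring]. }
assert (Dr : forall x, is_derive fr x (dr x)).
{ intros x. destruct (Pr (x - L)) as [A _]. unfold fr, dr. auto_derive.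
  - eexists; eassumption.
  - rewrite (is_derive_unique _ _ _ A). ring. }
assert (DDr : forall x, is_derive dr x (sin (fr x) - g)).
{ intros x. destruct (Pr (x - L)) as [_ A]. unfold fr, dr.
  rewrite sin_plus sin_2PI cos_2PI. auto_derive.
  - eexists; eassumption.
  - rewrite (is_derive_unique _ _ _ A). ring. }
set (phi := glue (- L) fl (glue L fm fr)). set (dphi := glue (- L) dl (glue L dm dr)).
assert (El : fl (- L) = fm (- L)).
{ unfold fl, fm. rewrite Rminus_diag Eyl. field. }
assert (Er : fm L = fr L).
{ unfold fr, fm. rewrite Rminus_diag Eyr.
  replace pout with (pin - 2 * g * L) in E2 by lra. lra. }
assert (Edl : dl (- L) = dm (- L)).
{ unfold dl, dm. rewrite Rminus_diag Ezl. ring. }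
assert (Edr : dm L = dr L).
{ unfold dr, dm. rewrite Rminus_diag Ezr. lra. }
assert (Dphi : forall x, is_derive phi x (dphi x)).
{ apply is_derive_glue; auto.
  - rewrite glue_lt; [|lra]. exact El.
  - rewrite glue_lt; [|lra]. exact Edl.
  - now apply is_derive_glue. }
assert (DE : forall x, Derive phi x = dphi x).
{ intros x. apply is_derive_unique, Dphi. }
assert (DDphi : forall x, Rabs x <> L ->
  is_derive (Derive phi) x (inhomogeneity x L 0 * sin (phi x) - g)).
{ intros x Hx. apply is_derive_ext with dphi; [intros; now rewrite DE|].
  unfold inhomogeneity, phi, dphi.
  destruct (Rlt_dec x (- L)) as [H1|H1]; [|destruct (Rlt_dec x L) as [H2|H2]].
  - rewrite (Rabs_left x); [|lra]. destruct (Rlt_dec (- x) L); [lra|].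
    rewrite glue_lt; [|lra]. rewrite Rmult_1_l. now apply is_derive_glue_lt.
  - assert (x <> - L). { intros ->. apply Hx. rewrite Rabs_Ropp Rabs_pos_eq; lra. }
    destruct (Rlt_dec (Rabs x) L) as [|N]; [|exfalso; apply N, Rabs_def1; lra].
    replace (0 * _ - g) with (- g) by ring.
    apply is_derive_glue_gt; [lra|]. now apply is_derive_glue_lt.
  - rewrite (Rabs_pos_eq x) in Hx |- *; [|lra]. destruct (Rlt_dec x L); [lra|].
    rewrite glue_ge; [|lra]. rewrite glue_ge; [|lra]. rewrite Rmult_1_l.
    apply is_derive_glue_gt; [lra|]. apply is_derive_glue_gt; [lra|]. apply DDr. }
exists phi. split; [split|split].
- intros x. eexists. apply Dphi.
- intros x. apply continuous_ext with dphi; [intros; now rewrite DE|].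
  apply continuous_glue.
  + rewrite glue_lt; [|lra]. exact Edl.
  + intros t. apply: ex_derive_continuous. eexists. apply DDl.
  + apply continuous_glue; [exact Edr| |].
    * intros t. apply: ex_derive_continuous. eexists. apply DDm.
    * intros t. apply: ex_derive_continuous. eexists. apply DDr.
- intros x Hx. eexists. exact (DDphi x Hx).
- intros x Hx. change (Derive_n phi 2 x) with (Derive (Derive phi) x).
  rewrite (is_derive_unique _ _ _ (DDphi x Hx)). ring.
- apply is_lim_spec in Ll. apply is_lim_spec. intros eps.
  destruct (Ll eps) as [M HM]. exists (Rmin (- L) (- L - M)). intros x Hx.
  assert (x < - L) by (eapply Rlt_le_trans; [exact Hx|apply Rmin_l]).
  assert (x < - L - M) by (eapply Rlt_le_trans; [exact Hx|apply Rmin_r]).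
  unfold phi. rewrite glue_lt; [|easy]. apply HM. lra.
- apply is_lim_spec in Lr. apply is_lim_spec. intros eps.
  destruct (Lr eps) as [M HM]. exists (Rmax L (M + L)). intros x Hx.
  assert (L < x) by (eapply Rle_lt_trans; [apply Rmax_l|exact Hx]).
  assert (M + L < x) by (eapply Rle_lt_trans; [apply Rmax_r|exact Hx]).
  unfold phi. rewrite glue_ge; [|lra]. rewrite glue_ge; [|lra].
  unfold fr. replace (yr (x - L) + 2 * PI - (asin g + 2 * PI)) with (yr (x - L) - asin g) by ring.
  apply HM. lra.
- unfold phi. rewrite glue_ge; [|lra]. rewrite glue_lt; [|lra]. unfold fm. field.
- unfold phi. rewrite glue_ge; [|lra]. rewrite glue_ge; [|lra].
  unfold fr. now rewrite Rminus_diag Eyr.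
Qed.

Lemma fluxon_determined (L g : R) (phi1 phi2 : R -> R) :
  0 < L -> pinned_fluxon L g 0 phi1 -> pinned_fluxon L g 0 phi2 ->
  phi1 (- L) = phi2 (- L) -> Derive phi1 (- L) = Derive phi2 (- L) -> phi1 = phi2.
Proof.
intros HL H1 H2 E D.
assert (M : forall x, - L <= x <= L -> Derive phi1 x = Derive phi2 x /\ phi1 x = phi2 x).
{ intros x Hx. destruct (fluxon_middle L g phi1 x HL H1 Hx) as [-> ->].
  destruct (fluxon_middle L g phi2 x HL H2 Hx) as [-> ->]. rewrite E D. easy. }
destruct (M L ltac:(lra)) as [ML1 ML2].
assert (TL1 := fluxon_left_tail L g phi1 HL H1). assert (TR1 := fluxon_right_tail L g phi1 HL H1).
assert (TL2 := fluxon_left_tail L g phi2 HL H2). assert (TR2 := fluxon_right_tail L g phi2 HL H2).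
apply functional_extensionality. intros x.
destruct (Rlt_dec x (- L)) as [Hx|Hx]; [|destruct (Rle_dec x L) as [Hx'|Hx']].
- replace x with (- L - (- L - x)) by ring.
  apply (pendulum_unique g (fun t => phi1 (- L - t)) (fun t => - Derive phi1 (- L - t))
    (fun t => phi2 (- L - t)) (fun t => - Derive phi2 (- L - t))); try apply TL1; try apply TL2; try lra.
  + now rewrite Rminus_0_r.
  + now rewrite Rminus_0_r D.
- apply M; lra.
- assert (EE : phi1 (L + (x - L)) - 2 * PI = phi2 (L + (x - L)) - 2 * PI).
  { apply (pendulum_unique g (fun t => phi1 (L + t) - 2 * PI) (fun t => Derive phi1 (L + t))
      (fun t => phi2 (L + t) - 2 * PI) (fun t => Derive phi2 (L + t))); try apply TR1; try apply TR2; try lra.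
    + now rewrite Rplus_0_r ML2.
    + now rewrite Rplus_0_r. }
  replace (L + (x - L)) with x in EE by ring. lra.
Qed.

(** * Speeds on the homoclinic level and the entry angle *)

Lemma acos_ge_1 (x : R) : 1 <= x -> acos x = 0.
Proof.
intros Hx. unfold acos, asin.
destruct (Rle_dec x (-1)); [lra|]. destruct (Rle_dec 1 x); lra.
Qed.

(** The arguments 1 and -1 cannot be avoided: they occur at the ends of the exit range and in both
    limits of the bias. Near 1 the decrease of cos gives [acos t < e] as soon as t > cos e, and
    beyond 1 the total function is 0. *)
Lemma continuity_pt_acos_1 : continuity_pt acos 1.
Proof.
intros eps He. simpl. unfold R_dist.
assert (HP := PI_RGT_0).
set (e := Rmin eps PI).
assert (He1 : 0 < e) by (apply Rmin_glb_lt; lra).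
assert (He2 : e <= eps) by apply Rmin_l.
assert (He3 : e <= PI) by apply Rmin_r.
assert (Hc : cos e < 1) by (rewrite -cos_0; apply cos_decreasing_1; lra).
exists (1 - cos e). split; [lra|]. intros t [_ Ht].
rewrite (acos_ge_1 1 (Rle_refl 1)) Rminus_0_r.
apply Rabs_def2 in Ht. assert (Hb := acos_bound t).
rewrite Rabs_pos_eq; [|lra].
destruct (Rle_dec 1 t) as [H1|H1]; [rewrite acos_ge_1; lra|].
apply Rlt_le_trans with e; [|easy].
assert (Hce := COS_bound e).
apply cos_decreasing_0; try lra. rewrite cos_acos; lra.
Qed.

Lemma continuous_acos (x : R) : continuous acos x.
Proof.
apply continuity_pt_filterlim.
assert (Hopp : forall x, continuity_pt acos (- x) -> continuity_pt acos x).
{ clear. intros x H. apply continuity_pt_ext with (fun t => PI - acos (- t)).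
  - intros t. rewrite acos_opp. ring.
  - apply continuity_pt_minus; [apply continuity_pt_cst|].
    apply (continuity_pt_comp Ropp acos); [|exact H].
    apply derivable_continuous_pt, derivable_pt_opp, derivable_pt_id. }
assert (Hge : forall x, 1 < x -> continuity_pt acos x).
{ clear. intros x Hx. apply continuity_pt_filterlim.
  apply (continuous_ext_loc _ (fun _ => 0)); [|apply continuous_const].
  apply (locally_interval _ x 1 p_infty); [easy|easy|].
  intros y Hy _. rewrite acos_ge_1; [easy|]. left. exact Hy. }
destruct (Rtotal_order x 1) as [H|[->|H]]; [|apply continuity_pt_acos_1|now apply Hge].
destruct (Rtotal_order x (-1)) as [H'|[->|H']].
- apply Hopp, Hge. lra.
- apply Hopp. replace (- -1) with 1 by ring. apply continuity_pt_acos_1.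
- apply derivable_continuous_pt, derivable_pt_acos. lra.
Qed.

Lemma is_derive_acos (x : R) : -1 < x < 1 -> is_derive acos x (- / sin (acos x)).
Proof.
intros Hx. apply is_derive_Reals.
assert (H := derive_pt_acos x Hx).
apply derive_pt_eq_1 in H. replace (- / sin (acos x)) with (-1 / sqrt (1 - x²)); [exact H|].
rewrite sin_acos; [|lra]. unfold Rdiv. ring.
Qed.

(* mom x is the speed on the homoclinic level at x. *)
Definition mom (g x : R) : R := sqrt (2 * gap g x).

Lemma mom_ge_0 (g x : R) : 0 <= mom g x.
Proof. apply sqrt_pos. Qed.

Lemma mom_pos (g x : R) : 0 < gap g x -> 0 < mom g x.
Proof. intros H. apply sqrt_lt_R0. lra. Qed.

Lemma mom_sq (g x : R) : 0 <= gap g x -> mom g x ^ 2 = 2 * gap g x.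
Proof. intros H. unfold mom. rewrite -Rsqr_pow2 Rsqr_sqrt; lra. Qed.

Lemma mom_0 (g x : R) : gap g x = 0 -> mom g x = 0.
Proof. intros H. unfold mom. rewrite H Rmult_0_r. apply sqrt_0. Qed.

Lemma mom_unique (g x p : R) : 0 <= p -> p ^ 2 = 2 * gap g x -> p = mom g x.
Proof. intros Hp H. unfold mom. rewrite -H -Rsqr_pow2 sqrt_Rsqr; lra. Qed.

Lemma mom_lt (g x y : R) : 0 <= gap g x -> gap g x < gap g y -> mom g x < mom g y.
Proof. intros H1 H2. apply sqrt_lt_1_alt. lra. Qed.

Lemma mom_continuous (g x : R) : continuous (mom g) x.
Proof.
apply continuous_sqrt_comp. apply: ex_derive_continuous.
unfold gap. auto_derive. easy.
Qed.

Lemma is_derive_mom (g x : R) : 0 < gap g x -> is_derive (mom g) x ((sin x - g) / mom g x).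
Proof.
intros H. assert (Hm := mom_pos g x H).
replace ((sin x - g) / mom g x) with (2 * (sin x - g) / (2 * sqrt (2 * gap g x))).
2:{ change (sqrt (2 * gap g x)) with (mom g x). field. lra. }
apply (is_derive_sqrt (fun x => 2 * gap g x)); [|lra].
unfold gap. auto_derive; [easy|ring].
Qed.

(* The entry angle in [0, PI] that energy conservation across the
   inhomogeneity assigns to the exit angle v; the other one is its mirror image. *)
Definition entry (g v : R) : R := acos (cos v - 2 * PI * g).

(** The exit angle whose entry angle is PI; there the two sides u and 2 PI - u meet. *)
Definition vmax (g : R) : R := acos (2 * PI * g - 1).

Lemma entry_continuous (g v : R) : continuous (entry g) v.
Proof.
apply (continuous_comp (fun v => cos v - 2 * PI * g) acos); [|apply continuous_acos].
apply: ex_derive_continuous. auto_derive. easy.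
Qed.

Lemma entry_bound (g v : R) : 0 <= entry g v <= PI.
Proof. apply acos_bound. Qed.

Lemma cos_vmax (g : R) : bias g -> cos (vmax g) = 2 * PI * g - 1.
Proof. intros Hg. destruct (bias_PI g Hg). assert (HP := PI_RGT_0). apply cos_acos. nra. Qed.

(** With a = asin g, 1 - cos a <= 1 - cos^2 a = g^2 < 2 PI g. This places every entry angle right of
    the saddle and [vmax] left of PI - a. *)
Lemma cos_asin_gt (g : R) : bias g -> 1 - 2 * PI * g < cos (asin g).
Proof.
intros Hg. destruct (bias_PI g Hg) as [H1 [H2 H3]]. destruct (bias_asin g Hg) as [Ha [Es Hc]].
assert (HP := PI_gt_3). assert (Bc := COS_bound (asin g)).
assert (Hsc := sin2_cos2 (asin g)). unfold Rsqr in Hsc. rewrite Es in Hsc.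
assert (0 <= cos (asin g) * (1 - cos (asin g))) by nra.
assert (0 < g * (2 * PI - g)) by nra. nra.
Qed.

Lemma vmax_bound (g : R) : bias g -> 0 <= vmax g <= PI - asin g.
Proof.
intros Hg. destruct (bias_PI g Hg) as [H1 [H2 H3]]. destruct (bias_asin g Hg) as [Ha [Es Hc]].
assert (HP := PI_gt_3).
assert (B := acos_bound (2 * PI * g - 1)). fold (vmax g) in B.
split; [lra|].
assert (C := cos_asin_gt g Hg).
apply cos_decr_0; try lra.
rewrite cos_vmax; [|easy]. rewrite Rtrigo_facts.cos_pi_minus. lra.
Qed.

Lemma cos_entry (g v : R) : bias g -> cos (vmax g) <= cos v ->
  cos (entry g v) = cos v - 2 * PI * g.
Proof.
intros Hg Hv. destruct (bias_PI g Hg) as [H1 _]. assert (HP := PI_RGT_0).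
rewrite cos_vmax in Hv; [|easy]. assert (B := COS_bound v). apply cos_acos. nra.
Qed.

Lemma entry_gt (g v : R) : bias g -> cos (vmax g) <= cos v -> asin g < entry g v.
Proof.
intros Hg Hv. destruct (bias_PI g Hg) as [H1 _]. destruct (bias_asin g Hg) as [Ha [Es Hc]].
assert (HP := PI_gt_3). assert (B := entry_bound g v).
apply cos_decreasing_0; try lra.
rewrite cos_entry; auto. assert (Bv := COS_bound v).
assert (C := cos_asin_gt g Hg). lra.
Qed.

Lemma entry_lt_PI (g v : R) : bias g -> cos (vmax g) < cos v -> entry g v < PI.
Proof.
intros Hg Hv. assert (B := entry_bound g v). assert (HP := PI_RGT_0).
apply cos_decreasing_0; try lra.
rewrite cos_entry; [|easy|lra]. rewrite cos_PI. rewrite cos_vmax in Hv; [|easy]. lra.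
Qed.

Lemma entry_PI (g v : R) : bias g -> cos v = cos (vmax g) -> entry g v = PI.
Proof.
intros Hg Hv. assert (B := entry_bound g v). assert (HP := PI_RGT_0).
apply cos_inj; try lra.
rewrite cos_entry; [|easy|lra]. rewrite cos_PI Hv cos_vmax; [|easy]. ring.
Qed.

Lemma entry_gt_abs (g v : R) : bias g -> cos (vmax g) <= cos v -> -PI <= v <= PI ->
  - entry g v < v < entry g v.
Proof.
intros Hg Hv Hb. destruct (bias_PI g Hg) as [H1 _].
assert (B := entry_bound g v). assert (HP := PI_RGT_0).
assert (Rabs v < entry g v).
{ assert (Rabs v <= PI) by (apply Rabs_le; lra). assert (Hp := Rabs_pos v).
  apply cos_decreasing_0; try lra. rewrite cos_entry; auto.
  assert (cos (Rabs v) = cos v); [|nra].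
  unfold Rabs. destruct (Rcase_abs v); [apply cos_neg|easy]. }
apply Rabs_def2 in H. lra.
Qed.

Lemma cos_ge_vmax (g v : R) : bias g -> - vmax g <= v <= vmax g -> cos (vmax g) <= cos v.
Proof.
intros Hg Hv. destruct (vmax_bound g Hg) as [B1 B2]. destruct (bias_asin g Hg) as [Ha _].
destruct (Rle_dec 0 v).
- apply cos_decr_1; lra.
- rewrite -(cos_neg v). apply cos_decr_1; lra.
Qed.

Lemma cos_gt_vmax (g v : R) : bias g -> - vmax g < v < vmax g -> cos (vmax g) < cos v.
Proof.
intros Hg Hv. destruct (vmax_bound g Hg) as [B1 B2]. destruct (bias_asin g Hg) as [Ha _].
destruct (Rle_dec 0 v).
- apply cos_decreasing_1; lra.
- rewrite -(cos_neg v). apply cos_decreasing_1; lra.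
Qed.

Lemma cos_2PI_minus (x : R) : cos (2 * PI - x) = cos x.
Proof. rewrite cos_minus cos_2PI sin_2PI. ring. Qed.

Lemma sin_2PI_minus (x : R) : sin (2 * PI - x) = - sin x.
Proof. rewrite sin_minus cos_2PI sin_2PI. ring. Qed.

Lemma is_derive_entry (g v : R) : bias g -> cos (vmax g) < cos v ->
  is_derive (entry g) v (sin v / sin (entry g v)).
Proof.
intros Hg Hv. destruct (bias_PI g Hg) as [H1 _]. assert (HP := PI_RGT_0).
assert (B := COS_bound v).
unfold entry at 1.
replace (sin v / sin (entry g v)) with (scal (- sin v) (- / sin (entry g v))).
2:{ unfold scal; simpl; unfold mult; simpl. unfold Rdiv. ring. }
apply (is_derive_comp acos (fun v => cos v - 2 * PI * g)).
- apply is_derive_acos. rewrite cos_vmax in Hv; [|easy]. nra.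
- auto_derive; [easy|ring].
Qed.

Lemma gap_match (g u v : R) : cos v - cos u = 2 * PI * g ->
  gap g u = gap g v + g * (2 * PI + v - u).
Proof. intros H. unfold gap. lra. Qed.

Lemma gap_ge_0 (g m v : R) : bias g -> is_top g m -> v <= m -> 0 <= gap g v.
Proof.
intros Hg Hm Hv. destruct (Rtotal_order v (asin g)) as [H|[->|H]].
- left. now apply gap_pos_left.
- rewrite gap_asin. lra.
- destruct Hv as [Hv|Hv]; [left; now apply (gap_pos_top g m)|].
  rewrite Hv (proj2 Hm). lra.
Qed.

Lemma le_top (g m u : R) : bias g -> is_top g m -> u <= 2 * PI -> 0 <= gap g u -> u <= m.
Proof.
intros Hg Hm Hu H. apply Rnot_lt_le. intros Hn. destruct (bias_asin g Hg) as [Ha _].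
assert (gap g u < 0) by (apply (gap_neg_top g m); [easy|easy|lra]). lra.
Qed.

Definition entry_side (g : R) (s : bool) (v : R) : R :=
  match s with true => entry g v | false => 2 * PI - entry g v end.

(** The second range, below the turning point, is empty when [m] is smaller than
    [2 * PI - vmax g]. *)
Definition exit_angle (g m v : R) : Prop :=
  - vmax g <= v <= vmax g \/ 2 * PI - vmax g <= v <= m.

Lemma exit_angle_facts (g m v : R) : bias g -> is_top g m -> exit_angle g m v ->
  v <= m /\ cos (vmax g) <= cos v /\ - entry g v < v.
Proof.
intros Hg Hm Hv. destruct (vmax_bound g Hg) as [B1 B2]. destruct (bias_asin g Hg) as [Ha _].
destruct Hm as [Hm Em]. assert (Be := entry_bound g v).
destruct Hv as [Hv|Hv].
- assert (Hc := cos_ge_vmax g v Hg Hv).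
  repeat split; [lra|easy|apply (entry_gt_abs g v); [easy|easy|lra]].
- assert (Hc : cos (vmax g) <= cos v).
  { rewrite -(cos_2PI_minus v). apply cos_decr_1; lra. }
  repeat split; [lra|easy|lra].
Qed.

Lemma entry_side_facts (g m v : R) (s : bool) :
  bias g -> is_top g m -> exit_angle g m v ->
  let u := entry_side g s v in
  asin g < u <= m /\ cos v - cos u = 2 * PI * g /\ 0 < 2 * PI + v - u /\
  0 <= gap g v /\ gap g v < gap g u.
Proof.
intros Hg Hm Hv u. destruct (exit_angle_facts g m v Hg Hm Hv) as [F1 [F2 F3]].
assert (Hgv := gap_ge_0 g m v Hg Hm F1).
assert (Be := entry_bound g v). assert (Ge := entry_gt g v Hg F2).
destruct (bias_asin g Hg) as [Ha _]. destruct (bias_PI g Hg) as [Hg0 _].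
assert (Ce : cos v - cos u = 2 * PI * g).
{ unfold u, entry_side. destruct s; rewrite ?cos_2PI_minus cos_entry; auto; ring. }
assert (P : 0 < 2 * PI + v - u) by (unfold u, entry_side; destruct s; lra).
assert (M := gap_match g u v Ce).
assert (gap g v < gap g u) by nra.
repeat split; auto; try lra.
- unfold u, entry_side. destruct s; lra.
- apply (le_top g); [easy|easy| |lra]. unfold u, entry_side. destruct s; lra.
Qed.

(** [L] is read off from the slope equation. The rise equation then follows by dividing the energy
    identity (pin - pout)(pin + pout) = 2 g (2 PI + v - u) by pin - pout = 2 g L. Positivity of [L]
    holds since the gap at [v] is below that at [u]. *)
Lemma orbit_exists (g m v z : R) (s : bool) :
  bias g -> is_top g m -> exit_angle g m v -> z ^ 2 = 2 * gap g v -> (v < asin g -> 0 < z) ->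
  let u := entry_side g s v in let L := (mom g u - z) / (2 * g) in
  0 < L /\ orbit g m L u v (mom g u) z.
Proof.
intros Hg Hm Hv Hz Hz' u L.
destruct (entry_side_facts g m v s Hg Hm Hv) as [F1 [F2 [F3 [F4 F5]]]]. fold u in F1, F2, F3, F5.
destruct (bias_PI g Hg) as [Hg0 _].
assert (Eu := mom_sq g u ltac:(lra)). assert (Pu := mom_pos g u ltac:(lra)).
assert (M := gap_match g u v F2).
assert (HL : 0 < L).
{ apply Rdiv_lt_0_compat; [|lra]. nra. }
split; [exact HL|].
assert (E : mom g u - z = 2 * g * L) by (unfold L; field; lra).
split; auto; try lra.
- apply (exit_angle_facts g m v); auto.
- assert (Q : 2 * g * (2 * PI + v - u) = 2 * g * L * (mom g u + z)).
  { rewrite -E. nra. }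
  apply Rmult_eq_reg_l with (2 * g); lra.
Qed.

(** If pin <= 0, then pout < 0 too and the phase would fall across the inhomogeneity; but pout < 0
    puts [v] right of the saddle, and u <= m < 2 PI then forces a rise. So pin is the positive root
    and [u] lies right of the saddle. *)
Lemma orbit_inv (g m L u v pin pout : R) :
  bias g -> is_top g m -> 0 < L -> orbit g m L u v pin pout ->
  asin g < u <= m /\ pin = mom g u /\ exit_angle g m v /\
  exists s : bool, u = entry_side g s v /\
    match s with true => u <= PI | false => PI < u end.
Proof.
intros Hg Hm HL H.
destruct (bias_PI g Hg) as [Hg0 _]. destruct (bias_asin g Hg) as [Ha _].
destruct H as [H1 H2 H3 H4 H5 H6 H7 H8].
assert (HgL : 0 < g * L) by nra.
assert (Hm2 := proj1 Hm).
assert (HP := PI_RGT_0).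
assert (Hdown : pout < 0 -> pin <= 0 -> False).
{ intros Ho Hi. assert (2 * PI + v - u < 0) by nra.
  destruct (Rlt_dec v (asin g)) as [Hv|Hv]; [specialize (H6 Hv); lra|lra]. }
assert (Hpin : 0 < pin).
{ apply Rnot_le_lt. intros Hn. apply Hdown; [nra|easy]. }
assert (Hu : asin g < u).
{ destruct (Rtotal_order u (asin g)) as [Hu|[Hu|Hu]]; [specialize (H5 Hu); lra| |easy].
  rewrite Hu gap_asin in H3. nra. }
assert (Ec : cos v - cos u = 2 * PI * g).
{ assert (E : pin ^ 2 - pout ^ 2 = 2 * g * (2 * PI + v - u)) by (rewrite H8; nra).
  rewrite H3 H4 in E. unfold gap in E. nra. }
assert (Hvu : u - 2 * PI < v).
{ destruct (Rlt_dec v (asin g)) as [Hv|Hv]; [specialize (H6 Hv); nra|lra]. }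
assert (Cm := cos_vmax g Hg). assert (Bm := vmax_bound g Hg).
assert (Bu := COS_bound u). assert (Bv := COS_bound v).
assert (Hcv : cos (vmax g) <= cos v) by lra.
split; [lra|]. split; [apply mom_unique; lra|]. split.
(* Otherwise [- v] would lie between u and 2 PI - u, where cos is at most cos u, contrary to cos v -
   cos u = 2 PI g > 0. *)
- assert (Hvu' : v < PI -> - u < v).
  { intros HvP. apply Rnot_le_lt. intros Hn.
    assert (cos v <= cos u); [|nra].
    destruct (Rle_dec u PI).
    - rewrite -(cos_neg v). destruct (Rle_dec (- v) PI).
      + apply cos_decr_1; lra.
      + rewrite -(cos_2PI_minus (- v)). apply cos_decr_1; lra.
    - rewrite -(cos_2PI_minus u) -(cos_neg v). apply cos_decr_1; lra. }
  destruct (Rle_dec v PI) as [HvP|HvP].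
  + left. split.
    * destruct (Rle_dec 0 v); [lra|].
      destruct (Rle_dec (- PI) v) as [Hv1|Hv1].
      -- assert (- v <= vmax g); [|lra]. apply cos_decr_0; try lra. now rewrite cos_neg.
      -- exfalso. assert (Hvu2 := Hvu' ltac:(lra)).
         assert (cos v <= cos u); [|nra].
         rewrite -(cos_2PI_minus u) -(cos_neg v) -(cos_2PI_minus (- v)).
         apply cos_decr_1; lra.
    * destruct (Rle_dec 0 v); [|lra]. apply cos_decr_0; lra.
  + right. split; [|easy].
    assert (2 * PI - v <= vmax g); [|lra].
    apply cos_decr_0; try lra. now rewrite cos_2PI_minus.
- destruct (Rle_dec u PI) as [HuP|HuP].
  + exists true. split; [|easy]. simpl. unfold entry.
    replace (cos v - 2 * PI * g) with (cos u) by lra. rewrite acos_cos; lra.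
  + exists false. split; [|lra]. simpl. unfold entry.
    replace (cos v - 2 * PI * g) with (cos (2 * PI - u)) by (rewrite cos_2PI_minus; lra).
    rewrite acos_cos; lra.
Qed.

(** * Monotonicity and unimodality of the length *)

(* Unlike mom, which has a corner at the saddle asin g, its signed version is
   differentiable there. *)
Definition smom (g : R) : R -> R := glue (asin g) (fun x => - mom g x) (mom g).

Lemma smom_lt (g x : R) : x < asin g -> smom g x = - mom g x.
Proof. intros H. unfold smom. now rewrite glue_lt. Qed.

Lemma smom_ge (g x : R) : asin g <= x -> smom g x = mom g x.
Proof. intros H. unfold smom. now rewrite glue_ge. Qed.

Lemma smom_continuous (g x : R) : continuous (smom g) x.
Proof.
apply continuous_glue.
- rewrite mom_0; [ring|apply gap_asin].
- intros t. apply (continuous_opp (mom g)), mom_continuous.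
- intros t. apply mom_continuous.
Qed.

Lemma smom_sq (g x : R) : 0 <= gap g x -> smom g x ^ 2 = 2 * gap g x.
Proof.
intros H. assert (E := mom_sq g x H). destruct (Rlt_dec x (asin g)).
- rewrite smom_lt; [|easy]. lra.
- rewrite smom_ge; lra.
Qed.

Lemma smom_neg (g x : R) : bias g -> x < asin g -> smom g x < 0.
Proof.
intros Hg H. rewrite smom_lt; [|easy].
assert (P := mom_pos g x (gap_pos_left g x Hg H)). lra.
Qed.

Lemma is_derive_smom (g x : R) : x <> asin g -> 0 < gap g x ->
  is_derive (smom g) x ((sin x - g) / smom g x).
Proof.
intros N H. assert (P := mom_pos g x H). assert (D := is_derive_mom g x H).
destruct (Rlt_dec x (asin g)) as [Hx|Hx].
- rewrite smom_lt; [|easy]. unfold smom. apply is_derive_glue_lt; [easy|].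
  replace ((sin x - g) / - mom g x) with (- ((sin x - g) / mom g x)) by (field; lra).
  now apply (is_derive_opp (mom g)).
- rewrite smom_ge; [|lra]. unfold smom. apply is_derive_glue_gt; [lra|easy].
Qed.

(* The sign of bend is opposite to that of the second derivative of smom
   with respect to - cos x, up to the factor smom. *)
Definition bend (g x : R) : R := sin x * (sin x - g) ^ 2 - 2 * g * gap g x * cos x.

Lemma is_derive_bend (g x : R) :
  is_derive (bend g) x (3 * (sin x - g) ^ 2 * cos x + 2 * g * gap g x * sin x).
Proof. unfold bend, gap. auto_derive; [easy|ring]. Qed.

Lemma bend_asin (g : R) : bias g -> bend g (asin g) = 0.
Proof.
intros Hg. destruct (bias_asin g Hg) as [_ [Es _]]. unfold bend. rewrite gap_asin Es. ring.
Qed.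

Lemma gap_pos (g x : R) : bias g -> x <= PI -> x <> asin g -> 0 < gap g x.
Proof.
intros Hg H N. destruct (top_exists g Hg) as [m Hm].
destruct (Rlt_dec x (asin g)); [now apply gap_pos_left|].
apply (gap_pos_top g m); [easy|easy|]. destruct Hm. lra.
Qed.

(** Up to PI / 2 [bend] increases from its zero at the saddle; beyond, cos is negative and neither
    term of [bend] can lower it. *)
Lemma bend_pos (g x : R) : bias g -> asin g < x < PI -> 0 < bend g x.
Proof.
intros Hg Hx. destruct (bias_asin g Hg) as [Ha [Es Hc]]. destruct (bias_PI g Hg) as [Hg0 _].
destruct (Rle_dec x (PI / 2)) as [Hx'|Hx'].
- rewrite -(bend_asin g Hg).
  apply (derive_pos_lt_closed _ _ _ _ (proj1 Hx) (fun t _ => is_derive_bend g t)).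
  intros t Ht. assert (0 < sin t) by (apply sin_gt_0; lra).
  assert (0 < cos t) by (apply cos_gt_0; lra).
  assert (0 <= (sin t - g) ^ 2) by apply pow2_ge_0.
  assert (P := gap_pos g t Hg ltac:(lra) ltac:(lra)).
  assert (0 < g * gap g t) by nra. nra.
- assert (0 < sin x) by (apply sin_gt_0; lra).
  assert (cos x < 0) by (apply cos_lt_0; lra).
  assert (0 <= (sin x - g) ^ 2) by apply pow2_ge_0.
  assert (P := gap_pos g x Hg ltac:(lra) ltac:(lra)).
  assert (0 < g * gap g x) by nra. unfold bend. nra.
Qed.

Lemma bend_neg (g x : R) : bias g -> 0 < x < asin g -> bend g x < 0.
Proof.
intros Hg Hx. destruct (bias_asin g Hg) as [Ha [Es Hc]]. destruct (bias_PI g Hg) as [Hg0 _].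
rewrite -(bend_asin g Hg).
apply (derive_pos_lt_closed _ _ _ _ (proj2 Hx) (fun t _ => is_derive_bend g t)).
intros t Ht. assert (0 < sin t) by (apply sin_gt_0; lra).
assert (0 < cos t) by (apply cos_gt_0; lra).
assert (0 <= (sin t - g) ^ 2) by apply pow2_ge_0.
assert (P := gap_pos g t Hg ltac:(lra) ltac:(lra)).
assert (0 < g * gap g t) by nra. nra.
Qed.

(** The difference of the two sides vanishes at the saddle and has derivative 2 gap sin x > 0. It
    supplies the bound on [p ^ 2 * c] in [second_derivative_loop_pos]. *)
Lemma gap_cos_lt (g x : R) : bias g -> asin g < x < PI -> g < sin x ->
  2 * gap g x * cos x < (sin x - g) ^ 2.
Proof.
intros Hg Hx Hs. destruct (bias_asin g Hg) as [Ha [Es Hc]].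
destruct (Rle_dec x (PI / 2)) as [Hx'|Hx'].
- assert (H : (sin (asin g) - g) ^ 2 - 2 * gap g (asin g) * cos (asin g)
    < (sin x - g) ^ 2 - 2 * gap g x * cos x).
  { apply (derive_pos_lt_closed (fun t => (sin t - g) ^ 2 - 2 * gap g t * cos t)
      (fun t => 2 * gap g t * sin t) _ _ (proj1 Hx)).
    - intros t _. unfold gap. auto_derive; [easy|ring].
    - intros t Ht. assert (0 < sin t) by (apply sin_gt_0; lra).
      assert (P := gap_pos g t Hg ltac:(lra) ltac:(lra)). nra. }
  rewrite Es gap_asin in H. lra.
- assert (cos x < 0) by (apply cos_lt_0; lra).
  assert (P := gap_pos g x Hg ltac:(lra) ltac:(lra)). nra.
Qed.

(* kappa is the derivative of smom with respect to - cos x. *)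
Definition kappa (g x : R) : R := (1 - g / sin x) / smom g x.

Lemma smom_neq_0 (g x : R) : bias g -> x <= PI -> x <> asin g -> smom g x <> 0.
Proof.
intros Hg H N E. assert (P := gap_pos g x Hg H N).
assert (E' := smom_sq g x ltac:(lra)). rewrite E in E'. lra.
Qed.

Lemma is_derive_kappa (g x : R) : bias g -> 0 < x < PI -> x <> asin g ->
  is_derive (kappa g) x (- bend g x / (sin x ^ 2 * smom g x ^ 3)).
Proof.
intros Hg Hx N. assert (P := gap_pos g x Hg ltac:(lra) N).
assert (D := is_derive_smom g x N P). assert (Nq := smom_neq_0 g x Hg ltac:(lra) N).
assert (E := smom_sq g x ltac:(lra)).
assert (Hs : 0 < sin x) by (apply sin_gt_0; lra).
unfold kappa. auto_derive.
- repeat split; try lra; try easy. eexists; exact D.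
- rewrite (is_derive_unique _ _ _ D). unfold bend.
  replace (2 * g * gap g x * cos x) with (g * cos x * (smom g x ^ 2)) by (rewrite E; ring).
  field. split; lra.
Qed.

Lemma kappa_decr_right (g x y : R) : bias g -> asin g < x -> x < y -> y < PI ->
  kappa g y < kappa g x.
Proof.
intros Hg Hx Hxy Hy. destruct (bias_asin g Hg) as [Ha _].
apply (derive_neg_lt_closed _ (fun x => - bend g x / (sin x ^ 2 * smom g x ^ 3)) _ _ Hxy).
- intros t Ht. apply is_derive_kappa; [easy|lra|lra].
- intros t Ht. assert (B := bend_pos g t Hg ltac:(lra)).
  assert (0 < sin t) by (apply sin_gt_0; lra).
  assert (0 < smom g t) by (rewrite smom_ge; [apply mom_pos, gap_pos; easy || lra|lra]).
  apply Rlt_div_l; [apply Rmult_lt_0_compat; now apply pow_lt|lra].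
Qed.

Lemma kappa_decr_left (g x y : R) : bias g -> 0 < x -> x < y -> y < asin g ->
  kappa g y < kappa g x.
Proof.
intros Hg Hx Hxy Hy. destruct (bias_asin g Hg) as [Ha _].
apply (derive_neg_lt_closed _ (fun x => - bend g x / (sin x ^ 2 * smom g x ^ 3)) _ _ Hxy).
- intros t Ht. apply is_derive_kappa; [easy|lra|lra].
- intros t Ht. assert (B := bend_neg g t Hg ltac:(lra)).
  assert (0 < sin t) by (apply sin_gt_0; lra).
  assert (N := smom_neg g t Hg ltac:(lra)).
  assert (0 < (- smom g t) ^ 3) by (apply pow_lt; lra).
  assert (0 < sin t ^ 2) by (now apply pow_lt).
  replace (- bend g t / (sin t ^ 2 * smom g t ^ 3)) with
    (bend g t / (sin t ^ 2 * (- smom g t) ^ 3)) by (field; lra).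
  apply Rlt_div_l; [now apply Rmult_lt_0_compat|lra].
Qed.

(* Both one-sided limits of kappa at asin g equal sqrt (cos (asin g)) / g; this
   compares kappa ^ 2 with the square of that value. *)
Lemma saddle_slope_decr (g x y : R) : bias g -> 0 < x -> x < y -> y <= PI / 2 ->
  g ^ 2 * (sin y - g) ^ 2 - 2 * gap g y * cos (asin g) * sin y ^ 2 <
  g ^ 2 * (sin x - g) ^ 2 - 2 * gap g x * cos (asin g) * sin x ^ 2.
Proof.
intros Hg Hx Hxy Hy. destruct (bias_asin g Hg) as [Ha [Es Hc]]. destruct (bias_PI g Hg) as [Hg0 _].
set (c := cos (asin g)) in *.
set (f := fun t => g ^ 2 * (sin t - g) ^ 2 - 2 * gap g t * c * sin t ^ 2).
set (df := fun t => 2 * ((sin t - g) * (g ^ 2 * cos t - sin t ^ 2 * c))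
  - 4 * gap g t * c * sin t * cos t).
assert (D : forall t, is_derive f t (df t)).
{ intros t. unfold f, df, gap. auto_derive; [easy|]. fold c. ring. }
assert (Hneg : forall t, 0 < t < PI / 2 -> t <> asin g -> df t < 0).
{ intros t Ht N. assert (0 < sin t) by (apply sin_gt_0; lra).
  assert (0 < cos t) by (apply cos_gt_0; lra).
  assert (P := gap_pos g t Hg ltac:(lra) N).
  assert (0 < gap g t * c * sin t * cos t) by (repeat apply Rmult_lt_0_compat; lra).
  (* Both factors change sign at the saddle, in opposite directions. *)
  assert ((sin t - g) * (g ^ 2 * cos t - sin t ^ 2 * c) <= 0); [|unfold df; lra].
  destruct (Rlt_dec t (asin g)) as [Hta|Hta].
  - assert (sin t < g) by (rewrite -Es; apply sin_increasing_1; lra).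
    assert (c < cos t) by (apply cos_decreasing_1; lra).
    assert (sin t ^ 2 < g ^ 2) by nra.
    assert (sin t ^ 2 * c <= g ^ 2 * cos t) by (apply Rmult_le_compat; nra). nra.
  - assert (g < sin t) by (rewrite -{1}Es; apply sin_increasing_1; lra).
    assert (cos t < c) by (apply cos_decreasing_1; lra).
    assert (g ^ 2 < sin t ^ 2) by nra.
    assert (g ^ 2 * cos t <= sin t ^ 2 * c) by (apply Rmult_le_compat; nra). nra. }
change (f y < f x).
destruct (Rle_dec y (asin g)) as [H1|H1]; [|destruct (Rle_dec (asin g) x) as [H2|H2]].
- apply (derive_neg_lt_closed f df x y Hxy (fun t _ => D t)). intros t Ht. apply Hneg; lra.
- apply (derive_neg_lt_closed f df x y Hxy (fun t _ => D t)). intros t Ht. apply Hneg; lra.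
- apply Rlt_trans with (f (asin g)).
  + apply (derive_neg_lt_closed f df (asin g) y); [lra|auto|]. intros t Ht. apply Hneg; lra.
  + apply (derive_neg_lt_closed f df x (asin g)); [lra|auto|]. intros t Ht. apply Hneg; lra.
Qed.

(** [kappa] has the form 0/0 at the saddle, so the two monotone pieces are joined by comparing each
    with the common limit [k / g], k = sqrt (cos (asin g)). For [y] beyond PI / 2 the comparison is
    passed through PI / 2. *)
Lemma kappa_cross_saddle (g x y : R) : bias g -> 0 < x < asin g -> asin g < y < PI ->
  kappa g y < kappa g x.
Proof.
intros Hg Hx Hy. destruct (bias_asin g Hg) as [Ha [Es Hc]]. destruct (bias_PI g Hg) as [Hg0 _].
assert (Hle : forall z, asin g < z <= PI / 2 -> kappa g z < kappa g x).
{ intros z Hz.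
  assert (Sx := saddle_slope_decr g x (asin g) Hg ltac:(lra) ltac:(lra) ltac:(lra)).
  assert (Sz := saddle_slope_decr g (asin g) z Hg ltac:(lra) ltac:(lra) ltac:(lra)).
  rewrite Es gap_asin in Sx, Sz.
  assert (Px := gap_pos g x Hg ltac:(lra) ltac:(lra)).
  assert (Pz := gap_pos g z Hg ltac:(lra) ltac:(lra)).
  assert (0 < sin x) by (apply sin_gt_0; lra). assert (0 < sin z) by (apply sin_gt_0; lra).
  assert (sin x < g) by (rewrite -Es; apply sin_increasing_1; lra).
  assert (g < sin z) by (rewrite -{1}Es; apply sin_increasing_1; lra).
  unfold kappa. rewrite (smom_lt g x) ?(smom_ge g z); try lra.
  assert (Mx := mom_pos g x Px). assert (Mz := mom_pos g z Pz).
  assert (Ex := mom_sq g x (Rlt_le _ _ Px)). assert (Ez := mom_sq g z (Rlt_le _ _ Pz)).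
  rewrite -Ex in Sx. rewrite -Ez in Sz.
  set (c := cos (asin g)) in *. set (p := mom g x) in *. set (r := mom g z) in *.
  set (k := sqrt c). assert (Hk : 0 < k) by (apply sqrt_lt_R0; lra).
  assert (Ek : k * k = c) by (apply sqrt_sqrt; lra).
  assert (Bx : p * sin x * k < g * (g - sin x)).
  { apply Rsqr_incrst_0; [|repeat apply Rmult_le_pos; lra|nra]. unfold Rsqr. nra. }
  assert (Bz : g * (sin z - g) < r * sin z * k).
  { apply Rsqr_incrst_0; [|nra|repeat apply Rmult_le_pos; lra]. unfold Rsqr. nra. }
  apply Rlt_trans with (k / g).
  - replace ((1 - g / sin z) / r) with (g * (sin z - g) / (r * sin z * g)) by (field; lra).
    apply Rlt_div_l; [repeat apply Rmult_lt_0_compat; lra|].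
    replace (k / g * (r * sin z * g)) with (r * sin z * k) by (field; lra). lra.
  - replace ((1 - g / sin x) / - p) with (g * (g - sin x) / (p * sin x * g)) by (field; lra).
    apply -> (Rlt_div_r (k / g) (g * (g - sin x)) (p * sin x * g));
      [|repeat apply Rmult_lt_0_compat; lra].
    replace (k / g * (p * sin x * g)) with (p * sin x * k) by (field; lra). lra. }
destruct (Rle_dec y (PI / 2)); [apply Hle; lra|].
apply Rlt_trans with (kappa g (PI / 2)); [apply kappa_decr_right; easy || lra|apply Hle; lra].
Qed.

Lemma kappa_decr (g x y : R) : bias g -> 0 < x -> x < y -> y < PI ->
  x <> asin g -> y <> asin g -> kappa g y < kappa g x.
Proof.
intros Hg Hx Hxy Hy Nx Ny.
destruct (Rlt_dec y (asin g)); [apply kappa_decr_left; easy || lra|].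
destruct (Rlt_dec x (asin g)); [apply kappa_cross_saddle; easy || lra|].
apply kappa_decr_right; easy || lra.
Qed.

(** At a critical point the two speeds are in a known ratio; one scale [t] replaces both and makes
    the second derivative a rational expression. *)
Lemma scale_pair (A B p r : R) : 0 < B -> 0 < r -> A * r = B * p ->
  exists t, 0 < t /\ r = B * t /\ p = A * t.
Proof.
intros HB Hr E. exists (r / B). split; [now apply Rdiv_lt_0_compat|].
split; [field; lra|]. apply Rmult_eq_reg_l with B; [|lra]. rewrite -E. field. lra.
Qed.

(* In the three lemmas below (s, c) and (S, C) are (sin, cos) of the exit and
   entry angles up to reflection, and the inequality is the sign of the second
   derivative of the sum or difference of the speeds at a critical point. *)
Lemma second_derivative_diff_neg (g s c S C r p : R) :
  0 < g -> 0 < s -> 0 < S -> C < c -> (S < s -> C < 0) -> 0 < p < r ->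
  (1 + g / s) * r = (1 + g / S) * p ->
  - (g * c / s ^ 2) * r + (1 + g / s) * (s * (1 + g / S) / r)
    + g * C * s / S ^ 3 * p - (1 + g / S) * (s * (1 + g / s) / p) < 0.
Proof.
intros Hg Hs HS HC HSs Hp E.
assert (Hgs : 0 < g / s) by now apply Rdiv_lt_0_compat.
assert (HgS : 0 < g / S) by now apply Rdiv_lt_0_compat.
(* Criticality together with p < r orders the sines, S < s, and this in turn makes C negative. *)
assert (Hlt : g / s < g / S).
{ apply Rnot_le_lt. intros Hn.
  assert ((1 + g / S) * p < (1 + g / s) * r); [|lra].
  apply Rle_lt_trans with ((1 + g / s) * p); [|apply Rmult_lt_compat_l; lra].
  apply Rmult_le_compat_r; lra. }
assert (HSs' : S < s).
{ apply Rnot_le_lt. intros Hn.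
  assert (g / S <= g / s); [|lra].
  apply Rmult_le_compat_l; [lra|]. now apply Rinv_le_contravar. }
specialize (HSs HSs').
destruct (scale_pair (1 + g / s) (1 + g / S) p r ltac:(lra) ltac:(lra) E) as [t [Ht [Er Ep]]].
replace (- (g * c / s ^ 2) * r + (1 + g / s) * (s * (1 + g / S) / r)
    + g * C * s / S ^ 3 * p - (1 + g / S) * (s * (1 + g / s) / p)) with
  (t * g * ((- c * (S + g) * S ^ 2 + C * (s + g) * s ^ 2) / (S ^ 3 * s ^ 2))
   - s / t * (g / S - g / s)).
2:{ rewrite Er Ep. field. repeat split; try lra; nra. }
assert (H1 : 0 < s / t * (g / S - g / s)).
{ apply Rmult_lt_0_compat; [now apply Rdiv_lt_0_compat|lra]. }
assert (H2 : - c * (S + g) * S ^ 2 + C * (s + g) * s ^ 2 <= 0).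
{ assert (0 < (S + g) * S ^ 2) by (apply Rmult_lt_0_compat; [lra|now apply pow_lt]).
  assert ((S + g) * S ^ 2 <= (s + g) * s ^ 2).
  { apply Rmult_le_compat; [lra|left; now apply pow_lt|lra|apply pow_incr; lra]. }
  nra. }
assert (H3 : (- c * (S + g) * S ^ 2 + C * (s + g) * s ^ 2) / (S ^ 3 * s ^ 2) <= 0).
{ assert (0 < S ^ 3 * s ^ 2) by (apply Rmult_lt_0_compat; now apply pow_lt).
  apply Rle_div_l; lra. }
assert (0 < t * g) by nra. nra.
Qed.

Lemma second_derivative_loop_pos (g s c S C r p : R) :
  0 < g -> g < s -> 0 < S -> C < c -> (0 < C -> s <= S) -> 0 < p -> 0 < r ->
  p ^ 2 * c < (s - g) ^ 2 -> (1 - g / s) * r = (1 + g / S) * p ->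
  0 < - (g * C * s / S ^ 3) * p + (1 + g / S) * (s * (1 - g / s) / p)
    - g * c / s ^ 2 * r - (1 - g / s) * (s * (1 + g / S) / r).
Proof.
intros Hg Hs HS HC HSs Hp Hr Hpc E.
assert (HgS : 0 < g / S) by now apply Rdiv_lt_0_compat.
assert (Hgs : 0 < 1 - g / s).
{ replace (1 - g / s) with ((s - g) / s) by (field; lra). apply Rdiv_lt_0_compat; lra. }
destruct (scale_pair (1 - g / s) (1 + g / S) p r ltac:(lra) ltac:(lra) E) as [t [Ht [Er Ep]]].
replace (- (g * C * s / S ^ 3) * p + (1 + g / S) * (s * (1 - g / s) / p)
    - g * c / s ^ 2 * r - (1 - g / s) * (s * (1 + g / S) / r)) with
  (g * s / t * ((/ S + / s) - t ^ 2 * C * (1 - g / s) / S ^ 3 - t ^ 2 * c * (1 + g / S) / s ^ 3)).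
2:{ rewrite Er Ep. field. repeat split; try lra; nra. }
assert (0 < g * s / t) by (apply Rdiv_lt_0_compat; nra).
apply Rmult_lt_0_compat; [easy|].
assert (Htc : t ^ 2 * c < s ^ 2).
{ apply Rmult_lt_reg_l with ((1 - g / s) ^ 2); [now apply pow_lt|].
  replace ((1 - g / s) ^ 2 * s ^ 2) with ((s - g) ^ 2) by (field; lra).
  rewrite Ep in Hpc. lra. }
assert (His : 0 < / s) by (apply Rinv_0_lt_compat; lra).
assert (HiS : 0 < / S) by (apply Rinv_0_lt_compat; lra).
assert (Hgi : g * / s < 1) by (unfold Rdiv in Hgs; lra).
assert (Ht2 : 0 < t ^ 2) by now apply pow_lt.
assert (Hi3 : 0 < / s ^ 3) by (apply Rinv_0_lt_compat, pow_lt; lra).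
assert (HI3 : 0 < / S ^ 3) by (apply Rinv_0_lt_compat, pow_lt; lra).
(* This bound and that of [T1] add up to exactly / s + / S, as the cross terms g / (s S) cancel.
   When a cosine is not positive, the corresponding term is simply dropped. *)
assert (T2 : t ^ 2 * c * (1 + g / S) / s ^ 3 < / s + g * / s * / S \/
  (c <= 0 /\ t ^ 2 * c * (1 + g / S) / s ^ 3 <= 0)).
{ destruct (Rle_dec c 0) as [Hc|Hc].
  - right. split; [easy|]. unfold Rdiv.
    assert (t ^ 2 * c <= 0) by nra.
    assert (t ^ 2 * c * (1 + g * / S) <= 0) by (unfold Rdiv in HgS; nra). nra.
  - left. apply Rlt_le_trans with (s ^ 2 * (1 + g / S) / s ^ 3).
    + apply Rmult_lt_compat_r; [easy|]. apply Rmult_lt_compat_r; lra.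
    + right. field. lra. }
assert (T1 : t ^ 2 * C * (1 - g / s) / S ^ 3 <= / S - g * / s * / S \/
  (C <= 0 /\ t ^ 2 * C * (1 - g / s) / S ^ 3 <= 0)).
{ destruct (Rle_dec C 0) as [HC'|HC'].
  - right. split; [easy|]. unfold Rdiv.
    assert (t ^ 2 * C <= 0) by nra.
    assert (t ^ 2 * C * (1 - g * / s) <= 0) by (unfold Rdiv in Hgs; nra). nra.
  - left. specialize (HSs ltac:(lra)).
    apply Rle_trans with (S ^ 2 * (1 - g / s) / S ^ 3).
    + apply Rmult_le_compat_r; [lra|]. apply Rmult_le_compat_r; [lra|].
      assert (t ^ 2 * C <= t ^ 2 * c) by nra. assert (s ^ 2 <= S ^ 2) by (apply pow_incr; lra). lra.
    + right. field. lra. }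
assert (g * / s * / S < / S) by nra.
assert (0 < g * / s * / S) by (repeat apply Rmult_lt_0_compat; lra).
destruct T1 as [T1|[T1 T1']], T2 as [T2|[T2 T2']]; lra.
Qed.

Lemma second_derivative_sum_neg (g s c S C r p : R) :
  0 < g -> 0 < s -> 0 < S -> C < c -> (S < g -> C < 0) -> (c < 0 -> S < s) ->
  0 < p -> 0 < r ->
  (1 - g / S) * p + (1 + g / s) * r = 0 ->
  g * C * s / S ^ 3 * p + (1 - g / S) * (s * (1 + g / s) / p)
    - g * c / s ^ 2 * r + (1 + g / s) * (s * (1 - g / S) / r) < 0.
Proof.
intros Hg Hs HS HC HSg HSs Hp Hr E.
assert (Hgs : 0 < g / s) by now apply Rdiv_lt_0_compat.
assert (HgS : 1 < g / S).
{ apply Rnot_le_lt. intros Hn. assert (0 < (1 + g / s) * r) by (apply Rmult_lt_0_compat; lra). nra. }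
assert (HSg' : S < g).
{ apply Rmult_lt_compat_r with (r := S) in HgS; [|easy].
  replace (g / S * S) with g in HgS by (field; lra). lra. }
specialize (HSg HSg').
destruct (scale_pair (1 + g / s) (g / S - 1) p r ltac:(lra) Hr ltac:(lra)) as [t [Ht [Er Ep]]].
replace (g * C * s / S ^ 3 * p + (1 - g / S) * (s * (1 + g / s) / p)
    - g * c / s ^ 2 * r + (1 + g / s) * (s * (1 - g / S) / r)) with
  (t * g * ((- c * (g - S) * S ^ 2 + C * (s + g) * s ^ 2) / (S ^ 3 * s ^ 2))
   - s / t * ((g / S - 1) + (1 + g / s))).
2:{ rewrite Er Ep. field. repeat split; try lra. }
assert (H1 : 0 < s / t * ((g / S - 1) + (1 + g / s))).
{ apply Rmult_lt_0_compat; [now apply Rdiv_lt_0_compat|lra]. }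
assert (H2 : - c * (g - S) * S ^ 2 + C * (s + g) * s ^ 2 <= 0).
{ assert (0 < (g - S) * S ^ 2) by (apply Rmult_lt_0_compat; [lra|now apply pow_lt]).
  assert (0 < (s + g) * s ^ 2) by (apply Rmult_lt_0_compat; [lra|now apply pow_lt]).
  destruct (Rle_dec 0 c) as [Hc|Hc]; [nra|].
  specialize (HSs ltac:(lra)).
  assert ((g - S) * S ^ 2 <= (s + g) * s ^ 2).
  { apply Rmult_le_compat; [lra|left; now apply pow_lt|lra|apply pow_incr; lra]. }
  nra. }
assert (H3 : (- c * (g - S) * S ^ 2 + C * (s + g) * s ^ 2) / (S ^ 3 * s ^ 2) <= 0).
{ assert (0 < S ^ 3 * s ^ 2) by (apply Rmult_lt_0_compat; now apply pow_lt).
  apply Rle_div_l; lra. }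
assert (0 < t * g) by nra. nra.
Qed.

(** * Slopes of the length and their signs *)

Definition entry_mom (g : R) (s : bool) (v : R) : R := mom g (entry_side g s v).

Definition entry_mom_slope (g : R) (s : bool) (v : R) : R :=
  let U := entry g v in
  match s with
  | true => (sin U - g) / mom g U * (sin v / sin U)
  | false => (sin U + g) / mom g (2 * PI - U) * (sin v / sin U)
  end.

Lemma entry_mom_continuous (g : R) (s : bool) (v : R) : continuous (entry_mom g s) v.
Proof.
apply (continuous_comp (entry_side g s) (mom g)); [|apply mom_continuous].
destruct s; simpl; [apply entry_continuous|].
apply (continuous_minus (fun _ => 2 * PI) (entry g)); [apply continuous_const|apply entry_continuous].
Qed.

Definition exit_interior (g m v : R) : Prop :=
  - vmax g < v < vmax g \/ 2 * PI - vmax g < v < m.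

Lemma exit_interior_angle (g m v : R) : exit_interior g m v -> exit_angle g m v.
Proof. intros [H|H]; [left|right]; lra. Qed.

Lemma exit_interior_cos (g m v : R) : bias g -> is_top g m -> exit_interior g m v ->
  cos (vmax g) < cos v.
Proof.
intros Hg Hm [H|H]; [now apply cos_gt_vmax|].
destruct (vmax_bound g Hg) as [B1 B2]. destruct (bias_asin g Hg) as [Ha _]. destruct Hm as [Hm _].
rewrite -(cos_2PI_minus v). apply cos_decreasing_1; lra.
Qed.

Lemma is_derive_entry_mom (g m v : R) (s : bool) :
  bias g -> is_top g m -> exit_interior g m v ->
  is_derive (entry_mom g s) v (entry_mom_slope g s v).
Proof.
intros Hg Hm Hv. assert (Hc := exit_interior_cos g m v Hg Hm Hv).
destruct (entry_side_facts g m v s Hg Hm (exit_interior_angle g m v Hv)) as [_ [_ [_ [F4 F5]]]].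
assert (D := is_derive_entry g v Hg Hc).
assert (M := is_derive_mom g (entry_side g s v) ltac:(lra)).
unfold entry_mom, entry_mom_slope. destruct s; simpl in *.
- replace ((sin (entry g v) - g) / mom g (entry g v) * (sin v / sin (entry g v))) with
    (scal (sin v / sin (entry g v)) ((sin (entry g v) - g) / mom g (entry g v))).
  2:{ unfold scal; simpl; unfold mult; simpl. apply Rmult_comm. }
  now apply (is_derive_comp (mom g) (entry g)).
- replace ((sin (entry g v) + g) / mom g (2 * PI - entry g v) * (sin v / sin (entry g v))) with
    (scal (- (sin v / sin (entry g v)))
      ((sin (2 * PI - entry g v) - g) / mom g (2 * PI - entry g v))).
  2:{ unfold scal; simpl; unfold mult; simpl. rewrite sin_2PI_minus. unfold Rdiv. ring. }
  apply (is_derive_comp (mom g) (fun v => 2 * PI - entry g v)); [exact M|].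
  replace (- (sin v / sin (entry g v))) with (0 - sin v / sin (entry g v)) by ring.
  apply is_derive_sub; [apply: is_derive_const|exact D].
Qed.

(** Reflecting [v] to - v or 2 PI - v brings it into (0, PI) with the same cosine and the opposite
    sine, so that negative outer angles and hump angles share one sign analysis. *)
Lemma exit_reflect (g m v : R) :
  bias g -> is_top g m -> exit_interior g m v -> v < 0 \/ PI < v ->
  exists y, 0 < y < entry g v /\ sin v = - sin y /\ cos v = cos y /\ 0 < sin y /\ 0 < gap g v.
Proof.
intros Hg Hm Hv Hs. destruct (vmax_bound g Hg) as [B1 B2]. destruct (bias_asin g Hg) as [Ha _].
assert (Hc := exit_interior_cos g m v Hg Hm Hv).
assert (Be := entry_bound g v). assert (HP := PI_RGT_0). assert (Hm2 := proj1 Hm).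
assert (exists y, 0 < y < PI /\ sin v = - sin y /\ cos v = cos y) as [y [Hy [Sy Cy]]].
{ destruct Hs as [Hs|Hs].
  - exists (- v). rewrite sin_neg cos_neg. repeat split; destruct Hv; try lra.
  - exists (2 * PI - v). rewrite sin_2PI_minus cos_2PI_minus. repeat split; destruct Hv; try lra. }
exists y. repeat split; auto; try lra.
- apply cos_decreasing_0; try lra. rewrite cos_entry; auto; [|lra]. rewrite -Cy.
  destruct (bias_PI g Hg) as [Hg0 _]. nra.
- apply sin_gt_0; lra.
- destruct Hs as [Hs|Hs]; [apply gap_pos_left; [easy|lra]|].
  apply (gap_pos_top g m); [easy|easy|]. destruct Hv; lra.
Qed.

Lemma Rmult_pos_sign (k x : R) : 0 < k -> (0 <= k * x -> 0 <= x) /\ (k * x <= 0 -> x <= 0).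
Proof. intros Hk. split; intros H; nra. Qed.

Definition side_sign (s : bool) : R := match s with true => 1 | false => -1 end.

(* Up to a factor of known sign, the derivative of the length with respect to
   the exit angle; its zeros are the critical points. *)
Definition balance (g : R) (s : bool) (v : R) : R :=
  (1 - g / sin v) * entry_mom g s v + (side_sign s - g / sin (entry g v)) * mom g v.

Definition balance_slope (g : R) (s : bool) (v : R) : R :=
  let U := entry g v in
  g * cos v / sin v ^ 2 * entry_mom g s v + (1 - g / sin v) * entry_mom_slope g s v
  + (g * cos U / sin U ^ 2 * (sin v / sin U) * mom g v
     + (side_sign s - g / sin U) * ((sin v - g) / mom g v)).

Lemma interior_pos (g m v : R) (s : bool) :
  bias g -> is_top g m -> exit_interior g m v -> 0 < gap g v ->
  asin g < entry g v < PI /\ 0 < sin (entry g v) /\ 0 < mom g v < entry_mom g s v.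
Proof.
intros Hg Hm Hi G0. assert (Hc := exit_interior_cos g m v Hg Hm Hi).
assert (GU := entry_gt g v Hg (Rlt_le _ _ Hc)). assert (LU := entry_lt_PI g v Hg Hc).
destruct (bias_asin g Hg) as [Ha _].
destruct (entry_side_facts g m v s Hg Hm (exit_interior_angle g m v Hi)) as [_ [_ [_ [_ F]]]].
split; [lra|]. split; [apply sin_gt_0; lra|].
split; [now apply mom_pos|]. apply mom_lt; lra.
Qed.

Lemma is_derive_balance (g m v : R) (s : bool) :
  bias g -> is_top g m -> exit_interior g m v -> 0 < gap g v -> sin v <> 0 ->
  is_derive (balance g s) v (balance_slope g s v).
Proof.
intros Hg Hm Hi G0 Hs. destruct (interior_pos g m v s Hg Hm Hi G0) as [_ [PS [M0 M1]]].
assert (DR := is_derive_entry_mom g m v s Hg Hm Hi).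
assert (DM := is_derive_mom g v G0).
assert (DU := is_derive_entry g v Hg (exit_interior_cos g m v Hg Hm Hi)).
unfold balance, balance_slope. auto_derive.
- repeat split; try lra; try (eexists; eassumption).
- rewrite (is_derive_unique _ _ _ DR) (is_derive_unique _ _ _ DM) (is_derive_unique _ _ _ DU).
  field. repeat split; lra.
Qed.

Lemma length_slope_balance (g m v : R) (s : bool) :
  bias g -> is_top g m -> exit_interior g m v -> 0 < gap g v -> sin v <> 0 ->
  exists k, 0 < k /\ entry_mom_slope g s v + side_sign s * ((sin v - g) / mom g v) =
    k * (side_sign s * sin v * balance g s v).
Proof.
intros Hg Hm Hi G0 Hs. destruct (interior_pos g m v s Hg Hm Hi G0) as [_ [PS [M0 M1]]].
exists (/ (entry_mom g s v * mom g v)). split.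
- apply Rinv_0_lt_compat, Rmult_lt_0_compat; lra.
- unfold balance, entry_mom_slope, entry_mom in *.
  destruct s; simpl in *; field; repeat split; lra.
Qed.

(** Here sin v < 0, so on the mirrored side [balance] has the sign of the slope. By
    [second_derivative_diff_neg] each of its zeros is crossed upwards, so the slope cannot go from
    >= 0 to <= 0. *)
Lemma diff_slope_sign (g m v1 v2 : R) :
  bias g -> is_top g m -> v1 < v2 ->
  (forall v, v1 <= v <= v2 -> exit_interior g m v /\ (v < 0 \/ PI < v)) ->
  0 <= entry_mom_slope g false v1 - (sin v1 - g) / mom g v1 ->
  entry_mom_slope g false v2 - (sin v2 - g) / mom g v2 <= 0 -> False.
Proof.
intros Hg Hm H12 Hr H1 H2. destruct (bias_PI g Hg) as [Hg0 _].
assert (Hsign : forall v, v1 <= v <= v2 -> exists k, 0 < k /\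
  entry_mom_slope g false v - (sin v - g) / mom g v = k * balance g false v).
{ intros v Hv. destruct (Hr v Hv) as [Hi Hn].
  destruct (exit_reflect g m v Hg Hm Hi Hn) as [y [Hy [Sy [Cy [Ps G0]]]]].
  destruct (length_slope_balance g m v false Hg Hm Hi G0 ltac:(lra)) as [k [Hk E]].
  exists (k * sin y). split; [nra|]. unfold side_sign in E. rewrite Sy in E |- *. lra. }
destruct (Hsign v1 ltac:(lra)) as [k1 [Hk1 E1]]. destruct (Hsign v2 ltac:(lra)) as [k2 [Hk2 E2]].
rewrite E1 in H1. rewrite E2 in H2.
apply (proj1 (Rmult_pos_sign k1 _ Hk1)) in H1. apply (proj2 (Rmult_pos_sign k2 _ Hk2)) in H2.
enough (0 < balance g false v2) by lra.
apply (zero_crossing_up _ (balance_slope g false) v1 v2 H12); [| |exact H1].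
- intros v Hv. destruct (Hr v Hv) as [Hi Hn].
  destruct (exit_reflect g m v Hg Hm Hi Hn) as [y [Hy [Sy [Cy [Ps G0]]]]].
  apply (is_derive_balance g m); auto. lra.
- intros v Hv Ez. destruct (Hr v Hv) as [Hi Hn].
  destruct (exit_reflect g m v Hg Hm Hi Hn) as [y [Hy [Sy [Cy [Ps G0]]]]].
  destruct (interior_pos g m v false Hg Hm Hi G0) as [GU [PS M]].
  unfold balance in Ez. simpl in Ez. rewrite Sy in Ez.
  enough (- balance_slope g false v < 0) by lra.
  assert (H := second_derivative_diff_neg g (sin y) (cos y) (sin (entry g v)) (cos (entry g v))
    (entry_mom g false v) (mom g v) Hg0 Ps PS).
  match type of H with _ -> _ -> _ -> _ -> ?x < 0 => replace (- balance_slope g false v) with x end.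
  2:{ unfold balance_slope, entry_mom_slope, entry_mom in *. simpl in *. rewrite Sy Cy. field. lra. }
  apply H.
  + apply cos_decreasing_1; lra.
  + intros Hlt. apply cos_lt_0; [|lra]. apply Rnot_le_lt. intros Hn'.
    assert (sin y < sin (entry g v)) by (apply sin_increasing_1; lra). lra.
  + exact M.
  + replace (1 - g / - sin y) with (1 + g / sin y) in Ez by (field; lra). lra.
Qed.

(** On the first side with sin v < 0 the sign of [balance] is opposite to that of the slope, so its
    upward crossings, given by [second_derivative_sum_neg], forbid a slope going from <= 0 to >=
    0. *)
Lemma sum_slope_sign (g m v1 v2 : R) :
  bias g -> is_top g m -> v1 < v2 ->
  (forall v, v1 <= v <= v2 -> exit_interior g m v /\ PI < v) ->
  entry_mom_slope g true v1 + (sin v1 - g) / mom g v1 <= 0 ->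
  0 <= entry_mom_slope g true v2 + (sin v2 - g) / mom g v2 -> False.
Proof.
intros Hg Hm H12 Hr H1 H2.
destruct (bias_PI g Hg) as [Hg0 _]. destruct (bias_asin g Hg) as [Ha [Es _]].
assert (Hsign : forall v, v1 <= v <= v2 -> exists k, 0 < k /\
  entry_mom_slope g true v + (sin v - g) / mom g v = - (k * balance g true v)).
{ intros v Hv. destruct (Hr v Hv) as [Hi Hn].
  destruct (exit_reflect g m v Hg Hm Hi (or_intror Hn)) as [y [Hy [Sy [Cy [Ps G0]]]]].
  destruct (length_slope_balance g m v true Hg Hm Hi G0 ltac:(lra)) as [k [Hk E]].
  exists (k * sin y). split; [nra|]. unfold side_sign in E. rewrite Sy in E |- *. lra. }
destruct (Hsign v1 ltac:(lra)) as [k1 [Hk1 E1]]. destruct (Hsign v2 ltac:(lra)) as [k2 [Hk2 E2]].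
rewrite E1 in H1. rewrite E2 in H2.
assert (H1' := proj1 (Rmult_pos_sign k1 (balance g true v1) Hk1) ltac:(lra)).
assert (H2' := proj2 (Rmult_pos_sign k2 (balance g true v2) Hk2) ltac:(lra)).
enough (0 < balance g true v2) by lra.
apply (zero_crossing_up _ (balance_slope g true) v1 v2 H12); [| |exact H1'].
- intros v Hv. destruct (Hr v Hv) as [Hi Hn].
  destruct (exit_reflect g m v Hg Hm Hi (or_intror Hn)) as [y [Hy [Sy [Cy [Ps G0]]]]].
  apply (is_derive_balance g m); auto. lra.
- intros v Hv Ez. destruct (Hr v Hv) as [Hi Hn].
  destruct (exit_reflect g m v Hg Hm Hi (or_intror Hn)) as [y [Hy [Sy [Cy [Ps G0]]]]].
  destruct (interior_pos g m v true Hg Hm Hi G0) as [GU [PS M]].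
  unfold balance in Ez. simpl in Ez. rewrite Sy in Ez.
  enough (- balance_slope g true v < 0) by lra.
  assert (H := second_derivative_sum_neg g (sin y) (cos y) (sin (entry g v)) (cos (entry g v))
    (entry_mom g true v) (mom g v) Hg0 Ps PS).
  match type of H with _ -> _ -> _ -> _ -> _ -> _ -> ?x < 0 =>
    replace (- balance_slope g true v) with x end.
  2:{ unfold balance_slope, entry_mom_slope, entry_mom in *. simpl in *. rewrite Sy Cy. field. lra. }
  apply H.
  + apply cos_decreasing_1; lra.
  + intros Hlt. apply cos_lt_0; [|lra]. apply Rnot_le_lt. intros Hn'.
    assert (sin (asin g) < sin (entry g v)) by (apply sin_increasing_1; lra). lra.
  + intros Hc. assert (PI / 2 < y).
    { apply Rnot_le_lt. intros Hn'. assert (0 <= cos y) by (apply cos_ge_0; lra). lra. }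
    apply sin_decreasing_1; lra.
  + lra.
  + lra.
  + replace (1 - g / - sin y) with (1 + g / sin y) in Ez by (field; lra). lra.
Qed.

(** Now sin v > g > 0, and on the mirrored side the slope has the sign of [- balance], which
    [second_derivative_loop_pos] makes cross upwards. *)
Lemma loop_slope_sign (g m v1 v2 : R) :
  bias g -> is_top g m -> asin g < v1 -> v1 < v2 -> v2 < vmax g ->
  0 <= entry_mom_slope g false v1 - (sin v1 - g) / mom g v1 ->
  entry_mom_slope g false v2 - (sin v2 - g) / mom g v2 <= 0 -> False.
Proof.
intros Hg Hm Ha1 H12 H2m H1 H2.
destruct (bias_PI g Hg) as [Hg0 _]. destruct (bias_asin g Hg) as [Ha [Es _]].
destruct (vmax_bound g Hg) as [B1 B2]. assert (HP := PI_RGT_0).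
assert (F : forall v, v1 <= v <= v2 -> exit_interior g m v /\ g < sin v /\ 0 < gap g v).
{ intros v Hv. split; [left; lra|]. split; [apply sin_gt_bias; [easy|lra]|].
  apply gap_pos; easy || lra. }
assert (Hsign : forall v, v1 <= v <= v2 -> exists k, 0 < k /\
  entry_mom_slope g false v - (sin v - g) / mom g v = k * - balance g false v).
{ intros v Hv. destruct (F v Hv) as [Hi [Hs G0]].
  destruct (length_slope_balance g m v false Hg Hm Hi G0 ltac:(lra)) as [k [Hk E]].
  exists (k * sin v). split; [nra|]. unfold side_sign in E. lra. }
destruct (Hsign v1 ltac:(lra)) as [k1 [Hk1 E1]]. destruct (Hsign v2 ltac:(lra)) as [k2 [Hk2 E2]].
rewrite E1 in H1. rewrite E2 in H2.
apply (proj1 (Rmult_pos_sign k1 _ Hk1)) in H1. apply (proj2 (Rmult_pos_sign k2 _ Hk2)) in H2.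
enough (0 < - balance g false v2) by lra.
apply (zero_crossing_up (fun v => - balance g false v) (fun v => - balance_slope g false v)
  v1 v2 H12); [| |exact H1].
- intros v Hv. destruct (F v Hv) as [Hi [Hs G0]].
  apply: is_derive_opp. apply (is_derive_balance g m); auto. lra.
- intros v Hv Ez. destruct (F v Hv) as [Hi [Hs G0]].
  destruct (interior_pos g m v false Hg Hm Hi G0) as [GU [PS M]].
  assert (Uv := entry_gt_abs g v Hg (Rlt_le _ _ (exit_interior_cos g m v Hg Hm Hi)) ltac:(lra)).
  unfold balance in Ez. simpl in Ez.
  assert (H := second_derivative_loop_pos g (sin v) (cos v) (sin (entry g v)) (cos (entry g v))
    (entry_mom g false v) (mom g v) Hg0 Hs PS).
  match type of H with _ -> _ -> _ -> _ -> _ -> _ -> 0 < ?x =>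
    replace (- balance_slope g false v) with x end.
  2:{ unfold balance_slope, entry_mom_slope, entry_mom in *. simpl in *. field. lra. }
  apply H.
  + apply cos_decreasing_1; lra.
  + intros Hc. assert (entry g v < PI / 2).
    { apply Rnot_le_lt. intros Hn'. assert (cos (entry g v) <= 0) by (apply cos_le_0; lra). lra. }
    left. apply sin_increasing_1; lra.
  + lra.
  + lra.
  + rewrite mom_sq; [|lra]. apply gap_cos_lt; [easy|lra|easy].
  + lra.
Qed.

(* The three families of fluxons; on each of them 2 g L is the entry speed
   minus the exit speed.  In the outer family the exit speed is - smom v; in the
   loop family it is mom v with v beyond the saddle; in the hump family v is
   close to the turning point m. *)
Definition outer (g : R) (s : bool) (v : R) : R := entry_mom g s v + smom g v.

Definition loop (g : R) (s : bool) (v : R) : R := entry_mom g s v - mom g v.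

(** The parameter satisfies |x| = m - v, and its sign separates the two exit speeds: positive for x
    < 0, negative for x > 0. They join at [m], where the speed vanishes, so the two branches become
    one function. *)
Definition hump (g m : R) (s : bool) : R -> R :=
  glue 0 (fun x => loop g s (m + x)) (fun x => entry_mom g s (m - x) + mom g (m - x)).

Lemma outer_continuous (g : R) (s : bool) (v : R) : continuous (outer g s) v.
Proof.
apply (continuous_plus (entry_mom g s) (smom g)); [apply entry_mom_continuous|apply smom_continuous].
Qed.

Lemma loop_continuous (g : R) (s : bool) (v : R) : continuous (loop g s) v.
Proof.
apply (continuous_minus (entry_mom g s) (mom g)); [apply entry_mom_continuous|apply mom_continuous].
Qed.

Lemma hump_continuous (g m : R) (s : bool) (x : R) : is_top g m -> continuous (hump g m s) x.
Proof.
intros [_ Hm]. apply continuous_glue.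
- unfold loop. rewrite Rplus_0_r Rminus_0_r mom_0; [ring|easy].
- intros t. apply (continuous_comp (fun x => m + x) (loop g s)); [|apply loop_continuous].
  apply: ex_derive_continuous. auto_derive. easy.
- intros t. apply (continuous_comp (fun x => m - x) (fun v => entry_mom g s v + mom g v)).
  + apply: ex_derive_continuous. auto_derive. easy.
  + apply (continuous_plus (entry_mom g s) (mom g)); [apply entry_mom_continuous|apply mom_continuous].
Qed.

(** * Unimodality of the three families *)

Lemma entry_side_ends (g v : R) : bias g -> cos v = cos (vmax g) ->
  entry_side g true v = PI /\ entry_side g false v = PI.
Proof. intros Hg Hv. simpl. rewrite (entry_PI g v Hg Hv). split; ring. Qed.

Lemma entry_mom_ends (g v : R) : bias g -> cos v = cos (vmax g) ->
  entry_mom g true v = entry_mom g false v.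
Proof. intros Hg Hv. unfold entry_mom. now destruct (entry_side_ends g v Hg Hv) as [-> ->]. Qed.

Lemma entry_mom_slope_kappa (g v : R) : bias g -> cos (vmax g) < cos v ->
  entry_mom_slope g true v = sin v * kappa g (entry g v).
Proof.
intros Hg Hc. assert (G := entry_gt g v Hg (Rlt_le _ _ Hc)). assert (LU := entry_lt_PI g v Hg Hc).
destruct (bias_asin g Hg) as [Ha _].
assert (0 < sin (entry g v)) by (apply sin_gt_0; lra).
assert (P := mom_pos g (entry g v) (gap_pos g (entry g v) Hg ltac:(lra) ltac:(lra))).
unfold entry_mom_slope, kappa. rewrite smom_ge; [|lra]. field. lra.
Qed.

Lemma outer_slope_kappa (g v : R) : bias g -> 0 < v < PI -> v <> asin g ->
  (sin v - g) / smom g v = sin v * kappa g v.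
Proof.
intros Hg Hv N. assert (0 < sin v) by (apply sin_gt_0; lra).
assert (Nq := smom_neq_0 g v Hg ltac:(lra) N).
unfold kappa. field. split; lra.
Qed.

Lemma is_derive_outer (g m v : R) (s : bool) :
  bias g -> is_top g m -> - vmax g < v < vmax g -> v <> asin g ->
  is_derive (outer g s) v (entry_mom_slope g s v + (sin v - g) / smom g v).
Proof.
intros Hg Hm Hv N. destruct (vmax_bound g Hg). destruct (bias_asin g Hg) as [Ha _].
apply (is_derive_plus (entry_mom g s) (smom g)).
- apply (is_derive_entry_mom g m); [easy|easy|now left].
- apply is_derive_smom; [easy|]. apply gap_pos; easy || lra.
Qed.

(** With sin v = - t the slope is a sum of three positive terms, the first because the exit speed
    [p] is below the entry speed [r]. For v < 0 it is also the slope of [outer], where [smom] is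
    [- mom]. *)
Lemma loop_slope_pos (g m v : R) :
  bias g -> is_top g m -> exit_interior g m v -> v < 0 \/ PI < v ->
  0 < entry_mom_slope g true v - (sin v - g) / mom g v.
Proof.
intros Hg Hm Hi Hn. destruct (bias_PI g Hg) as [Hg0 _].
destruct (exit_reflect g m v Hg Hm Hi Hn) as [y [Hy [Sy [Cy [Ps G0]]]]].
destruct (interior_pos g m v true Hg Hm Hi G0) as [_ [PS M]].
unfold entry_mom_slope, entry_mom in *. simpl in *. rewrite Sy.
set (r := mom g (entry g v)) in *. set (p := mom g v) in *. set (t := sin y) in *.
set (S := sin (entry g v)) in *.
replace ((S - g) / r * (- t / S) - (- t - g) / p) with
  (t * (/ p - / r) + g / p + t * (g / S) / r) by (field; lra).
assert (/ r < / p) by (apply Rinv_lt_contravar; nra).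
assert (0 < g / p) by (apply Rdiv_lt_0_compat; lra).
assert (0 < t * (g / S) / r).
{ apply Rdiv_lt_0_compat; [|lra]. apply Rmult_lt_0_compat; [easy|]. now apply Rdiv_lt_0_compat. }
assert (0 < t * (/ p - / r)) by (apply Rmult_lt_0_compat; lra). lra.
Qed.

(** For v <= 0 the slope is positive. For v > 0 it is sin v times [kappa g (entry g v) + kappa g v];
    [entry] increases and [kappa] decreases, so once nonpositive it cannot return to nonnegative
    values. *)
Lemma outer_quasiconcave (g : R) : bias g -> quasiconcave (outer g true) (- vmax g) (vmax g).
Proof.
intros Hg. destruct (top_exists g Hg) as [m Hm].
destruct (vmax_bound g Hg) as [B1 B2]. destruct (bias_asin g Hg) as [Ha _].
destruct (bias_PI g Hg) as [Hg0 _].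
apply (quasiconcave_of_derive _
  (fun v => entry_mom_slope g true v + (sin v - g) / smom g v) (asin g)).
- intros v Hv N. now apply (is_derive_outer g m).
- intros v _. apply continuity_pt_filterlim, outer_continuous.
- intros v1 v2 H1 H12 H2 N1 N2 S1 S2.
  destruct (Rtotal_order v1 0) as [Hv|[->|Hv]].
  + assert (P := loop_slope_pos g m v1 Hg Hm ltac:(left; lra) (or_introl Hv)).
    assert (M := mom_pos g v1 (gap_pos_left g v1 Hg ltac:(lra))).
    rewrite smom_lt in S1; [|lra].
    replace ((sin v1 - g) / - mom g v1) with (- ((sin v1 - g) / mom g v1)) in S1 by (field; lra). lra.
  + unfold entry_mom_slope in S1. rewrite sin_0 in S1.
    assert (Q := smom_neg g 0 Hg ltac:(lra)).
    assert (0 < - g / smom g 0).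
    { replace (- g / smom g 0) with (g / - smom g 0) by (field; lra). apply Rdiv_lt_0_compat; lra. }
    replace ((sin (entry g 0) - g) / mom g (entry g 0) * (0 / sin (entry g 0)) + (0 - g) / smom g 0)
      with (- g / smom g 0) in S1 by (unfold Rdiv; ring). lra.
  + assert (C1 := cos_gt_vmax g v1 Hg ltac:(lra)). assert (C2 := cos_gt_vmax g v2 Hg ltac:(lra)).
    rewrite entry_mom_slope_kappa in S1; auto. rewrite entry_mom_slope_kappa in S2; auto.
    rewrite outer_slope_kappa in S1; [|easy|lra|easy]. rewrite outer_slope_kappa in S2; [|easy|lra|easy].
    assert (0 < sin v1) by (apply sin_gt_0; lra). assert (0 < sin v2) by (apply sin_gt_0; lra).
    assert (K1 : kappa g v2 < kappa g v1) by (apply kappa_decr; easy || lra).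
    assert (G1 := entry_gt g v1 Hg (Rlt_le _ _ C1)). assert (L2 := entry_lt_PI g v2 Hg C2).
    assert (U12 : entry g v1 < entry g v2).
    { assert (E1 := entry_bound g v1). assert (E2 := entry_bound g v2).
      apply cos_decreasing_0; try lra.
      rewrite !cos_entry; try easy; try lra.
      assert (cos v2 < cos v1) by (apply cos_decreasing_1; lra). lra. }
    assert (K2 : kappa g (entry g v2) < kappa g (entry g v1)) by (apply kappa_decr; easy || lra).
    assert (T1 := proj2 (Rmult_pos_sign (sin v1) (kappa g (entry g v1) + kappa g v1) ltac:(easy)) ltac:(lra)).
    assert (T2 := proj1 (Rmult_pos_sign (sin v2) (kappa g (entry g v2) + kappa g v2) ltac:(easy)) ltac:(lra)).
    lra.
Qed.

Lemma entry_mom_slope_false_sign (g m v : R) : bias g -> is_top g m -> exit_interior g m v ->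
  exists k, 0 < k /\ entry_mom_slope g false v = k * sin v.
Proof.
intros Hg Hm Hv. assert (Hc := exit_interior_cos g m v Hg Hm Hv).
assert (F0 := exit_interior_angle g m v Hv).
destruct (entry_side_facts g m v false Hg Hm F0) as [_ [_ [_ [F4 F6]]]]. simpl in F6.
assert (Ge := entry_gt g v Hg (Rlt_le _ _ Hc)). assert (Le := entry_lt_PI g v Hg Hc).
destruct (bias_asin g Hg) as [Ha _]. destruct (bias_PI g Hg) as [Hg0 _].
assert (HS : 0 < sin (entry g v)) by (apply sin_gt_0; lra).
assert (HM := mom_pos g (2 * PI - entry g v) ltac:(lra)).
exists ((sin (entry g v) + g) / mom g (2 * PI - entry g v) / sin (entry g v)). split.
- apply Rdiv_lt_0_compat; [apply Rdiv_lt_0_compat; lra|easy].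
- unfold entry_mom_slope. field. lra.
Qed.

(** For v >= 0 entry speed and [smom] both have nonnegative slope, the latter strictly positive away
    from the saddle; a minimum can only occur at v < 0, where [diff_slope_sign] applies. *)
Lemma outer_quasiconvex (g : R) : bias g -> quasiconvex (outer g false) (- vmax g) (vmax g).
Proof.
intros Hg. destruct (top_exists g Hg) as [m Hm].
destruct (vmax_bound g Hg) as [B1 B2]. destruct (bias_asin g Hg) as [Ha _].
apply (quasiconvex_of_derive _
  (fun v => entry_mom_slope g false v + (sin v - g) / smom g v) (asin g)).
- intros v Hv N. now apply (is_derive_outer g m).
- intros v _. apply continuity_pt_filterlim, outer_continuous.
- intros v1 v2 H1 H12 H2 N1 N2 S1 S2.
  destruct (Rle_dec 0 v2) as [Hv|Hv].
  + destruct (entry_mom_slope_false_sign g m v2 Hg Hm ltac:(left; lra)) as [k [Hk E]].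
    rewrite E in S2.
    assert (0 <= sin v2) by (apply sin_ge_0; lra).
    assert (0 <= k * sin v2) by (apply Rmult_le_pos; lra).
    assert (0 < (sin v2 - g) / smom g v2); [|lra].
    destruct (Rlt_dec v2 (asin g)) as [Hva|Hva].
    * assert (Q := smom_neg g v2 Hg Hva).
      assert (sin v2 < g) by (apply sin_lt_bias_left; [easy|lra]).
      replace ((sin v2 - g) / smom g v2) with ((g - sin v2) / - smom g v2) by (field; lra).
      apply Rdiv_lt_0_compat; lra.
    * rewrite smom_ge; [|lra]. apply Rdiv_lt_0_compat.
      -- assert (g < sin v2) by (apply sin_gt_bias; [easy|lra]). lra.
      -- apply mom_pos, gap_pos; easy || lra.
  + apply (diff_slope_sign g m v1 v2); auto.
    * intros v Hr. split; [left; lra|left; lra].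
    * rewrite smom_lt in S1; [|lra].
      assert (M := mom_pos g v1 (gap_pos g v1 Hg ltac:(lra) N1)).
      replace ((sin v1 - g) / - mom g v1) with (- ((sin v1 - g) / mom g v1)) in S1 by (field; lra). lra.
    * rewrite smom_lt in S2; [|lra].
      assert (M := mom_pos g v2 (gap_pos g v2 Hg ltac:(lra) N2)).
      replace ((sin v2 - g) / - mom g v2) with (- ((sin v2 - g) / mom g v2)) in S2 by (field; lra). lra.
Qed.

Lemma outer_ends (g v : R) : bias g -> cos v = cos (vmax g) -> outer g true v = outer g false v.
Proof. intros Hg Hv. unfold outer. now rewrite (entry_mom_ends g v Hg Hv). Qed.

Lemma is_derive_loop (g m v : R) (s : bool) :
  bias g -> is_top g m -> exit_interior g m v -> asin g < v ->
  is_derive (loop g s) v (entry_mom_slope g s v - (sin v - g) / mom g v).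
Proof.
intros Hg Hm Hv Hva. destruct (vmax_bound g Hg) as [B1 B2]. destruct (bias_asin g Hg) as [Ha _].
assert (Hm' := proj1 Hm).
apply is_derive_sub.
- now apply (is_derive_entry_mom g m).
- apply is_derive_mom, (gap_pos_top g m); [easy|easy|]. destruct Hv; lra.
Qed.

(* Both loop branches laid end to end: v runs up to vmax on the first side and
   back down on the mirrored one. *)
Definition loop_path (g : R) : R -> R :=
  glue (vmax g) (loop g true) (fun x => loop g false (2 * vmax g - x)).

(** The first half strictly decreases: its slope is sin v times [kappa g (entry g v) - kappa g v],
    and the entry angle exceeds [v]. The reversed second half is governed by [loop_slope_sign]. *)
Lemma loop_path_quasiconvex (g : R) : bias g ->
  quasiconvex (loop_path g) (asin g) (2 * vmax g - asin g).
Proof.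
intros Hg. destruct (top_exists g Hg) as [m Hm].
destruct (vmax_bound g Hg) as [B1 B2]. destruct (bias_asin g Hg) as [Ha _].
set (d := fun s v => entry_mom_slope g s v - (sin v - g) / mom g v).
apply (quasiconvex_of_derive _
  (glue (vmax g) (d true) (fun x => - d false (2 * vmax g - x))) (vmax g)).
- intros x Hx N. destruct (Rlt_dec x (vmax g)) as [H|H].
  + rewrite glue_lt; [|easy]. apply is_derive_glue_lt; [easy|].
    apply (is_derive_loop g m); [easy|easy|left; lra|lra].
  + rewrite glue_ge; [|lra]. apply is_derive_glue_gt; [lra|].
    assert (D := is_derive_loop g m (2 * vmax g - x) false Hg Hm ltac:(left; lra) ltac:(lra)).
    fold (d false (2 * vmax g - x)) in D.
    auto_derive; [eexists; exact D|]. rewrite (is_derive_unique _ _ _ D). ring.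
- intros x _. apply continuity_pt_filterlim. apply continuous_glue.
  + replace (2 * vmax g - vmax g) with (vmax g) by ring.
    unfold loop. now rewrite (entry_mom_ends g (vmax g)).
  + apply loop_continuous.
  + intros t. apply (continuous_comp (fun x => 2 * vmax g - x) (loop g false)); [|apply loop_continuous].
    apply: ex_derive_continuous. auto_derive. easy.
- intros x1 x2 H1 H12 H2 N1 N2 S1 S2.
  destruct (Rlt_dec x1 (vmax g)) as [H|H].
  + rewrite glue_lt in S1; [|easy]. unfold d in S1.
    assert (C1 := cos_gt_vmax g x1 Hg ltac:(lra)).
    rewrite entry_mom_slope_kappa in S1; auto.
    rewrite -(smom_ge g x1) in S1; [|lra].
    rewrite outer_slope_kappa in S1; [|easy|lra|lra].
    assert (0 < sin x1) by (apply sin_gt_0; lra).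
    assert (L1 := entry_lt_PI g x1 Hg C1).
    assert (U1 := entry_gt_abs g x1 Hg (Rlt_le _ _ C1) ltac:(lra)).
    assert (K : kappa g (entry g x1) < kappa g x1) by (apply kappa_decr; easy || lra).
    nra.
  + rewrite glue_ge in S1; [|lra]. rewrite glue_ge in S2; [|lra].
    apply (loop_slope_sign g m (2 * vmax g - x2) (2 * vmax g - x1)); auto; try lra;
      unfold d in *; lra.
Qed.

Definition hump_slope (g m : R) (s : bool) : R -> R :=
  glue 0 (fun x => entry_mom_slope g s (m + x) - (sin (m + x) - g) / mom g (m + x))
    (fun x => - (entry_mom_slope g s (m - x) + (sin (m - x) - g) / mom g (m - x))).

Lemma hump_derive (g m x : R) (s : bool) :
  bias g -> is_top g m -> let w := m - (2 * PI - vmax g) in -w < x < w -> x <> 0 ->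
  is_derive (hump g m s) x (hump_slope g m s x).
Proof.
intros Hg Hm w Hx N. destruct (vmax_bound g Hg) as [B1 B2]. destruct (bias_asin g Hg) as [Ha _].
assert (Hm' := proj1 Hm).
unfold w in Hx. unfold hump, hump_slope. destruct (Rlt_dec x 0) as [H|H].
- rewrite glue_lt; [|easy]. apply is_derive_glue_lt; [easy|].
  assert (D := is_derive_loop g m (m + x) s Hg Hm ltac:(right; lra) ltac:(lra)).
  auto_derive; [eexists; exact D|]. rewrite (is_derive_unique _ _ _ D). ring.
- rewrite glue_ge; [|lra]. apply is_derive_glue_gt; [lra|].
  assert (D1 := is_derive_entry_mom g m (m - x) s Hg Hm ltac:(right; lra)).
  assert (D2 := is_derive_mom g (m - x) (gap_pos_top g m (m - x) Hg Hm ltac:(lra))).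
  auto_derive; [repeat split; eexists; eassumption|].
  rewrite (is_derive_unique _ _ _ D1) (is_derive_unique _ _ _ D2). ring.
Qed.

(** Up to x = 0 the hump increases by [loop_slope_pos]; beyond, the angle m - x runs backwards and
    [sum_slope_sign] excludes a fall followed by a rise. *)
Lemma hump_quasiconcave (g m : R) : bias g -> is_top g m ->
  let w := m - (2 * PI - vmax g) in quasiconcave (hump g m true) (- w) w.
Proof.
intros Hg Hm w. destruct (vmax_bound g Hg) as [B1 B2]. destruct (bias_asin g Hg) as [Ha [Es _]].
assert (Hm' := proj1 Hm). destruct (bias_PI g Hg) as [Hg0 _].
apply (quasiconcave_of_derive _ (hump_slope g m true) 0).
- intros x Hx N. now apply hump_derive.
- intros x _. apply continuity_pt_filterlim. now apply hump_continuous.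
- unfold hump_slope. intros x1 x2 H1 H12 H2 N1 N2 S1 S2. unfold w in H1, H2.
  destruct (Rlt_dec x1 0) as [H|H].
  + rewrite glue_lt in S1; [|easy].
    assert (P := loop_slope_pos g m (m + x1) Hg Hm ltac:(right; lra) ltac:(right; lra)). lra.
  + rewrite glue_ge in S1; [|lra]. rewrite glue_ge in S2; [|lra].
    apply (sum_slope_sign g m (m - x2) (m - x1)); auto; try lra.
    intros v Hv. split; [right; lra|lra].
Qed.

(** For x > 0 entry and exit speed both grow as the angle m - x decreases, so critical points occur
    only at x < 0, where [diff_slope_sign] applies. *)
Lemma hump_quasiconvex (g m : R) : bias g -> is_top g m ->
  let w := m - (2 * PI - vmax g) in quasiconvex (hump g m false) (- w) w.
Proof.
intros Hg Hm w. destruct (vmax_bound g Hg) as [B1 B2]. destruct (bias_asin g Hg) as [Ha [Es _]].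
assert (Hm' := proj1 Hm). destruct (bias_PI g Hg) as [Hg0 _].
apply (quasiconvex_of_derive _ (hump_slope g m false) 0).
- intros x Hx N. now apply hump_derive.
- intros x _. apply continuity_pt_filterlim. now apply hump_continuous.
- unfold hump_slope. intros x1 x2 H1 H12 H2 N1 N2 S1 S2. unfold w in H1, H2.
  destruct (Rlt_dec x2 0) as [H|H].
  + rewrite glue_lt in S1; [|lra]. rewrite glue_lt in S2; [|easy].
    apply (diff_slope_sign g m (m + x1) (m + x2)); auto; try lra.
    intros v Hv. split; [right; lra|right; lra].
  + rewrite glue_ge in S2; [|lra].
    assert (Hi : exit_interior g m (m - x2)) by (right; lra).
    destruct (entry_mom_slope_false_sign g m (m - x2) Hg Hm Hi) as [k [Hk E]].
    rewrite E in S2.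
    assert (sin (m - x2) < 0) by (apply sin_lt_0; lra).
    assert (M := mom_pos g (m - x2) (gap_pos_top g m (m - x2) Hg Hm ltac:(lra))).
    assert ((sin (m - x2) - g) / mom g (m - x2) < 0) by (apply Rlt_div_l; lra).
    assert (k * sin (m - x2) < 0) by nra. lra.
Qed.

(** * Sorting the fluxons into the families and counting them *)

Definition at_most_two {T : Type} (C : T -> Prop) : Prop :=
  forall x y z, C x -> C y -> C z -> x <> y -> x <> z -> y <> z -> False.

Lemma at_most_two_length {T : Type} (C : T -> Prop) (l : list T) :
  at_most_two C -> NoDup l -> List.Forall C l -> (length l <= 2)%nat.
Proof.
intros HC ND HF.
destruct l as [|x [|y [|z l]]]; simpl; try lia. exfalso.
inversion_clear ND as [|? ? Nx ND']. inversion_clear ND' as [|? ? Ny ND].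
inversion_clear HF as [|? ? Cx HF']. inversion_clear HF' as [|? ? Cy HF].
inversion_clear HF as [|? ? Cz _].
apply (HC x y z); auto; intros ->; simpl in *; tauto.
Qed.

Lemma split_class_length {T : Type} (A P : T -> Prop) (k : nat) (l : list T) :
  at_most_two A -> (forall l', NoDup l' -> List.Forall P l' -> (length l' <= k)%nat) ->
  NoDup l -> List.Forall (fun x => A x \/ P x) l -> (length l <= 2 + k)%nat.
Proof.
intros HA HP ND HF.
(* The clause on [In] is what carries [NoDup] through the induction. An element belonging to both
   classes goes to one list only. *)
assert (exists la lp, NoDup la /\ NoDup lp /\ List.Forall A la /\ List.Forall P lp /\
  (forall x, In x la \/ In x lp -> In x l) /\ length l = (length la + length lp)%nat)
  as [la [lp [Na [Np [Fa [Fp [_ E]]]]]]].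
{ induction l as [|x l IH].
  - exists nil, nil. repeat split; try constructor. simpl. tauto.
  - inversion_clear ND as [|? ? Nx ND']. inversion_clear HF as [|? ? Hx HF'].
    destruct (IH ND' HF') as [la [lp [Na [Np [Fa [Fp [I E]]]]]]].
    assert (K : ~ In x la /\ ~ In x lp) by (split; intros H; apply Nx, I; tauto).
    destruct Hx as [Hx|Hx]; [exists (x :: la), lp|exists la, (x :: lp)];
      repeat split; auto; try (constructor; tauto); try (simpl; lia);
      simpl; intros y Hy; specialize (I y); tauto. }
assert (H1 := at_most_two_length A la HA Na Fa). assert (H2 := HP lp Np Fp). lia.
Qed.

Definition outer_fluxon (g L : R) (phi : R -> R) : Prop :=
  pinned_fluxon L g 0 phi /\ exists s v,
    on_arc (outer g true) (outer g false) (- vmax g) (vmax g) (2 * g * L) s v /\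
    phi (- L) = entry_side g s v.

(** The strict bound for [s = false] assigns the junction [vmax] to the first side, as [on_arc] does
    for closed curves. *)
Definition loop_fluxon (g L : R) (phi : R -> R) : Prop :=
  pinned_fluxon L g 0 phi /\ exists s v,
    asin g < v <= vmax g /\ (s = false -> v < vmax g) /\
    loop g s v = 2 * g * L /\ phi (- L) = entry_side g s v.

Definition hump_fluxon (g m L : R) (phi : R -> R) : Prop :=
  pinned_fluxon L g 0 phi /\ exists s x,
    let w := m - (2 * PI - vmax g) in
    on_arc (hump g m true) (hump g m false) (- w) w (2 * g * L) s x /\
    phi (- L) = entry_side g s (m - Rabs x).

(** By [orbit_inv] the slope at -L is [mom] of the value there, so equal values give equal initial
    data. *)
Lemma fluxon_eq_of_entry (g L : R) (phi1 phi2 : R -> R) :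
  bias g -> 0 < L -> pinned_fluxon L g 0 phi1 -> pinned_fluxon L g 0 phi2 ->
  phi1 (- L) = phi2 (- L) -> phi1 = phi2.
Proof.
intros Hg HL H1 H2 E. destruct (top_exists g Hg) as [m Hm].
apply (fluxon_determined L g); auto.
assert (O1 := orbit_of_fluxon g m L phi1 Hg Hm HL H1).
assert (O2 := orbit_of_fluxon g m L phi2 Hg Hm HL H2).
destruct (orbit_inv _ _ _ _ _ _ _ Hg Hm HL O1) as [_ [-> _]].
destruct (orbit_inv _ _ _ _ _ _ _ Hg Hm HL O2) as [_ [-> _]].
now rewrite E.
Qed.

Lemma outer_at_most_two (g L : R) : bias g -> 0 < L -> at_most_two (outer_fluxon g L).
Proof.
intros Hg HL p1 p2 p3 [F1 [s1 [v1 [A1 E1]]]] [F2 [s2 [v2 [A2 E2]]]] [F3 [s3 [v3 [A3 E3]]]] N12 N13 N23.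
apply (closed_curve_level3 _ _ _ _ _ s1 s2 s3 v1 v2 v3
  (outer_quasiconcave g Hg) (outer_quasiconvex g Hg)
  (outer_ends g _ Hg (cos_neg _)) (outer_ends g _ Hg (eq_refl _)) A1 A2 A3).
- intros E. apply N12, (fluxon_eq_of_entry g L); auto. injection E as -> ->. congruence.
- intros E. apply N13, (fluxon_eq_of_entry g L); auto. injection E as -> ->. congruence.
- intros E. apply N23, (fluxon_eq_of_entry g L); auto. injection E as -> ->. congruence.
Qed.

Lemma hump_at_most_two (g m L : R) : bias g -> is_top g m -> 0 < L ->
  at_most_two (hump_fluxon g m L).
Proof.
intros Hg Hm HL p1 p2 p3 [F1 [s1 [v1 [A1 E1]]]] [F2 [s2 [v2 [A2 E2]]]] [F3 [s3 [v3 [A3 E3]]]] N12 N13 N23.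
set (w := m - (2 * PI - vmax g)) in *.
(* For w < 0 the turning point lies below the hump range and the family is empty. *)
destruct (Rlt_dec w 0) as [Hw|Hw].
{ revert A1. destruct s1; intros [A _]; lra. }
assert (Ew : forall s, hump g m s (- w) = loop g s (2 * PI - vmax g) /\
  hump g m s w = entry_mom g s (2 * PI - vmax g) + mom g (2 * PI - vmax g)).
{ intros s. unfold hump. split.
  - destruct (Rlt_dec (- w) 0) as [H|H].
    + rewrite glue_lt; [|easy]. f_equal. unfold w. ring.
    + assert (w = 0) by lra. rewrite H0 Ropp_0 glue_ge; [|lra].
      replace (2 * PI - vmax g) with (m - w) by (unfold w; ring). rewrite H0.
      unfold loop. rewrite Rminus_0_r (mom_0 g m (proj2 Hm)). ring.
  - rewrite glue_ge; [|lra]. now replace (m - w) with (2 * PI - vmax g) by (unfold w; ring). }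
assert (Em := entry_mom_ends g (2 * PI - vmax g) Hg (cos_2PI_minus _)).
apply (closed_curve_level3 (hump g m true) (hump g m false) (- w) w (2 * g * L)
  s1 s2 s3 v1 v2 v3 (hump_quasiconcave g m Hg Hm) (hump_quasiconvex g m Hg Hm)); auto.
- destruct (Ew true) as [-> _]. destruct (Ew false) as [-> _]. unfold loop. now rewrite Em.
- destruct (Ew true) as [_ ->]. destruct (Ew false) as [_ ->]. now rewrite Em.
- intros E. apply N12, (fluxon_eq_of_entry g L); auto. injection E as -> ->. congruence.
- intros E. apply N13, (fluxon_eq_of_entry g L); auto. injection E as -> ->. congruence.
- intros E. apply N23, (fluxon_eq_of_entry g L); auto. injection E as -> ->. congruence.
Qed.

Lemma loop_at_most_two (g L : R) : bias g -> 0 < L -> at_most_two (loop_fluxon g L).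
Proof.
intros Hg HL.
assert (K : forall phi, loop_fluxon g L phi -> exists x,
  asin g <= x <= 2 * vmax g - asin g /\ loop_path g x = 2 * g * L /\
  phi (- L) = glue (vmax g) (entry_side g true) (fun x => entry_side g false (2 * vmax g - x)) x).
{ intros phi [_ [s [v [Hv [Hs [E1 E2]]]]]]. destruct s.
  - exists v. split; [lra|]. unfold loop_path.
    destruct (Rlt_dec v (vmax g)) as [H|H].
    + now rewrite !glue_lt.
    + replace v with (vmax g) in * by lra. rewrite !glue_ge; try lra.
      replace (2 * vmax g - vmax g) with (vmax g) by ring.
      destruct (entry_side_ends g (vmax g) Hg (eq_refl _)) as [T1 T2].
      unfold loop. rewrite -(entry_mom_ends g (vmax g) Hg (eq_refl _)). rewrite T2 -T1. split; [exact E1|exact E2].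
  - specialize (Hs (eq_refl _)). exists (2 * vmax g - v). split; [lra|]. unfold loop_path.
    rewrite !glue_ge; try lra. now replace (2 * vmax g - (2 * vmax g - v)) with v by ring. }
intros p1 p2 p3 H1 H2 H3 N12 N13 N23.
destruct (K p1 H1) as [x1 [A1 [B1 C1]]]. destruct (K p2 H2) as [x2 [A2 [B2 C2]]].
destruct (K p3 H3) as [x3 [A3 [B3 C3]]].
apply (quasiconvex_level3 _ _ _ (2 * g * L) x1 x2 x3 (loop_path_quasiconvex g Hg)); auto; intros E.
- apply N12, (fluxon_eq_of_entry g L); auto; [apply H1|apply H2|congruence].
- apply N13, (fluxon_eq_of_entry g L); auto; [apply H1|apply H3|congruence].
- apply N23, (fluxon_eq_of_entry g L); auto; [apply H2|apply H3|congruence].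
Qed.

(** The range of [v] separates humps from the rest. In the first range an exit slope equal to
    [- smom] means outer; the only other possibility is a positive slope right of the saddle, a
    loop. *)
Lemma fluxon_trichotomy (g m L : R) (phi : R -> R) :
  bias g -> is_top g m -> 0 < L -> pinned_fluxon L g 0 phi ->
  outer_fluxon g L phi \/ loop_fluxon g L phi \/ hump_fluxon g m L phi.
Proof.
intros Hg Hm HL H.
assert (O := orbit_of_fluxon g m L phi Hg Hm HL H).
set (v := phi L - 2 * PI) in *. set (pout := Derive phi L) in *.
destruct (orbit_inv _ _ _ _ _ _ _ Hg Hm HL O) as [Hu [Ep [Hv [s [Es Hs]]]]].
assert (El := orbit_slope _ _ _ _ _ _ _ O). rewrite Ep Es in El.
change (entry_mom g s v - pout = 2 * g * L) in El.
assert (Eq := orbit_pout _ _ _ _ _ _ _ O). assert (Hr := orbit_right _ _ _ _ _ _ _ O).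
destruct (vmax_bound g Hg) as [B1 B2]. destruct (bias_asin g Hg) as [Ha _]. assert (Hm' := proj1 Hm).
destruct (exit_angle_facts g m v Hg Hm Hv) as [F1 [F2 _]].
assert (G0 := gap_ge_0 g m v Hg Hm F1).
(* On the mirrored side u > PI strictly, so a junction, where u = PI, is always counted on the first
   side. *)
assert (Hne : s = false -> cos v <> cos (vmax g)).
{ intros -> Ec. destruct (entry_side_ends g v Hg Ec) as [_ T]. rewrite T in Es. lra. }
assert (Hsign : 0 <= pout /\ pout = mom g v \/ pout < 0 /\ pout = - mom g v).
{ destruct (Rle_dec 0 pout); [left; split; [easy|now apply mom_unique]|right; split; [lra|]].
  rewrite -(mom_unique g v (- pout)); [ring|lra|rewrite -Eq; ring]. }
destruct Hv as [Hv|Hv].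
- assert (Hlt : s = false -> - vmax g < v < vmax g).
  { intros Hf. specialize (Hne Hf). split.
    - destruct Hv as [[Hv|Hv] _]; [easy|]. exfalso. apply Hne. rewrite -Hv. apply cos_neg.
    - destruct Hv as [_ [Hv|Hv]]; [easy|]. exfalso. apply Hne. now rewrite Hv. }
  assert (Kout : pout = - smom g v -> outer_fluxon g L phi).
  { intros Hp. split; [easy|]. exists s, v. split; [|easy].
    assert (Eo : outer g s v = 2 * g * L) by (unfold outer; lra).
    destruct s; split; auto. }
  destruct (Rlt_dec v (asin g)) as [Hva|Hva].
  + left. apply Kout. rewrite smom_lt; [|easy]. specialize (Hr Hva). destruct Hsign as [[_ ->]|[? _]]; lra.
  + destruct Hsign as [[Hp Ep']|[_ Ep']].
    * destruct (Req_dec v (asin g)) as [Ev|Nv].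
      -- left. apply Kout. rewrite Ep' smom_ge; [|lra]. rewrite Ev mom_0; [ring|apply gap_asin].
      -- right; left. split; [easy|]. exists s, v. repeat split; try lra; auto.
         ++ intros Hf. apply Hlt, Hf.
         ++ unfold loop. lra.
    * left. apply Kout. rewrite smom_ge; lra.
- right; right. split; [easy|].
  set (w := m - (2 * PI - vmax g)).
  assert (Hlt : s = false -> m - v < w).
  { intros Hf. specialize (Hne Hf). unfold w. destruct Hv as [[Hv|Hv] _]; [lra|].
    exfalso. apply Hne. rewrite -Hv. apply cos_2PI_minus. }
  destruct Hsign as [[Hp Ep']|[Hp Ep']].
  + exists s, (v - m). simpl. fold w.
    assert (Eh : hump g m s (v - m) = 2 * g * L).
    { unfold hump. destruct (Rlt_dec (v - m) 0) as [Hn|Hn].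
      - rewrite glue_lt; [|easy]. unfold loop. replace (m + (v - m)) with v by ring. lra.
      - rewrite glue_ge; [|lra]. replace (m - (v - m)) with v by lra.
        assert (v = m) by lra. assert (mom g v = 0) by (apply mom_0; rewrite H0; apply Hm). lra. }
    split.
    * destruct s; split; auto; unfold w in *; [lra|specialize (Hlt (eq_refl _)); lra].
    * rewrite Rabs_left1; [|lra]. now replace (m - - (v - m)) with v by ring.
  + exists s, (m - v). simpl. fold w.
    assert (Eh : hump g m s (m - v) = 2 * g * L).
    { unfold hump. rewrite glue_ge; [|lra]. replace (m - (m - v)) with v by ring. lra. }
    split.
    * destruct s; split; auto; unfold w in *; [lra|specialize (Hlt (eq_refl _)); lra].
    * rewrite Rabs_pos_eq; [|lra]. now replace (m - (m - v)) with v by ring.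
Qed.

Lemma fluxon_count_le_6 (g L : R) (n : nat) :
  bias g -> 0 < L -> at_least_fluxons n L g 0 -> (n <= 6)%nat.
Proof.
intros Hg HL [l [ND [HF <-]]]. destruct (top_exists g Hg) as [m Hm].
apply (split_class_length (outer_fluxon g L) (fun phi => loop_fluxon g L phi \/ hump_fluxon g m L phi) 4).
- now apply outer_at_most_two.
- intros l1 N1 F1. apply (split_class_length (loop_fluxon g L) (hump_fluxon g m L) 2); auto.
  + now apply loop_at_most_two.
  + intros l2 N2 F2. apply (at_most_two_length (hump_fluxon g m L)); auto. now apply hump_at_most_two.
- exact ND.
- eapply Forall_impl; [|exact HF]. intros phi Hphi. now apply fluxon_trichotomy.
Qed.

(** * Extremal lengths and limits *)

Lemma ivt_between (f : R -> R) (a b l : R) :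
  (forall x, continuous f x) -> a <= b -> (f a <= l <= f b \/ f b <= l <= f a) ->
  exists x, a <= x <= b /\ f x = l.
Proof.
intros Hc Hab Hl.
destruct (IVT_gen f a b l) as [x [Hx E]].
- intros x. apply continuity_pt_filterlim, Hc.
- unfold Rmin, Rmax. destruct (Rle_dec (f a) (f b)); lra.
- exists x. split; [|easy]. now rewrite Rmin_left in Hx; [|lra]; rewrite Rmax_right in Hx.
Qed.

Lemma fluxon_exists (g m L v z : R) (s : bool) :
  bias g -> is_top g m -> exit_angle g m v -> z ^ 2 = 2 * gap g v -> (v < asin g -> 0 < z) ->
  entry_mom g s v - z = 2 * g * L ->
  0 < L /\ exists phi, pinned_fluxon L g 0 phi /\
    phi (- L) = entry_side g s v /\ phi L = v + 2 * PI.
Proof.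
intros Hg Hm Hv Hz Hz' El. destruct (bias_PI g Hg) as [Hg0 _].
destruct (orbit_exists g m v z s Hg Hm Hv Hz Hz') as [HL O].
assert (E : (mom g (entry_side g s v) - z) / (2 * g) = L).
{ change (mom g (entry_side g s v)) with (entry_mom g s v). rewrite El. field. lra. }
rewrite E in HL, O. split; [easy|]. now apply (fluxon_of_orbit g m L _ _ _ _ Hg Hm HL O).
Qed.

Lemma outer_fluxon_exists (g L v : R) (s : bool) :
  bias g -> - vmax g <= v <= vmax g -> outer g s v = 2 * g * L ->
  0 < L /\ exists phi, pinned_fluxon L g 0 phi /\
    phi (- L) = entry_side g s v /\ phi L = v + 2 * PI.
Proof.
intros Hg Hv El. destruct (top_exists g Hg) as [m Hm].
assert (Hx : exit_angle g m v) by now left.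
destruct (exit_angle_facts g m v Hg Hm Hx) as [F1 _].
assert (G := gap_ge_0 g m v Hg Hm F1).
apply (fluxon_exists g m L v (- smom g v)); auto.
- rewrite -(smom_sq g v G). ring.
- intros Ha. assert (S := smom_neg g v Hg Ha). lra.
- unfold outer in El. lra.
Qed.

Lemma top_lt (g m : R) : bias g -> is_top g m -> m < 2 * PI - asin g.
Proof.
intros Hg Hm. apply Rnot_le_lt. intros H.
assert (G := gap_ge_0 g m _ Hg Hm H). revert G. unfold gap. rewrite cos_2PI_minus.
destruct (bias_asin g Hg) as [Ha _]. destruct (bias_PI g Hg) as [Hg0 _]. nra.
Qed.

(** Both sides have the same cosine, and the tilt - g x of the gap favours the smaller angle. *)
Lemma entry_mom_side (g m v : R) (s : bool) : bias g -> is_top g m -> exit_angle g m v ->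
  entry_mom g false v <= entry_mom g s v <= entry_mom g true v.
Proof.
intros Hg Hm Hv.
assert (entry_mom g false v <= entry_mom g true v); [|destruct s; lra].
unfold entry_mom. apply sqrt_le_1_alt. simpl. unfold gap. rewrite cos_2PI_minus.
assert (B := entry_bound g v). destruct (bias_PI g Hg) as [Hg0 _]. nra.
Qed.

Lemma entry_mom_cos (g v w : R) (s : bool) : cos v = cos w -> entry_mom g s v = entry_mom g s w.
Proof. intros E. unfold entry_mom, entry_side, entry. now rewrite E. Qed.

Lemma mom_le (g x y : R) : gap g x <= gap g y -> mom g x <= mom g y.
Proof. intros H. apply sqrt_le_1_alt. lra. Qed.

(** Let y in [0, vmax] have the cosine of [v]; entry speeds are unchanged. Since mom (- y) >= mom v,
    the mirrored outer length at - y is a lower bound. Right of the saddle mom y >= mom v makes the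
    first-side outer length at [y] an upper bound; left of it [v] itself serves. *)
Lemma fluxon_between_outer (g L : R) (phi : R -> R) :
  bias g -> 0 < L -> pinned_fluxon L g 0 phi ->
  exists v1 v2, - vmax g <= v1 <= vmax g /\ - vmax g <= v2 <= vmax g /\
    outer g false v1 <= 2 * g * L <= outer g true v2.
Proof.
intros Hg HL H. destruct (top_exists g Hg) as [m Hm].
assert (O := orbit_of_fluxon g m L phi Hg Hm HL H).
set (v := phi L - 2 * PI) in *. set (pout := Derive phi L) in *.
destruct (orbit_inv _ _ _ _ _ _ _ Hg Hm HL O) as [_ [Ep [Hv [s [Es _]]]]].
assert (El := orbit_slope _ _ _ _ _ _ _ O). rewrite Ep Es in El.
change (entry_mom g s v - pout = 2 * g * L) in El.
assert (Eq := orbit_pout _ _ _ _ _ _ _ O). assert (Hr := orbit_right _ _ _ _ _ _ _ O).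
destruct (vmax_bound g Hg) as [B1 B2]. destruct (bias_asin g Hg) as [Ha _].
destruct (bias_PI g Hg) as [Hg0 _]. assert (Hm' := proj1 Hm). assert (Tm := top_lt g m Hg Hm).
destruct (exit_angle_facts g m v Hg Hm Hv) as [F1 [F2 _]].
assert (G0 := gap_ge_0 g m v Hg Hm F1).
assert (Habs : Rabs pout = mom g v).
{ apply mom_unique; [apply Rabs_pos|]. now rewrite pow2_abs. }
assert (Hp : - mom g v <= pout <= mom g v).
{ rewrite -Habs. apply Rabs_le_between. lra. }
assert (Hside := entry_mom_side g m v s Hg Hm Hv).
assert (exists y, 0 <= y <= vmax g /\ cos y = cos v /\ - y <= v /\ (y <= v \/ v = - y))
  as [y [Hy [Cy [Hyv Hyv']]]].
{ destruct Hv as [Hv|Hv].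
  - exists (Rabs v). unfold Rabs. destruct (Rcase_abs v); rewrite ?cos_neg; repeat split; lra.
  - exists (2 * PI - v). rewrite cos_2PI_minus. repeat split; lra. }
assert (Glow : mom g v <= mom g (- y)).
{ apply mom_le. unfold gap. rewrite cos_neg Cy. nra. }
exists (- y).
assert (Low : outer g false (- y) <= 2 * g * L).
{ unfold outer. rewrite smom_lt; [|lra].
  rewrite (entry_mom_cos g (- y) v false); [lra|now rewrite cos_neg]. }
destruct (Rlt_dec v (asin g)) as [Hva|Hva].
- exists v. assert (Hvo : - vmax g <= v <= vmax g) by (destruct Hv; lra).
  specialize (Hr Hva). assert (pout = mom g v) by (apply mom_unique; lra).
  repeat split; try lra. unfold outer. rewrite smom_lt; lra.
- exists y. assert (Hya : asin g <= y).
  { destruct Hv as [Hv|Hv].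
    - destruct Hyv' as [Hyv'|Hyv']; [|lra].
      apply Rnot_lt_le. intros Hn.
      assert (cos v < cos y) by (apply cos_decreasing_1; lra). lra.
    - apply Rnot_lt_le. intros Hn.
      assert (cos (2 * PI - v) < cos y) by (apply cos_decreasing_1; lra).
      rewrite cos_2PI_minus in H0. lra. }
  assert (Gup : mom g v <= mom g y).
  { apply mom_le. unfold gap. rewrite Cy. destruct Hyv' as [Hyv'|Hyv']; [nra|lra]. }
  repeat split; try lra. unfold outer. rewrite smom_ge; [|lra].
  rewrite (entry_mom_cos g y v true Cy). lra.
Qed.

Lemma outer_extrema (g : R) : bias g ->
  exists v1 v2, - vmax g <= v1 <= vmax g /\ - vmax g <= v2 <= vmax g /\
  (forall v, - vmax g <= v <= vmax g -> outer g false v1 <= outer g false v) /\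
  (forall v, - vmax g <= v <= vmax g -> outer g true v <= outer g true v2).
Proof.
intros Hg. destruct (vmax_bound g Hg) as [B1 B2].
destruct (continuity_ab_min (outer g false) (- vmax g) (vmax g)) as [v1 [M1 H1]]; [lra| |].
{ intros c _. apply continuity_pt_filterlim, outer_continuous. }
destruct (continuity_ab_maj (outer g true) (- vmax g) (vmax g)) as [v2 [M2 H2]]; [lra| |].
{ intros c _. apply continuity_pt_filterlim, outer_continuous. }
now exists v1, v2.
Qed.

(** From [v1] on the lower arc two routes lead to [v2] on the upper arc, one through each common
    end, and each crosses the level. The crossings differ either in the exit angle or in the entry
    angle. *)
Lemma outer_two_points (g l v1 v2 : R) : bias g ->
  - vmax g <= v1 <= vmax g -> - vmax g <= v2 <= vmax g ->
  outer g false v1 < l < outer g true v2 ->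
  (forall v, - vmax g <= v <= vmax g -> outer g true v <= outer g true v2) ->
  exists s x t y, - vmax g <= x <= vmax g /\ - vmax g <= y <= vmax g /\
    outer g s x = l /\ outer g t y = l /\
    (x <> y \/ entry_side g s x <> entry_side g t y).
Proof.
intros Hg H1 H2 Hl Hmax. destruct (vmax_bound g Hg) as [B1 B2].
assert (Ea := outer_ends g (- vmax g) Hg (cos_neg _)).
assert (Eb := outer_ends g (vmax g) Hg (eq_refl _)).
assert (Cn := outer_continuous g false). assert (Cp := outer_continuous g true).
assert (Hmix : forall x, - vmax g <= x <= vmax g -> entry_side g true x = entry_side g false x ->
  x = - vmax g \/ x = vmax g).
{ intros x Hx E. simpl in E.
  destruct (Req_dec x (- vmax g)) as [|N1]; [now left|].
  destruct (Req_dec x (vmax g)) as [|N2]; [now right|]. exfalso.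
  assert (C := cos_gt_vmax g x Hg ltac:(lra)). assert (Le := entry_lt_PI g x Hg C). lra. }
(* The route through [- vmax]. The strict inequality in the second case keeps its crossing away from
   the junction, which lies on both arcs. *)
assert (Kl : (exists x, - vmax g <= x <= v1 /\ outer g false x = l) \/
  (outer g true (- vmax g) < l /\ exists x, - vmax g <= x <= v2 /\ outer g true x = l)).
{ destruct (Rle_dec l (outer g true (- vmax g))) as [H|H].
  - left. apply (ivt_between _ _ _ _ Cn); lra.
  - right. split; [lra|]. apply (ivt_between _ _ _ _ Cp); lra. }
assert (Kr : (exists x, v1 <= x <= vmax g /\ outer g false x = l) \/
  (outer g true (vmax g) < l /\ exists x, v2 <= x <= vmax g /\ outer g true x = l)).
{ destruct (Rle_dec l (outer g true (vmax g))) as [H|H].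
  - left. apply (ivt_between _ _ _ _ Cn); lra.
  - right. split; [lra|]. apply (ivt_between _ _ _ _ Cp); lra. }
destruct Kl as [[x [Hx Ex]]|[Hla [x [Hx Ex]]]]; destruct Kr as [[y [Hy Ey]]|[Hlb [y [Hy Ey]]]].
- exists false, x, false, y. repeat split; try lra. left. intros <-.
  assert (x = v1) by lra. subst. lra.
- exists false, x, true, y. repeat split; try lra.
  destruct (Req_dec x y) as [<-|N]; [right|now left]. intros E.
  destruct (Hmix x ltac:(lra) (eq_sym E)) as [F|F].
  + assert (x = v2) by lra. subst. lra.
  + rewrite F in Ey. lra.
- exists true, x, false, y. repeat split; try lra.
  destruct (Req_dec x y) as [<-|N]; [right|now left]. intros E.
  destruct (Hmix x ltac:(lra) E) as [F|F].
  + rewrite F in Ex. lra.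
  + assert (x = v2) by lra. subst. lra.
- exists true, x, true, y. repeat split; try lra. left. intros <-.
  assert (x = v2) by lra. subst. lra.
Qed.

Lemma at_least_one (g L : R) (phi : R -> R) :
  pinned_fluxon L g 0 phi -> at_least_fluxons 1 L g 0.
Proof.
intros H. exists (phi :: nil). repeat split; auto.
constructor; [easy|constructor].
Qed.

Lemma extremal_half_lengths (g : R) : bias g ->
  exists v1 v2, - vmax g <= v1 <= vmax g /\ - vmax g <= v2 <= vmax g /\
  let Lmin := outer g false v1 / (2 * g) in let Lmax := outer g true v2 / (2 * g) in
  is_minimum (pinning_half_length g 0) Lmin /\ is_maximum (pinning_half_length g 0) Lmax /\
  (forall L, Lmin < L < Lmax -> at_least_fluxons 2 L g 0).
Proof.
intros Hg. destruct (bias_PI g Hg) as [Hg0 _].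
destruct (outer_extrema g Hg) as [v1 [v2 [H1 [H2 [Hmin Hmax]]]]].
exists v1, v2. split; [easy|]. split; [easy|].
assert (Ed : forall l, 2 * g * (l / (2 * g)) = l) by (intros; field; lra).
assert (Hle : forall l L, l <= 2 * g * L -> l / (2 * g) <= L).
{ intros l L Hl. apply Rle_div_l; lra. }
assert (Hge : forall l L, 2 * g * L <= l -> L <= l / (2 * g)).
{ intros l L Hl. apply Rle_div_r; lra. }
split; [|split].
- destruct (outer_fluxon_exists g _ v1 false Hg H1 (eq_sym (Ed _))) as [HL [phi [Hphi _]]].
  split; [split; [easy|now exists phi]|].
  intros L [HL' [psi Hpsi]]. destruct (fluxon_between_outer g L psi Hg HL' Hpsi) as [w1 [w2 [K1 [K2 K3]]]].
  apply Hle. specialize (Hmin w1 K1). lra.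
- destruct (outer_fluxon_exists g _ v2 true Hg H2 (eq_sym (Ed _))) as [HL [phi [Hphi _]]].
  split; [split; [easy|now exists phi]|].
  intros L [HL' [psi Hpsi]]. destruct (fluxon_between_outer g L psi Hg HL' Hpsi) as [w1 [w2 [K1 [K2 K3]]]].
  apply Hge. specialize (Hmax w2 K2). lra.
- intros L [HL1 HL2].
  assert (Hl : outer g false v1 < 2 * g * L < outer g true v2).
  { split.
    - apply Rlt_div_l in HL1; lra.
    - apply Rlt_div_r in HL2; lra. }
  destruct (outer_two_points g (2 * g * L) v1 v2 Hg H1 H2 Hl Hmax)
    as [s [x [t [y [Hx [Hy [Ex [Ey N]]]]]]]].
  destruct (outer_fluxon_exists g L x s Hg Hx Ex) as [HL [phi [P1 [P2 P3]]]].
  destruct (outer_fluxon_exists g L y t Hg Hy Ey) as [_ [psi [Q1 [Q2 Q3]]]].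
  exists (phi :: psi :: nil). split; [|split; [|easy]].
  + constructor; [|constructor; [easy|constructor]].
    intros [E|[]]. subst psi. destruct N as [N|N]; [apply N; lra|apply N; congruence].
  + constructor; [easy|]. constructor; [easy|constructor].
Qed.

(** The infimum yields a function of [g] without choosing a minimiser; it equals the minimum
    wherever one exists. *)
Definition min_half_length (g : R) : R := real (Glb_Rbar (pinning_half_length g 0)).

Definition max_half_length (g : R) : R := real (Lub_Rbar (pinning_half_length g 0)).

Lemma min_half_length_eq (g L : R) :
  is_minimum (pinning_half_length g 0) L -> min_half_length g = L.
Proof.
intros [H1 H2]. unfold min_half_length.
rewrite (is_glb_Rbar_unique _ (Finite L)); [easy|]. split.
- intros x Hx. now apply H2.
- intros b Hb. now apply Hb.
Qed.

Lemma max_half_length_eq (g L : R) :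
  is_maximum (pinning_half_length g 0) L -> max_half_length g = L.
Proof.
intros [H1 H2]. unfold max_half_length.
rewrite (is_lub_Rbar_unique _ (Finite L)); [easy|]. split.
- intros x Hx. now apply H2.
- intros b Hb. now apply Hb.
Qed.

Lemma half_lengths_spec (g : R) : bias g ->
  is_minimum (pinning_half_length g 0) (min_half_length g) /\
  is_maximum (pinning_half_length g 0) (max_half_length g) /\
  (forall L, min_half_length g < L < max_half_length g -> at_least_fluxons 2 L g 0) /\
  (exists v1, - vmax g <= v1 <= vmax g /\ min_half_length g = outer g false v1 / (2 * g)) /\
  (exists v2, - vmax g <= v2 <= vmax g /\ max_half_length g = outer g true v2 / (2 * g)).
Proof.
intros Hg. destruct (extremal_half_lengths g Hg) as [v1 [v2 [H1 [H2 [H3 [H4 H5]]]]]].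
rewrite (min_half_length_eq g _ H3) (max_half_length_eq g _ H4).
repeat split; try apply H3; try apply H4; auto; [exists v1|exists v2]; easy.
Qed.

(** * Extremal lengths for small bias *)

Lemma outer_length_bounds (g v : R) (s : bool) :
  bias g -> - vmax g <= v <= vmax g ->
  min_half_length g <= outer g s v / (2 * g) <= max_half_length g.
Proof.
intros Hg Hv. destruct (bias_PI g Hg) as [Hg0 _].
destruct (half_lengths_spec g Hg) as [[_ H1] [[_ H2] _]].
destruct (outer_fluxon_exists g (outer g s v / (2 * g)) v s Hg Hv) as [HL [phi [P _]]].
{ field. lra. }
assert (pinning_half_length g 0 (outer g s v / (2 * g))) by (split; [easy|now exists phi]).
split; auto.
Qed.

Lemma min_half_length_pos (g : R) : bias g -> 0 < min_half_length g.
Proof. intros Hg. apply (half_lengths_spec g Hg). Qed.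

Lemma mom_match (g u v : R) : 0 <= gap g u -> 0 <= gap g v -> cos v - cos u = 2 * PI * g ->
  (mom g u - mom g v) * (mom g u + mom g v) = 2 * g * (2 * PI + v - u).
Proof.
intros Hu Hv E. assert (Eu := mom_sq g u Hu). assert (Ev := mom_sq g v Hv).
assert (M := gap_match g u v E). nra.
Qed.

Lemma mom_PI_gt_1 (g : R) : bias g -> 1 < mom g PI.
Proof.
intros Hg. assert (G := gap_PI_pos g Hg). rewrite -sqrt_1. apply sqrt_lt_1_alt. lra.
Qed.

(** The fluxon with u = PI and v = - vmax has L = (PI - vmax) / (mom PI + mom (- vmax)), and mom PI
    > 1. As the bias vanishes, [vmax] tends to PI. *)
Lemma min_half_length_le (g : R) : bias g -> min_half_length g <= PI - vmax g.
Proof.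
intros Hg. destruct (bias_PI g Hg) as [Hg0 _]. destruct (vmax_bound g Hg) as [B1 B2].
destruct (bias_asin g Hg) as [Ha _].
apply Rle_trans with (outer g false (- vmax g) / (2 * g)).
{ apply outer_length_bounds; [easy|lra]. }
apply Rle_div_l; [lra|].
unfold outer, entry_mom. destruct (entry_side_ends g (- vmax g) Hg (cos_neg _)) as [_ ->].
rewrite smom_lt; [|lra].
assert (G := gap_pos_left g (- vmax g) Hg ltac:(lra)).
assert (E := mom_match g PI (- vmax g) ltac:(assert (K := gap_PI_pos g Hg); lra) ltac:(lra)).
rewrite cos_neg cos_PI cos_vmax in E; [|easy]. specialize (E ltac:(ring)).
assert (M := mom_PI_gt_1 g Hg). assert (M' := mom_ge_0 g (- vmax g)).
destruct (Rle_dec 0 (mom g PI - mom g (- vmax g))); nra.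
Qed.

(** At u = PI, v = vmax the outer value is mom PI + mom vmax > 1. The condition on [g] gives vmax >=
    PI / 2, right of the saddle, where [smom] is nonnegative. *)
Lemma max_half_length_ge (g : R) : bias g -> 2 * PI * g <= 1 -> / (2 * g) <= max_half_length g.
Proof.
intros Hg Hg2. destruct (bias_PI g Hg) as [Hg0 _]. destruct (vmax_bound g Hg) as [B1 B2].
destruct (bias_asin g Hg) as [Ha _].
apply Rle_trans with (outer g true (vmax g) / (2 * g)).
2:{ apply outer_length_bounds; [easy|lra]. }
replace (/ (2 * g)) with (1 / (2 * g)) by (field; lra).
apply Rmult_le_compat_r; [left; apply Rinv_0_lt_compat; lra|].
unfold outer, entry_mom. destruct (entry_side_ends g (vmax g) Hg (eq_refl _)) as [-> _].
assert (PI / 2 <= vmax g).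
{ apply Rnot_lt_le. intros H. assert (0 < cos (vmax g)) by (apply cos_gt_0; lra).
  rewrite cos_vmax in H0; [|easy]. lra. }
rewrite smom_ge; [|lra].
assert (M := mom_PI_gt_1 g Hg). assert (M' := mom_ge_0 g (vmax g)). lra.
Qed.

Lemma vmax_continuous (g : R) : continuous vmax g.
Proof.
apply (continuous_comp (fun g => 2 * PI * g - 1) acos); [|apply continuous_acos].
apply: ex_derive_continuous. auto_derive. easy.
Qed.

Lemma min_half_length_lim_0 : filterlim min_half_length (at_right 0) (locally 0).
Proof.
apply filterlim_locally. intros eps.
assert (HP := PI_RGT_0).
assert (H1 : 0 < 1 / PI) by (apply Rdiv_lt_0_compat; lra).
assert (N1 := proj1 (filterlim_locally _ _) (vmax_continuous 0) eps).
assert (N2 := open_lt (1 / PI) 0 H1).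
unfold at_right, within. generalize (filter_and _ _ N1 N2). apply filter_imp. intros g [D1 D2] Hg.
assert (Hbias : bias g) by (split; lra).
assert (B := min_half_length_le g Hbias). assert (P := min_half_length_pos g Hbias).
change (Rabs (vmax g - vmax 0) < eps) in D1. apply Rabs_def2 in D1.
assert (E : vmax 0 = PI).
{ unfold vmax. replace (2 * PI * 0 - 1) with (cos PI) by (rewrite cos_PI; ring). rewrite acos_cos; lra. }
change (Rabs (min_half_length g - 0) < eps). rewrite Rminus_0_r Rabs_pos_eq; lra.
Qed.

Lemma max_half_length_lim_0 : filterlim max_half_length (at_right 0) (Rbar_locally p_infty).
Proof.
intros P [M HM].
assert (HP := PI_gt_3). assert (HP4 := PI_4).
(* The 4 exceeds PI, so 2 g K < 1 yields both the bias condition and 2 PI g <= 1. *)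
set (K := Rabs M + 4). assert (HK : 4 <= K) by (unfold K; assert (A := Rabs_pos M); lra).
assert (Hd : 0 < / (2 * K)) by (apply Rinv_0_lt_compat; lra).
exists (mkposreal _ Hd). intros g Hb Hg. simpl in Hb.
change (Rabs (g - 0) < / (2 * K)) in Hb. rewrite Rminus_0_r in Hb.
assert (A := Rle_abs g).
assert (HgK : 2 * g * K < 1).
{ apply Rlt_le_trans with (2 * / (2 * K) * K); [|right; field; lra].
  apply Rmult_lt_compat_r; lra. }
assert (Hbias : bias g).
{ split; [easy|]. apply Rle_div_r; nra. }
apply HM. apply Rlt_le_trans with (/ (2 * g)).
- apply Rlt_trans with K; [unfold K; assert (A' := Rle_abs M); lra|].
  apply Rmult_lt_reg_l with (2 * g); [lra|]. rewrite Rinv_r; lra.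
- apply max_half_length_ge; [easy|nra].
Qed.

(** * The common limit at bias 1 / PI *)

Definition entry_min (g : R) : R := acos (1 - 2 * PI * g).

(** The gap with the cosine made an independent argument, so that cosine and angle can be replaced
    by separate bounds. *)
Definition gap_with_cos (g c x : R) : R := cos (asin g) - c + g * (asin g - x).

(** Every cosine and angle takes its least favourable value over the exit range. At bias 1 / PI this
    range shrinks to v = 0, and lower and upper bound coincide there, so no extremal point need be
    located. *)
Definition length_lower (g : R) : R :=
  (sqrt (2 * gap_with_cos g (1 - 2 * PI * g) (2 * PI - entry_min g))
   - sqrt (2 * gap_with_cos g (2 * PI * g - 1) (- vmax g))) / (2 * g).

Definition length_upper (g : R) : R :=
  (sqrt (2 * gap_with_cos g (-1) (entry_min g))
   - sqrt (2 * gap_with_cos g 1 (vmax g))) / (2 * g).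

Lemma outer_length_sandwich (g v : R) (s : bool) :
  bias g -> vmax g < asin g -> - vmax g <= v <= vmax g ->
  length_lower g <= outer g s v / (2 * g) <= length_upper g.
Proof.
intros Hg Hva Hv. destruct (bias_PI g Hg) as [Hg0 [Hg1 _]]. assert (HP := PI_RGT_0).
destruct (vmax_bound g Hg) as [B1 B2].
assert (Hc := cos_ge_vmax g v Hg Hv). assert (Ce := cos_entry g v Hg Hc).
assert (Bv := COS_bound v). assert (Be := entry_bound g v). assert (Bm := acos_bound (1 - 2 * PI * g)).
fold (entry_min g) in Bm. assert (Cm : cos (entry_min g) = 1 - 2 * PI * g) by (apply cos_acos; nra).
assert (Hm : entry_min g <= entry g v) by (apply cos_decr_0; lra).
rewrite cos_vmax in Hc; [|easy].
unfold outer, length_lower, length_upper. rewrite smom_lt; [|lra].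
assert (Hi : 0 <= / (2 * g)) by (left; apply Rinv_0_lt_compat; lra).
assert (Hu : cos (entry_side g s v) = cos v - 2 * PI * g /\
  entry_min g <= entry_side g s v <= 2 * PI - entry_min g).
{ destruct s; simpl; [|rewrite cos_2PI_minus]; lra. }
destruct Hu as [Cu Hu].
split; apply Rmult_le_compat_r; auto.
- apply Rplus_le_compat; [apply sqrt_le_1_alt|apply Ropp_le_contravar, sqrt_le_1_alt];
    unfold gap_with_cos, gap; [rewrite Cu|]; nra.
- apply Rplus_le_compat; [apply sqrt_le_1_alt|apply Ropp_le_contravar, sqrt_le_1_alt];
    unfold gap_with_cos, gap; [rewrite Cu|]; nra.
Qed.

Lemma continuous_asin (x : R) : continuous asin x.
Proof.
apply continuous_ext with (fun x => PI / 2 - acos x).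
- intros t. change (PI / 2 - acos t = asin t :> R). unfold acos, asin.
  destruct (Rle_dec t (-1)); [lra|]. destruct (Rle_dec 1 t); lra.
- apply (continuous_minus (fun _ => PI / 2) acos); [apply continuous_const|apply continuous_acos].
Qed.

Lemma continuous_gap_with_cos (c e : R -> R) (g : R) :
  continuous c g -> continuous e g ->
  continuous (fun g => sqrt (2 * gap_with_cos g (c g) (e g))) g.
Proof.
intros Hc He. apply continuous_sqrt_comp.
apply (continuous_scal_r 2 (fun g => gap_with_cos g (c g) (e g))).
apply (continuous_plus (fun g => cos (asin g) - c g) (fun g => g * (asin g - e g))).
- apply (continuous_minus (fun g => cos (asin g)) c); [|exact Hc].
  apply (continuous_comp asin cos); [apply continuous_asin|apply continuous_cos].
- apply (continuous_mult (fun g => g) (fun g => asin g - e g)); [apply continuous_id|].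
  apply (continuous_minus asin e); [apply continuous_asin|exact He].
Qed.

Lemma entry_min_continuous (g : R) : continuous entry_min g.
Proof.
apply (continuous_comp (fun g => 1 - 2 * PI * g) acos); [|apply continuous_acos].
apply: ex_derive_continuous. auto_derive. easy.
Qed.

Lemma continuous_div_double (f : R -> R) (g : R) :
  g <> 0 -> continuous f g -> continuous (fun g => f g / (2 * g)) g.
Proof.
intros Hg Hf. apply (continuous_mult f (fun g => / (2 * g))); [exact Hf|].
apply: ex_derive_continuous. auto_derive. lra.
Qed.

Lemma length_lower_continuous (g : R) : g <> 0 -> continuous length_lower g.
Proof.
intros Hg. apply (continuous_div_double (fun g => _ - _)); [easy|].
apply (continuous_minus (fun g => sqrt (2 * gap_with_cos g (1 - 2 * PI * g) (2 * PI - entry_min g)))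
  (fun g => sqrt (2 * gap_with_cos g (2 * PI * g - 1) (- vmax g)))).
- apply (continuous_gap_with_cos (fun g => 1 - 2 * PI * g) (fun g => 2 * PI - entry_min g)).
  + apply: ex_derive_continuous. auto_derive. easy.
  + apply (continuous_minus (fun _ => 2 * PI) entry_min); [apply continuous_const|apply entry_min_continuous].
- apply (continuous_gap_with_cos (fun g => 2 * PI * g - 1) (fun g => - vmax g)).
  + apply: ex_derive_continuous. auto_derive. easy.
  + apply (continuous_opp vmax), vmax_continuous.
Qed.

Lemma length_upper_continuous (g : R) : g <> 0 -> continuous length_upper g.
Proof.
intros Hg. apply (continuous_div_double (fun g => _ - _)); [easy|].
apply (continuous_minus (fun g => sqrt (2 * gap_with_cos g (-1) (entry_min g)))
  (fun g => sqrt (2 * gap_with_cos g 1 (vmax g)))).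
- apply (continuous_gap_with_cos (fun _ => -1) entry_min); [apply continuous_const|apply entry_min_continuous].
- apply (continuous_gap_with_cos (fun _ => 1) vmax); [apply continuous_const|apply vmax_continuous].
Qed.

Definition critical_length : R :=
  sqrt (PI / 2 * (asin (1 / PI) + sqrt (PI ^ 2 - 1)))
  - sqrt (PI / 2 * (asin (1 / PI) + sqrt (PI ^ 2 - 1) - PI)).

Lemma cos_asin_inv_PI : PI * cos (asin (1 / PI)) = sqrt (PI ^ 2 - 1).
Proof.
assert (HP := PI_gt_3).
assert (Hb : bias (1 / PI)) by (split; [apply Rdiv_lt_0_compat|]; lra).
destruct (bias_asin _ Hb) as [Ha [Es Hc]].
assert (Hsc := sin2_cos2 (asin (1 / PI))). rewrite Es in Hsc. unfold Rsqr in Hsc.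
symmetry. apply sqrt_lem_1; [nra|nra|].
replace (PI * cos (asin (1 / PI)) * (PI * cos (asin (1 / PI)))) with
  (PI ^ 2 * (cos (asin (1 / PI)) * cos (asin (1 / PI)))) by ring.
replace (cos (asin (1 / PI)) * cos (asin (1 / PI))) with (1 - 1 / PI * (1 / PI)) by lra.
field. lra.
Qed.

Lemma sqrt_over_bias (X : R) : sqrt (2 * X) / (2 * (1 / PI)) = sqrt (PI / 2 * (PI * X)).
Proof.
assert (HP := PI_gt_3).
replace (PI / 2 * (PI * X)) with ((PI / 2) ^ 2 * (2 * X)) by field.
rewrite (sqrt_mult_alt ((PI / 2) ^ 2)); [|apply pow2_ge_0].
rewrite -Rsqr_pow2 sqrt_Rsqr; [|lra]. field. lra.
Qed.

Lemma vmax_inv_PI : vmax (1 / PI) = 0.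
Proof.
assert (HP := PI_gt_3). unfold vmax.
replace (2 * PI * (1 / PI) - 1) with (cos 0) by (rewrite cos_0; field; lra).
rewrite acos_cos; lra.
Qed.

Lemma length_bounds_critical :
  length_lower (1 / PI) = critical_length /\ length_upper (1 / PI) = critical_length.
Proof.
assert (HP := PI_gt_3).
assert (E1 : entry_min (1 / PI) = PI).
{ unfold entry_min. replace (1 - 2 * PI * (1 / PI)) with (cos PI) by (rewrite cos_PI; field; lra).
  rewrite acos_cos; lra. }
assert (E2 := vmax_inv_PI).
assert (K1 : PI * gap_with_cos (1 / PI) (-1) PI = asin (1 / PI) + sqrt (PI ^ 2 - 1)).
{ unfold gap_with_cos. rewrite -cos_asin_inv_PI. field. lra. }
assert (K2 : PI * gap_with_cos (1 / PI) 1 0 = asin (1 / PI) + sqrt (PI ^ 2 - 1) - PI).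
{ unfold gap_with_cos. rewrite -cos_asin_inv_PI. field. lra. }
assert (E3 : 1 - 2 * PI * (1 / PI) = -1) by (field; lra).
assert (E4 : 2 * PI * (1 / PI) - 1 = 1) by (field; lra).
unfold length_lower, length_upper, critical_length. rewrite E1 E2 E3 E4 Ropp_0.
replace (2 * PI - PI) with PI by ring.
rewrite -K2 -K1 -!sqrt_over_bias. split; field; lra.
Qed.

Lemma half_length_lim_critical (h : R -> R) :
  (forall g, bias g -> exists s v, - vmax g <= v <= vmax g /\ h g = outer g s v / (2 * g)) ->
  filterlim h (at_left (1 / PI)) (locally critical_length).
Proof.
intros Hh. assert (HP := PI_gt_3).
assert (H1 : 0 < 1 / PI) by (apply Rdiv_lt_0_compat; lra).
apply filterlim_locally. intros eps.
destruct length_bounds_critical as [El Eu].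
assert (H0 : 1 / PI <> 0) by lra.
assert (N1 := proj1 (filterlim_locally _ _) (length_lower_continuous (1 / PI) H0) eps).
assert (N2 := proj1 (filterlim_locally _ _) (length_upper_continuous (1 / PI) H0) eps).
assert (Hb : bias (1 / PI)) by (split; [exact H1|apply Rle_refl]).
destruct (bias_asin _ Hb) as [Ha _].
assert (Ev := vmax_inv_PI).
assert (Cd : continuous (fun g => asin g - vmax g) (1 / PI)).
{ apply (continuous_minus asin vmax); [apply continuous_asin|apply vmax_continuous]. }
(* The radius [asin (1 / PI)] is the limit of [asin g - vmax g] itself, so this difference stays
   positive and the whole exit range lies left of the saddle. *)
assert (N3 := proj1 (filterlim_locally _ _) Cd (mkposreal _ (proj1 Ha))).
assert (N4 := open_gt 0 (1 / PI) H1).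
unfold at_left, within.
generalize (filter_and _ _ (filter_and _ _ N1 N2) (filter_and _ _ N3 N4)). apply filter_imp.
intros g [[D1 D2] [D3 D4]] Hg. rewrite El in D1. rewrite Eu in D2. rewrite Ev in D3.
change (Rabs (length_lower g - critical_length) < eps) in D1.
change (Rabs (length_upper g - critical_length) < eps) in D2.
change (Rabs (asin g - vmax g - (asin (1 / PI) - 0)) < asin (1 / PI)) in D3.
apply Rabs_def2 in D1. apply Rabs_def2 in D2. apply Rabs_def2 in D3.
assert (Hbg : bias g) by (split; lra).
destruct (Hh g Hbg) as [s [v [Hv E]]].
assert (B := outer_length_sandwich g v s Hbg ltac:(lra) Hv). rewrite -E in B.
change (Rabs (h g - critical_length) < eps). apply Rabs_def1; lra.
Qed.

(** * Numerical value of the critical length and an example with six fluxons *)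

Lemma PI_bounds : 314 / 100 < PI < 315 / 100.
Proof.
assert (H := PI_2_3_7_ineq 1). unfold PI_2_3_7_tg, tg_alt, Ratan_seq in H.
simpl in H. lra.
Qed.

Lemma critical_length_approx : Rabs (critical_length - 18 / 10) < 5 / 100.
Proof.
assert (HP := PI_bounds).
set (B := sqrt (PI ^ 2 - 1)).
assert (EB : B ^ 2 = PI ^ 2 - 1) by (unfold B; rewrite -Rsqr_pow2 Rsqr_sqrt; nra).
assert (PB : 0 <= B) by apply sqrt_pos.
assert (B1 : 2976 / 1000 < B < 2988 / 1000) by (split; nra).
(* The small difference PI - B is bounded through its product with PI + B; subtracting the separate
   bounds would lose too much precision. *)
assert (EP : (PI - B) * (PI + B) = 1) by nra.
assert (B2 : 1629 / 10000 < PI - B < 1636 / 10000) by (split; nra).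
assert (Hi : 3174 / 10000 < 1 / PI < 3185 / 10000).
{ split; [apply -> (Rlt_div_r (3174 / 10000) 1 PI); lra|].
  apply <- (Rlt_div_l 1 (3185 / 10000) PI); lra. }
assert (Es : sin (asin (1 / PI)) = 1 / PI) by (apply sin_asin; lra).
assert (Hb := asin_bound (1 / PI)).
assert (A1 : 3174 / 10000 < asin (1 / PI)).
{ destruct (Rlt_dec 0 (asin (1 / PI))) as [H|H].
  - assert (K := sin_lt_x _ H). lra.
  - assert (sin (asin (1 / PI)) <= 0); [|lra].
    rewrite -sin_0. apply sin_incr_1; lra. }
assert (A2 : asin (1 / PI) < 33 / 100).
{ apply sin_increasing_0; try lra. rewrite Es.
  assert (K := sin_bound (33 / 100) 0 ltac:(lra) ltac:(lra)).
  unfold sin_approx, sin_term in K. simpl in K. lra. }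
set (A := asin (1 / PI)) in *.
unfold critical_length. fold A B.
assert (S1 : 2274 / 1000 < sqrt (PI / 2 * (A + B)) < 2287 / 1000).
{ split.
  - rewrite -(sqrt_Rsqr (2274 / 1000)); [|lra]. apply sqrt_lt_1_alt. unfold Rsqr. split; [lra|nra].
  - rewrite -(sqrt_Rsqr (2287 / 1000)); [|lra]. apply sqrt_lt_1_alt. unfold Rsqr. split; nra. }
assert (S2 : 490 / 1000 < sqrt (PI / 2 * (A + B - PI)) < 514 / 1000).
{ split.
  - rewrite -(sqrt_Rsqr (490 / 1000)); [|lra]. apply sqrt_lt_1_alt. unfold Rsqr. split; [lra|nra].
  - rewrite -(sqrt_Rsqr (514 / 1000)); [|lra]. apply sqrt_lt_1_alt. unfold Rsqr. split; nra. }
apply Rabs_def1; lra.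
Qed.

Lemma one_minus_cos_le (x : R) : 0 <= x -> 1 - cos x <= x ^ 2 / 2.
Proof.
intros [Hx|<-]; [|rewrite cos_0; lra].
replace x with (2 * (x / 2)) at 1 by field. rewrite cos_2a_sin.
assert (H := sin_lt_x (x / 2) ltac:(lra)).
destruct (Rle_dec 0 (sin (x / 2))) as [H0|H0]; [nra|].
destruct (Rle_dec x 2) as [H2|H2].
- exfalso. apply H0. apply sin_ge_0; [lra|]. assert (K := PI_gt_3). lra.
- assert (B := SIN_bound (x / 2)). nra.
Qed.

(** On each side there are three arcs: the outer one left of the saddle, the loop, and the hump with
    positive exit slope. Each joins an end with u = PI, where the length is below 4, to a point with
    exit speed zero (saddle or turning point), where it is above 4. *)
Lemma six_fluxons : at_least_fluxons 6 4 (1 / 1000) 0.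
Proof.
assert (HPI := PI_bounds).
set (g := 1 / 1000).
assert (Hg : bias g) by (split; unfold g; [lra|apply -> (Rle_div_r (1 / 1000) 1 PI); lra]).
destruct (top_exists g Hg) as [m Hm].
destruct (bias_asin g Hg) as [Ha [_ Hc]]. destruct (vmax_bound g Hg) as [B1 B2].
assert (Hm' := proj1 Hm).
assert (Cv := cos_vmax g Hg).
assert (Hv2 : PI / 2 <= vmax g).
{ apply Rnot_lt_le. intros H. assert (0 < cos (vmax g)) by (apply cos_gt_0; lra).
  unfold g in *. lra. }
set (l := 2 * g * 4).
assert (Hl : l = 8 / 1000) by (unfold l, g; lra).
assert (Hg' : g = 1 / 1000) by reflexivity.
assert (GP : 189 / 100 <= gap g PI).
{ unfold gap. rewrite cos_PI. nra. }
assert (MP : 19 / 10 <= mom g PI).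
{ rewrite -(sqrt_Rsqr (19 / 10)); [|lra]. apply sqrt_le_1_alt. unfold Rsqr. lra. }
assert (GH : 1 <= gap g (2 * PI - vmax g)).
{ unfold gap. rewrite cos_2PI_minus Cv. nra. }
assert (MH : 1 <= mom g (2 * PI - vmax g)).
{ rewrite -sqrt_1. apply sqrt_le_1_alt. lra. }
assert (Hbm : 2 * PI - vmax g <= m).
{ apply (le_top g); [easy|easy|lra|lra]. }
(* At u = PI the speed difference is 2 g (PI + v) / (mom PI + mom v), so comparing it with l = 2 g 4
   is the numerical inequality negated in the second alternative. *)
assert (End : forall v s, cos v = cos (vmax g) -> 0 <= gap g v -> entry_mom g s v - mom g v < l \/
  ~ (PI + v < 4 * (mom g PI + mom g v))).
{ intros v s Ec Gv. destruct (Rlt_dec (PI + v) (4 * (mom g PI + mom g v))) as [H|H]; [left|now right].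
  assert (Ep : entry_mom g s v = mom g PI).
  { unfold entry_mom. destruct (entry_side_ends g v Hg Ec) as [T1 T2].
    destruct s; [now rewrite T1|now rewrite T2]. }
  rewrite Ep. assert (E := mom_match g PI v ltac:(lra) Gv).
  rewrite cos_PI Ec Cv in E. specialize (E ltac:(ring)).
  assert (M := mom_ge_0 g v). apply Rnot_le_lt. intros Hn. nra. }
assert (Ov : forall s, outer g s (- vmax g) < l).
{ intros s. unfold outer. rewrite smom_lt; [|lra].
  assert (M := mom_ge_0 g (- vmax g)).
  assert (G := gap_pos_left g (- vmax g) Hg ltac:(lra)).
  destruct (End (- vmax g) s (cos_neg _) ltac:(lra)) as [H|H]; [lra|exfalso; apply H; lra]. }
assert (Lv : forall s, loop g s (vmax g) < l).
{ intros s. assert (M := mom_ge_0 g (vmax g)).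
  assert (G := gap_pos g (vmax g) Hg ltac:(lra) ltac:(lra)).
  destruct (End (vmax g) s (eq_refl _) ltac:(lra)) as [H|H]; [easy|exfalso; apply H; lra]. }
assert (Hv : forall s, loop g s (2 * PI - vmax g) < l).
{ intros s. destruct (End (2 * PI - vmax g) s (cos_2PI_minus _) ltac:(lra)) as [H|H];
    [easy|exfalso; apply H; lra]. }
(* With exit speed zero the squared entry speed is 2 g (2 PI + v - u) >= 2/10000, against l^2 =
   64/1000000. *)
assert (Big : forall s v, exit_angle g m v -> gap g v = 0 -> 1 / 10 <= 2 * PI + v - entry_side g s v ->
  l < entry_mom g s v).
{ intros s v Hx Gv Hd. destruct (entry_side_facts g m v s Hg Hm Hx) as [_ [E _]].
  assert (M := gap_match g _ _ E). unfold entry_mom.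
  rewrite -(sqrt_Rsqr l); [|lra]. apply sqrt_lt_1_alt. unfold Rsqr. rewrite Hl. nra. }
assert (Xa : exit_angle g m (asin g)) by (left; lra).
assert (Xm : exit_angle g m m) by (right; lra).
(* An entry angle below 1/10 would give 1 - cos < 1/200, but 1 - cos is at least 2 PI g > 6/1000. *)
assert (Ea : 1 / 10 <= entry g (asin g)).
{ apply Rnot_lt_le. intros Hn. assert (B := entry_bound g (asin g)).
  assert (K := one_minus_cos_le (entry g (asin g)) ltac:(lra)).
  rewrite cos_entry in K; [|easy|apply cos_ge_vmax; [easy|lra]].
  assert (Bc := COS_bound (asin g)). nra. }
assert (Oa : forall s, l < entry_mom g s (asin g)).
{ intros s. apply Big; [easy|apply gap_asin|]. assert (B := entry_bound g (asin g)). destruct s; simpl; lra. }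
assert (Om : forall s, l < entry_mom g s m).
{ intros s. apply Big; [easy|apply Hm|]. assert (B := entry_bound g m). destruct s; simpl; lra. }
assert (M0 : mom g (asin g) = 0) by (apply mom_0, gap_asin).
assert (Mm : mom g m = 0) by (apply mom_0, Hm).
assert (FO : forall s, exists phi v, pinned_fluxon 4 g 0 phi /\
  phi (- (4)) = entry_side g s v /\ phi 4 = v + 2 * PI /\ v < asin g /\ entry g v < PI).
{ intros s. destruct (ivt_between (outer g s) (- vmax g) (asin g) l) as [v [Hx E]].
  - apply outer_continuous.
  - lra.
  - left. specialize (Ov s). specialize (Oa s). unfold outer in *. rewrite (smom_ge g (asin g)); lra.
  - assert (v <> asin g).
    { intros ->. specialize (Oa s). unfold outer in E. rewrite smom_ge in E; lra. }
    assert (v <> - vmax g). { intros ->. specialize (Ov s). lra. }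
    destruct (outer_fluxon_exists g 4 v s Hg ltac:(lra) E) as [_ [phi [P1 [P2 P3]]]].
    exists phi, v. repeat (split; [easy || lra|]).
    apply entry_lt_PI, (exit_interior_cos g m); [easy|easy|easy|left; lra]. }
assert (FL : forall s a b, asin g <= a <= b -> (forall v, a < v < b -> exit_interior g m v) ->
  loop g s a < l < loop g s b \/ loop g s b < l < loop g s a ->
  exists phi v, pinned_fluxon 4 g 0 phi /\
  phi (- (4)) = entry_side g s v /\ phi 4 = v + 2 * PI /\ a < v < b /\ entry g v < PI).
{ intros s a b Hab Hi Hlab. destruct (ivt_between (loop g s) a b l) as [v [Hx E]].
  - apply loop_continuous.
  - lra.
  - lra.
  - assert (v <> a). { intros ->. lra. }
    assert (v <> b). { intros ->. lra. }
    assert (Hv' := Hi v ltac:(lra)). assert (Hv'' := exit_interior_angle g m v Hv').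
    destruct (fluxon_exists g m 4 v (mom g v) s Hg Hm Hv'') as [_ [phi [P1 [P2 P3]]]].
    + apply mom_sq, (gap_ge_0 g m), (exit_angle_facts g m v Hg Hm Hv''); easy.
    + lra.
    + exact E.
    + exists phi, v. repeat (split; [easy || lra|]).
      apply entry_lt_PI, (exit_interior_cos g m); easy. }
assert (FA : forall s, loop g s (asin g) = entry_mom g s (asin g)).
{ intros s. unfold loop. lra. }
assert (FM : forall s, loop g s m = entry_mom g s m).
{ intros s. unfold loop. lra. }
destruct (FO true) as [p1 [v1 [P1 [U1 [V1 [I1 S1]]]]]].
destruct (FO false) as [p2 [v2 [P2 [U2 [V2 [I2 S2]]]]]].
destruct (FL true (asin g) (vmax g)) as [p3 [v3 [P3 [U3 [V3 [I3 S3]]]]]].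
{ lra. } { intros v Hx. left; lra. } { right. now rewrite FA. }
destruct (FL false (asin g) (vmax g)) as [p4 [v4 [P4 [U4 [V4 [I4 S4]]]]]].
{ lra. } { intros v Hx. left; lra. } { right. now rewrite FA. }
destruct (FL true (2 * PI - vmax g) m) as [p5 [v5 [P5 [U5 [V5 [I5 S5]]]]]].
{ lra. } { intros v Hx. right; lra. } { left. now rewrite FM. }
destruct (FL false (2 * PI - vmax g) m) as [p6 [v6 [P6 [U6 [V6 [I6 S6]]]]]].
{ lra. } { intros v Hx. right; lra. } { left. now rewrite FM. }
simpl in U1, U2, U3, U4, U5, U6.
exists (p1 :: p2 :: p3 :: p4 :: p5 :: p6 :: nil). split; [|split; [|easy]].
(* The value at 4 tells the three disjoint ranges of [v] apart, and the value at -4, below or above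
   PI, tells the two sides apart. *)
- repeat constructor; simpl; intros H; repeat destruct H as [H|H]; try easy;
    assert (Q1 := f_equal (fun f : R -> R => f 4) H);
    assert (Q2 := f_equal (fun f : R -> R => f (- (4))) H); simpl in Q1, Q2; lra.
- repeat (constructor; [assumption|]). constructor.
Qed.

Theorem theorem3 :
  (exists Lmin Lmax : R -> R,
    (forall gamma : R, 0 < gamma <= 1 / PI ->
       is_minimum (pinning_half_length gamma 0) (Lmin gamma) /\
       is_maximum (pinning_half_length gamma 0) (Lmax gamma) /\
       (forall L : R, Lmin gamma < L < Lmax gamma ->
          at_least_fluxons 2 L gamma 0) /\
       at_least_fluxons 1 (Lmin gamma) gamma 0 /\
       at_least_fluxons 1 (Lmax gamma) gamma 0) /\
    filterlim Lmin (at_right 0) (locally 0) /\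
    filterlim Lmax (at_right 0) (Rbar_locally p_infty) /\
    (let Lstar :=
       sqrt (PI / 2 * (asin (1 / PI) + sqrt (PI ^ 2 - 1)))
       - sqrt (PI / 2 * (asin (1 / PI) + sqrt (PI ^ 2 - 1) - PI)) in
     filterlim Lmin (at_left (1 / PI)) (locally Lstar) /\
     filterlim Lmax (at_left (1 / PI)) (locally Lstar) /\
     Rabs (Lstar - 18 / 10) < 5 / 100) /\
    (forall gamma L : R, 0 < gamma <= 1 / PI ->
       Lmin gamma <= L <= Lmax gamma ->
       forall n : nat, at_least_fluxons n L gamma 0 -> (n <= 6)%nat) /\
    (exists gamma L : R, 0 < gamma <= 1 / PI /\
       Lmin gamma <= L <= Lmax gamma /\ at_least_fluxons 6 L gamma 0)) /\
  (forall gamma L : R, 1 / PI < gamma <= 1 -> 0 < L ->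
     ~ exists phi : R -> R, pinned_fluxon L gamma 0 phi).
Proof.
split; [|exact energy_no_fluxon].
exists min_half_length, max_half_length.
split; [|split; [|split; [|split; [|split]]]].
- intros g Hg. destruct (half_lengths_spec g Hg) as [H1 [H2 [H3 _]]].
  repeat split; try apply H1; try apply H2; auto.
  + destruct H1 as [[_ [phi H]] _]. now apply (at_least_one g _ phi).
  + destruct H2 as [[_ [phi H]] _]. now apply (at_least_one g _ phi).
- exact min_half_length_lim_0.
- exact max_half_length_lim_0.
- split; [|split; [|exact critical_length_approx]].
  + apply half_length_lim_critical. intros g Hg.
    destruct (half_lengths_spec g Hg) as [_ [_ [_ [[v Hv] _]]]]. now exists false, v.
  + apply half_length_lim_critical. intros g Hg.
    destruct (half_lengths_spec g Hg) as [_ [_ [_ [_ [v Hv]]]]]. now exists true, v.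
- intros g L Hg HL n. apply fluxon_count_le_6; [easy|].
  assert (P := min_half_length_pos g Hg). lra.
- assert (HP := PI_bounds).
  assert (Hg : bias (1 / 1000)) by (split; [lra|apply -> (Rle_div_r (1 / 1000) 1 PI); lra]).
  exists (1 / 1000), 4. split; [exact Hg|]. split; [|exact six_fluxons].
  destruct (half_lengths_spec _ Hg) as [[_ H1] [[_ H2] _]].
  destruct six_fluxons as [l [_ [HF El]]]. destruct l as [|phi l]; [easy|].
  inversion_clear HF as [|? ? Hphi _].
  assert (pinning_half_length (1 / 1000) 0 4) by (split; [lra|now exists phi]).
  split; auto.
Qed.
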